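(* Let $0<a<b$, $N\in\mathbb{N}$, $l=(l_1,\dots,l_N)\in\mathbb{R}^N$ with $l_1<\dots<l_N$, and $\alpha=(\alpha_1,\dots,\alpha_N)\in(0,\infty)^N$ be such that $$f_{a,b,N,\alpha,l}(x):=\frac{\sqrt{(b-x)(x-a)}}{x}\sum_{k=1}^N\frac{\alpha_k}{x^{l_k}}\,1_{(a,b)}(x)$$ satisfies $\int_a^b f_{a,b,N,\alpha,l}(x)\,dx=1$. Suppose that a random variable $X$ has distribution $\mathrm{GPFP}(a,b,N,\alpha,l):=f_{a,b,N,\alpha,l}(x)\,dx$. If there is some $t\ge 0$ such that $l_k\in[t,t+1]$ for all $k=1,\dots,N$, then for every real $r\ge 1$ the distribution of $X^r$ belongs to the class UI.
   Context: $X$ is a positive random variable; the distribution of $X^r$ is the push-forward of the distribution of $X$ under $x\mapsto x^r$. For a probability measure $\mu$ on $\mathbb{R}$ the Cauchy transform is $G_\mu(z)=\int_{\mathbb{R}}\frac{1}{z-x}\,d\mu(x)$, which is analytic on the upper half-plane $\mathbb{C}^+$. For every $\gamma>0$ there exist $\lambda,M,\delta>0$ such that $G_\mu$ is univalent (injective analytic) on $\Gamma_{\lambda,M}=\{z\in\mathbb{C}^+:\lambda|\mathrm{Re}(z)|<\mathrm{Im}(z),\ \mathrm{Im}(z)>M\}$ and $G_\mu(\Gamma_{\lambda,M})$ contains $\Lambda_{\gamma,\delta}=\{z\in\mathbb{C}^-:\gamma|\mathrm{Re}(z)|<-\mathrm{Im}(z),\ \mathrm{Im}(z)>-\delta\}$,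 where $\mathbb{C}^-$ is the lower half-plane. Hence a right inverse $G_\mu^{-1}$ is defined on $\Lambda_{\gamma,\delta}$. Class UI (Univalent Inverse Cauchy transform): $\mu$ belongs to UI if the right inverse $G_\mu^{-1}$, originally defined on a triangular domain $\Lambda_{\gamma,\delta}$, has a univalent analytic continuation to all of $\mathbb{C}^-$. *)

(* Defs.v *)
From HB Require Import structures.
From mathcomp Require Import all_boot all_order all_algebra.
From mathcomp Require Import all_classical all_reals all_analysis.
From mathcomp.real_closed Require Export complex.

Set Implicit Arguments.
Unset Strict Implicit.
Unset Printing Implicit Defensive.

Import Order.TTheory GRing.Theory Num.Theory.
Import numFieldNormedType.Exports.

Local Open Scope classical_set_scope.
Local Open Scope ring_scope.

Section ComplexPlane.
Context {R : realType}.
Implicit Types (D : set R[i]) (f : R[i] -> R[i]).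

Definition lower_half_plane : set R[i] := [set z | complex.Im z < 0].

Definition Gamma_domain (lambda M : R) : set R[i] :=
  [set z | [/\ 0 < complex.Im z,
               lambda * `|complex.Re z| < complex.Im z & M < complex.Im z]].

Definition Lambda_domain (gamma delta : R) : set R[i] :=
  [set z | [/\ complex.Im z < 0,
               gamma * `|complex.Re z| < - complex.Im z & - delta < complex.Im z]].

(* The increment in [derivable] ranges over the scalar field R[i] of the
   normed module R[i]^o, so differentiability in direction 1 is complex
   differentiability; D is meant to be open. *)
Definition analytic_on D f : Prop :=
  forall z, D z -> derivable (f : R[i]^o -> R[i]^o) z 1.

Definition univalent_on D f : Prop := analytic_on D f /\ set_inj D f.

End ComplexPlane.

Section UnivalentInverseCauchyTransform.
Context {R : realType}.
Variable mu : probability R R.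

(* There is no integral of complex-valued functions in the library: real and
   imaginary parts are integrated separately. *)
Definition cauchy_transform (z : R[i]) : R[i] :=
  Complex (\int[mu]_x complex.Re ((z - x%:C%C)^-1))
          (\int[mu]_x complex.Im ((z - x%:C%C)^-1)).

(* H is the right inverse of the Cauchy transform on Lambda_(gamma, delta)
   obtained from its univalence on some Gamma_(lambda, M). *)
Definition cauchy_right_inverse (gamma delta : R) (H : R[i] -> R[i]) : Prop :=
  exists lambda M : R,
    [/\ 0 < lambda, 0 < M,
        univalent_on (Gamma_domain lambda M) cauchy_transform,
        Lambda_domain gamma delta
          `<=` cauchy_transform @` Gamma_domain lambda M &
        forall w, Lambda_domain gamma delta w ->
          Gamma_domain lambda M (H w) /\ cauchy_transform (H w) = w].

(* By the identity theorem the choice of gamma, delta and of the domain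
   Gamma_(lambda, M) is immaterial. *)
Definition class_UI : Prop :=
  exists (gamma delta : R) (H F : R[i] -> R[i]),
    [/\ 0 < gamma, 0 < delta, cauchy_right_inverse gamma delta H,
        univalent_on lower_half_plane F &
        forall w, Lambda_domain gamma delta w -> F w = H w].

End UnivalentInverseCauchyTransform.

Section GPFP.
Context {R : realType} (a b : R) {N : nat} (alpha l : 'I_N -> R).

Definition GPFP_pdf (x : R) : R :=
  Num.sqrt ((b - x) * (x - a)) / x
  * (\sum_(k < N) alpha k / x `^ l k) * \1_`]a, b[ x.

Definition GPFP (A : set R) : \bar R :=
  (\int[lebesgue_measure]_(x in A) (GPFP_pdf x)%:E)%E.

End GPFP.

Section PowerOfRandomVariable.
Context {d : measure_display} {T : measurableType d} {R : realType}
  {P : probability T R}.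

(* Only meaningful when X > 0 almost surely: powR takes conventional values at
   nonpositive arguments. *)
Definition RV_powR (X : {RV P >-> R}) (r : R) : T -> R := fun w => X w `^ r.

Lemma measurable_RV_powR (X : {RV P >-> R}) (r : R) :
  measurable_fun setT (RV_powR X r).
Proof. exact: (@measurableT_comp _ _ _ _ _ _ (@powR R ^~ r)). Qed.

HB.instance Definition _ (X : {RV P >-> R}) (r : R) :=
  isMeasurableFun.Build _ _ _ _ (RV_powR X r) (measurable_RV_powR X r).

End PowerOfRandomVariable.

(* Main.v *)
Require Import Defs.
From mathcomp Require Import all_boot all_order all_algebra.
From mathcomp Require Import all_classical all_reals all_analysis.
From mathcomp Require Import measurable_realfun ring lra.
Import Order.TTheory GRing.Theory Num.Theory.
Import numFieldNormedType.Exports.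
Local Open Scope classical_set_scope.
Local Open Scope ring_scope.
Set Implicit Arguments.
Unset Strict Implicit.
Unset Printing Implicit Defensive.

(** The Cauchy transform [G] of the law of [X^r] is continued analytically
through the cut, the continuation is shown to take every value of the lower
half-plane exactly once, and the inverse of the continuation is then the
univalent extension of the inverse of [G].

The continuation is explicit. Put [z = e^(r u)]. After the change of variables
[x -> x^r] the transform is a sum over [k] of
[alpha k * e^(- m u) * int s(x)/x * e^(m w) / (e^(r w) - 1) dx], with
[w = u - ln x], [m = l k + r] and [s(x) = sqrt ((b - x)(x - a))]. The kernel
[e^(m w) / (e^(r w) - 1)] differs from [(1/r) / (e^w - 1)] by a function which
is analytic in the strip [|Im u| < pi / r], and the integral of
[s(x)/x / (e^w - 1)] is the Cauchy transform of the semicircle at [e^u]. A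
linear differential equation identifies the latter as
[K (zeta - c) - i K sqrt ((b - zeta)(zeta - a))] above the cut, and with the
opposite sign of the root below. Keeping one branch of the root therefore
continues the transform from the upper half-plane through the cut to the strip
[- phi < Im u < pi / r] with two slits on the real axis ([log_domain],
[continued]); below the cut it exceeds the original transform by
[- 2 i (K/r) sqrt ((b - zeta)(zeta - a))] times the sum of the [alpha k e^(- m u)].

The angle [phi = pi / (t + r)] is such that [(m - 1) phi <= pi <= m phi] for all
[k]; this is where [l k] in [[t, t + 1]] is used. These inequalities give the
excess a nonnegative imaginary part, in the limit, along the lower edge of the
strip ([root_scale_edge]) and far to the right. At the rest of the boundary the
continuation is asymptotically real or has nonnegative imaginary part, except
far to the left below the axis, where it is unbounded. Hence the continuation is
proper onto the lower half-plane ([continued_lower_proper]).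

Such a map takes all values of the lower half-plane equally often, and one
value is enough to see that this happens once ([degree_one]). Instead of the
argument principle this rests on the maximum principle: uniqueness and
simplicity of a preimage [u] of [w] are equivalent to an inequality
([sole_preimage]) which is stable under small changes of [w] and under limits.
The one value is found far to the left, where the continuation is equivalent to
a multiple of [e^(- m u)] for the largest exponent [m] ([start_point]).

The inverse [u] of the continuation is analytic and [e^(r u)] is injective on
the strip, so [F w = e^(r u(w))] is univalent ([inverse_univalent]). Near the
origin a value [w] is taken by [G] close to [1/w], because [G z] is close to
[1/z] at infinity; as it has only one preimage, [F] is the inverse of [G] there
([transform_univalent_inverse]). *)

(** * Complex numbers and their modulus *)

(* the modulus with values in [R] rather than in [R[i]] *)
Notation cmod := Normc.normc.
Notation Re := complex.Re.
Notation Im := complex.Im.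

Section Modulus.
Context {R : realType}.
Implicit Types (x y : R) (z w : R[i]).

Lemma cmodE z : cmod z = Num.sqrt (Re z ^+ 2 + Im z ^+ 2).
Proof. by case: z. Qed.

Lemma cmod_sqr z : cmod z ^+ 2 = Re z ^+ 2 + Im z ^+ 2.
Proof. by rewrite cmodE sqr_sqrtr // addr_ge0 // sqr_ge0. Qed.

Lemma cmod_ge0 z : 0 <= cmod z.
Proof. by rewrite cmodE sqrtr_ge0. Qed.

Lemma cmodM z w : cmod (z * w) = cmod z * cmod w.
Proof. exact: Normc.normcM. Qed.

Lemma cmodV z : cmod z^-1 = (cmod z)^-1.
Proof. exact: Normc.normcV. Qed.

Lemma cmodN z : cmod (- z) = cmod z.
Proof. exact: normcN. Qed.

Lemma cmodD z w : cmod (z + w) <= cmod z + cmod w.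
Proof. exact: le_normcD. Qed.

Lemma cmod0 : cmod (0 : R[i]) = 0.
Proof. exact: Normc.normc0. Qed.

Lemma cmod1 : cmod (1 : R[i]) = 1.
Proof. exact: Normc.normc1. Qed.

Lemma cmodX z n : cmod (z ^+ n) = cmod z ^+ n.
Proof. by elim: n => [|n IH]; rewrite ?cmod1 // !exprS cmodM IH. Qed.

Lemma cmod_eq0 z : (cmod z == 0) = (z == 0).
Proof.
by apply/eqP/eqP => [/Normc.eq0_normc|->] //; exact: cmod0.
Qed.

Lemma cmod_gt0 z : (0 < cmod z) = (z != 0).
Proof. by rewrite lt_neqAle cmod_ge0 andbT eq_sym cmod_eq0. Qed.

Lemma cmodB z w : cmod (z - w) = cmod (w - z).
Proof. by rewrite -cmodN opprB. Qed.

Lemma cmod_lerB z w : cmod z - cmod w <= cmod (z - w).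
Proof. by have := cmodD (z - w) w; rewrite subrK; lra. Qed.

Lemma cmod_real x : cmod (x%:C)%C = `|x|.
Proof. by rewrite cmodE /= expr0n addr0 sqrtr_sqr. Qed.

Lemma cmod_Re z : `|Re z| <= cmod z.
Proof.
by rewrite cmodE -sqrtr_sqr ler_wsqrtr // lerDl sqr_ge0.
Qed.

Lemma cmod_Im z : `|Im z| <= cmod z.
Proof.
by rewrite cmodE -sqrtr_sqr ler_wsqrtr // lerDr sqr_ge0.
Qed.

Lemma cmod_le z : cmod z <= `|Re z| + `|Im z|.
Proof.
rewrite -(ler_pXn2r (_ : 0 < 2)%N) ?nnegrE ?cmod_ge0 ?addr_ge0 //.
rewrite cmod_sqr sqrrD !real_normK ?num_real //.
have : 0 <= `|Re z| * `|Im z| *+ 2 by rewrite mulrn_wge0 // mulr_ge0.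
lra.
Qed.

Lemma ReD z w : Re (z + w) = Re z + Re w. Proof. by case: z; case: w. Qed.
Lemma ImD z w : Im (z + w) = Im z + Im w. Proof. by case: z; case: w. Qed.
Lemma ReN z : Re (- z) = - Re z. Proof. by case: z. Qed.
Lemma ImN z : Im (- z) = - Im z. Proof. by case: z. Qed.
Lemma ReM z w : Re (z * w) = Re z * Re w - Im z * Im w.
Proof. by case: z; case: w. Qed.
Lemma ImM z w : Im (z * w) = Re z * Im w + Im z * Re w.
Proof. by case: z => a b; case: w => c d /=; rewrite addrC. Qed.
Lemma Re_real x : Re (x%:C)%C = x. Proof. by []. Qed.
Lemma Im_real x : Im (x%:C)%C = 0. Proof. by []. Qed.
Lemma ReC x y : Re (Complex x y) = x. Proof. by []. Qed.
Lemma ImC x y : Im (Complex x y) = y. Proof. by []. Qed.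
Lemma Re_sum (I : Type) (s : seq I) (F : I -> R[i]) :
  Re (\sum_(i <- s) F i) = \sum_(i <- s) Re (F i).
Proof. by elim/big_rec2 : _ => // i y z _; rewrite ReD => <-. Qed.
Lemma Im_sum (I : Type) (s : seq I) (F : I -> R[i]) :
  Im (\sum_(i <- s) F i) = \sum_(i <- s) Im (F i).
Proof. by elim/big_rec2 : _ => // i y z _; rewrite ImD => <-. Qed.
Lemma cmod_sum (I : Type) (s : seq I) (F : I -> R[i]) :
  cmod (\sum_(i <- s) F i) <= \sum_(i <- s) cmod (F i).
Proof.
elim/big_rec2 : _ => [|i y z _ H]; first by rewrite cmod0.
by apply: (le_trans (cmodD _ _)); rewrite lerD2l.
Qed.

Lemma complex_eqP z w : Re z = Re w -> Im z = Im w -> z = w.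
Proof. by case: z w => a b [c d] /= -> ->. Qed.

End Modulus.

Definition ReImE := (@ReC, @ImC, @Re_real, @Im_real, @ReD, @ImD, @ReN, @ImN,
  @ReM, @ImM).

(** * Expansions to second order, uniformly in families *)

Section Expansions.
Context {R : realType}.
Local Notation C := R[i].

(** Analyticity is encoded as an expansion to second order with a cubic
remainder. This form passes to products and inverses and, being uniform in a
family, to integrals over the parameter of the family; and the second order
term is what the proof of the maximum principle needs. *)
Definition unif_expansion {I : Type} (S : set I) (f : I -> C -> C) (z : C)
    (f1 f2 : I -> C) : Prop :=
  exists M d : R, [/\ 1 <= M, 0 < d & forall i, S i ->
    [/\ cmod (f i z) <= M, cmod (f1 i) <= M, cmod (f2 i) <= M &
      forall h, cmod h < d ->
        cmod (f i (z + h) - (f i z + f1 i * h + f2 i * h ^+ 2))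
          <= M * cmod h ^+ 3]].

Definition unif_analytic {I : Type} (S : set I) (f : I -> C -> C) (z : C) :=
  exists f1 f2, unif_expansion S f z f1 f2.

Definition analytic_at (f : C -> C) (z : C) :=
  unif_analytic [set: unit] (fun=> f) z.

Lemma unif_expansion_cst {I : Type} (S : set I) (c : I -> C) (M : R) (z : C) :
  (forall i, S i -> cmod (c i) <= M) ->
  unif_expansion S (fun i _ => c i) z (fun=> 0) (fun=> 0).
Proof.
move=> cM; exists (Num.max 1 M), 1; split=> //; first by rewrite le_max lexx.
move=> i Si; rewrite cmod0 le_max cM // orbT; split=> //.
- by rewrite le_max ler01.
- by rewrite le_max ler01.
move=> h _; rewrite !mul0r !addr0 subrr cmod0.
by rewrite mulr_ge0 ?exprn_ge0 ?cmod_ge0 // le_max ler01.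
Qed.

Lemma unif_expansion_id {I : Type} (S : set I) (z : C) :
  unif_expansion S (fun _ u => u) z (fun=> 1) (fun=> 0).
Proof.
exists (Num.max 1 (cmod z)), 1; split=> //; first by rewrite le_max lexx.
move=> i Si; rewrite cmod0 cmod1; split=> //; rewrite ?le_max ?lexx ?orbT ?ler01 //.
move=> h _; rewrite mul1r mul0r addr0 subrr cmod0.
by rewrite mulr_ge0 ?exprn_ge0 ?cmod_ge0 // le_max ler01.
Qed.

Lemma unif_expansionD {I : Type} (S : set I) (f g : I -> C -> C) z f1 f2 g1 g2 :
  unif_expansion S f z f1 f2 -> unif_expansion S g z g1 g2 ->
  unif_expansion S (fun i u => f i u + g i u) z
    (fun i => f1 i + g1 i) (fun i => f2 i + g2 i).
Proof.
move=> [M [d [M1 d0 Hf]]] [M' [d' [M'1 d'0 Hg]]].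
exists (M + M'), (Num.min d d'); split; [lra|by rewrite lt_min d0 d'0|].
move=> i Si; have [a0 a1 a2 ar] := Hf i Si; have [b0 b1 b2 br] := Hg i Si.
have tri (x y : C) X Y : cmod x <= X -> cmod y <= Y -> cmod (x + y) <= X + Y.
  by have := cmodD x y; lra.
split; [exact: tri..|].
move=> h; rewrite lt_min => /andP[hd hd']; rewrite [leRHS]mulrDl.
have -> : f i (z + h) + g i (z + h) -
   (f i z + g i z + (f1 i + g1 i) * h + (f2 i + g2 i) * h ^+ 2) =
  (f i (z + h) - (f i z + f1 i * h + f2 i * h ^+ 2)) +
  (g i (z + h) - (g i z + g1 i * h + g2 i * h ^+ 2)) by ring.
by apply: tri; [exact: ar|exact: br].
Qed.

Lemma cmod_mul_le (x y : C) (X Y : R) :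
  cmod x <= X -> cmod y <= Y -> cmod (x * y) <= X * Y.
Proof.
by move=> xX yY; rewrite cmodM ler_pM ?cmod_ge0.
Qed.

Lemma cmod_add_le (x y : C) (X Y : R) :
  cmod x <= X -> cmod y <= Y -> cmod (x + y) <= X + Y.
Proof. by have := cmodD x y; lra. Qed.

Lemma unif_expansionM {I : Type} (S : set I) (f g : I -> C -> C) z f1 f2 g1 g2 :
  unif_expansion S f z f1 f2 -> unif_expansion S g z g1 g2 ->
  unif_expansion S (fun i u => f i u * g i u) z
    (fun i => f1 i * g i z + f i z * g1 i)
    (fun i => f2 i * g i z + f1 i * g1 i + f i z * g2 i).
Proof.
move=> [M [d [M1 d0 Hf]]] [M' [d' [M'1 d'0 Hg]]].
exists (10 * (M * M')), (Num.min 1 (Num.min d d')).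
have MM' : 1 <= M * M' by rewrite -[1]mulr1 ler_pM.
split; [lra|by rewrite !lt_min ltr01 d0 d'0|].
move=> i Si; have [a0 a1 a2 ar] := Hf i Si; have [b0 b1 b2 br] := Hg i Si.
have L (x : R) : x <= M * M' -> x <= 10 * (M * M') by lra.
have L2 (x : R) : x <= M * M' + M * M' -> x <= 10 * (M * M') by lra.
have L3 (x : R) : x <= M * M' + M * M' + M * M' -> x <= 10 * (M * M') by lra.
split; [by apply/L/cmod_mul_le|by apply/L2/cmod_add_le; exact/cmod_mul_le| |].
  by apply/L3; do 2?apply/cmod_add_le; exact/cmod_mul_le.
move=> h; rewrite !lt_min => /and3P[h1 hd hd'].
set rf := f i (z + h) - (f i z + f1 i * h + f2 i * h ^+ 2).
set rg := g i (z + h) - (g i z + g1 i * h + g2 i * h ^+ 2).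
have -> : f i (z + h) * g i (z + h) - (f i z * g i z +
   (f1 i * g i z + f i z * g1 i) * h +
   (f2 i * g i z + f1 i * g1 i + f i z * g2 i) * h ^+ 2) =
  h ^+ 3 * (f1 i * g2 i + f2 i * g1 i + h * (f2 i * g2 i)) +
  rf * (g i z + h * (g1 i + h * g2 i) + rg) +
  (f i z + h * (f1 i + h * f2 i)) * rg by rewrite /rf /rg; ring.
have hr : cmod rf <= M * cmod h ^+ 3 by exact: ar.
have hg : cmod rg <= M' * cmod h ^+ 3 by exact: br.
have h3 : cmod (h ^+ 3) <= cmod h ^+ 3 by rewrite cmodX.
have hl : cmod h <= 1 by exact: ltW.
have h0 := cmod_ge0 h.
have h31 : cmod h ^+ 3 <= 1 by rewrite exprn_ile1.
have h30 : 0 <= cmod h ^+ 3 by rewrite exprn_ge0.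
have hg' : cmod rg <= M' by nra.
have e1 := cmod_mul_le h3 (cmod_add_le (cmod_add_le (cmod_mul_le a1 b2)
  (cmod_mul_le a2 b1)) (cmod_mul_le hl (cmod_mul_le a2 b2))).
have e2 := cmod_mul_le hr (cmod_add_le (cmod_add_le b0
  (cmod_mul_le hl (cmod_add_le b1 (cmod_mul_le hl b2)))) hg').
have e3 := cmod_mul_le (cmod_add_le a0 (cmod_mul_le hl (cmod_add_le a1
  (cmod_mul_le hl a2)))) hg.
apply: (le_trans (cmod_add_le (cmod_add_le e1 e2) e3)).
rewrite le_eqVlt; apply/orP; left; apply/eqP; ring.
Qed.

Lemma unif_expansionV {I : Type} (S : set I) (f : I -> C -> C) z f1 f2 (c : R) :
  0 < c -> (forall i, S i -> c <= cmod (f i z)) ->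
  unif_expansion S f z f1 f2 ->
  unif_expansion S (fun i u => (f i u)^-1) z
    (fun i => - f1 i / f i z ^+ 2)
    (fun i => f1 i ^+ 2 / f i z ^+ 3 - f2 i / f i z ^+ 2).
Proof.
move=> c0 cf [M [d [M1 d0 Hf]]].
pose e := Num.min 1 c^-1; pose k := c^-1.
have k0 : 0 < k by rewrite invr_gt0.
pose M2 := 1 + k + M * k ^+ 2 + (M ^+ 2 * k ^+ 3 + M * k ^+ 2).
have p2 : 0 <= M * k ^+ 2 by rewrite mulr_ge0 ?exprn_ge0 //; lra.
have p3 : 0 <= M ^+ 2 * k ^+ 3 by rewrite mulr_ge0 ?exprn_ge0 //; lra.
have M21 : 1 <= M2 by rewrite /M2; lra.
pose K := (M * M2 + M * M2 + M * M2 + M * (M2 + M2 + M2)) * (2 * k).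
have MM2 : 1 <= M * M2 by rewrite -[1]mulr1 ler_pM.
have K0 : 0 <= K by rewrite mulr_ge0 //; nra.
have MK x : x <= M2 -> x <= M2 + K by move: K0; clear; lra.
exists (M2 + K), (Num.min 1 (Num.min d (c / (2 * (3 * M))))).
have M30 : 0 < 2 * (3 * M) by lra.
split; [lra|by rewrite !lt_min ltr01 d0 divr_gt0|].
move=> i Si; have [a0 a1 a2 ar] := Hf i Si; have cfi := cf i Si.
have fi0 : 0 < cmod (f i z) by apply: lt_le_trans cfi.
have f0 : f i z != 0 by rewrite -cmod_gt0.
have b0 : cmod (f i z)^-1 <= k by rewrite cmodV /k lef_pV2 ?posrE.
have bn n : cmod (f i z ^+ n)^-1 <= k ^+ n.
  by rewrite cmodV cmodX -exprVn lerXn2r ?nnegrE -?cmodV ?cmod_ge0 // ltW.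
have bn2 := bn 2; have bn3 := bn 3.
have b1 : cmod (- f1 i / f i z ^+ 2) <= M * k ^+ 2.
  by rewrite mulNr cmodN; exact: cmod_mul_le.
have b2 : cmod (f1 i ^+ 2 / f i z ^+ 3 - f2 i / f i z ^+ 2) <=
   M ^+ 2 * k ^+ 3 + M * k ^+ 2.
  apply: cmod_add_le; last by rewrite cmodN; exact: cmod_mul_le.
  apply: cmod_mul_le => //; rewrite cmodX ler_pXn2r ?nnegrE ?cmod_ge0 //; lra.
have c0' : cmod (f i z)^-1 <= M2 by rewrite /M2; move: b0 p2 p3; clear; lra.
have c1 : cmod (- f1 i / f i z ^+ 2) <= M2.
  by rewrite /M2; move: b1 k0 p2 p3; clear; lra.
have c2 : cmod (f1 i ^+ 2 / f i z ^+ 3 - f2 i / f i z ^+ 2) <= M2.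
  by rewrite /M2; move: b2 k0 p2; clear; lra.
split; [exact: MK..|].
set g0 := (f i z)^-1 in c0' *; set g1 := - f1 i / _ in c1 *.
set g2 := _ - _ in c2 *.
move=> h; rewrite !lt_min => /and3P[h1 hd hc].
set rf := f i (z + h) - (f i z + f1 i * h + f2 i * h ^+ 2).
have hr : cmod rf <= M * cmod h ^+ 3 by exact: ar.
have h3 : cmod (h ^+ 3) <= cmod h ^+ 3 by rewrite cmodX.
have hl : cmod h <= 1 by exact: ltW.
have h0 := cmod_ge0 h.
have h31 : cmod h ^+ 3 <= cmod h by rewrite exprS ler_piMr ?exprn_ile1.
have fz : f i (z + h) = f i z + (h * (f1 i + h * f2 i) + rf).
  by rewrite /rf; ring.
have dl : cmod (h * (f1 i + h * f2 i) + rf) <= c / 2.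
  have hh := cmod_mul_le (lexx (cmod h)) (cmod_add_le a1 (cmod_mul_le hl a2)).
  apply: le_trans (cmod_add_le hh hr) _.
  have hM : cmod h * (3 * M) <= c / 2.
    by move: hc; rewrite ltr_pdivlMr //; clear; lra.
  nra.
have fh : c / 2 <= cmod (f i (z + h)).
  have := cmod_lerB (f i z) (- (h * (f1 i + h * f2 i) + rf)).
  by rewrite cmodN opprK -fz; move: cfi dl; clear; lra.
have fh0 : f i (z + h) != 0 by rewrite -cmod_gt0; move: c0 fh; clear; lra.
have -> : (f i (z + h))^-1 - (g0 + g1 * h + g2 * h ^+ 2) =
  - (h ^+ 3 * (f1 i * g2 + f2 i * g1 + h * (f2 i * g2)) +
   rf * (g0 + h * (g1 + h * g2))) * (f i (z + h))^-1.
  apply: (mulIf fh0); rewrite mulfVK // mulrBl mulVf //.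
  rewrite fz /g0 /g1 /g2; field.
  by rewrite f0.
have Vf : cmod (f i (z + h))^-1 <= 2 * k.
  rewrite cmodV -[2 * k]invrK lef_pV2 ?posrE ?invr_gt0 ?mulr_gt0 ?cmod_gt0 //.
  by rewrite invfM invrK mulrC.
have e1 := cmod_mul_le h3 (cmod_add_le (cmod_add_le (cmod_mul_le a1 c2)
  (cmod_mul_le a2 c1)) (cmod_mul_le hl (cmod_mul_le a2 c2))).
have e2 := cmod_mul_le hr (cmod_add_le c0'
  (cmod_mul_le hl (cmod_add_le c1 (cmod_mul_le hl c2)))).
have e3 := cmod_add_le e1 e2; rewrite -cmodN in e3.
apply: (le_trans (cmod_mul_le e3 Vf)).
apply: (@le_trans _ _ (K * cmod h ^+ 3)).
  by rewrite le_eqVlt; apply/orP; left; apply/eqP; rewrite /K; ring.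
by apply: ler_wpM2r; [exact: exprn_ge0|move: M21; clear; lra].
Qed.

End Expansions.

Section AnalyticAt.
Context {R : realType}.
Local Notation C := R[i].
Implicit Types (f g : C -> C) (z : C).

Lemma analytic_expansion f z : analytic_at f z ->
  exists a b : C, exists M d : R, [/\ 0 <= M, 0 < d & forall h, cmod h < d ->
    cmod (f (z + h) - (f z + a * h + b * h ^+ 2)) <= M * cmod h ^+ 3].
Proof.
move=> [f1 [f2 [M [d [M1 d0 H]]]]]; exists (f1 tt), (f2 tt), M, d.
by split=> //; [lra|move=> h hd; have [_ _ _] := H tt I; exact].
Qed.

Lemma analytic_cst (c : C) z : analytic_at (fun=> c) z.
Proof. by do 2 eexists; apply: (@unif_expansion_cst _ _ _ _ (cmod c)). Qed.

Lemma analytic_id z : analytic_at id z.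
Proof. by do 2 eexists; apply: unif_expansion_id. Qed.

Lemma analyticD f g z : analytic_at f z -> analytic_at g z ->
  analytic_at (fun u => f u + g u) z.
Proof.
move=> [f1 [f2 Hf]] [g1 [g2 Hg]].
by do 2 eexists; exact: (unif_expansionD Hf Hg).
Qed.

Lemma analyticM f g z : analytic_at f z -> analytic_at g z ->
  analytic_at (fun u => f u * g u) z.
Proof.
move=> [f1 [f2 Hf]] [g1 [g2 Hg]].
by do 2 eexists; exact: (unif_expansionM Hf Hg).
Qed.

Lemma analyticV f z : f z != 0 -> analytic_at f z ->
  analytic_at (fun u => (f u)^-1) z.
Proof.
move=> fz [f1 [f2 Hf]]; do 2 eexists; apply: (unif_expansionV _ _ Hf).
  by rewrite -cmod_gt0 in fz; exact: fz.
by [].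
Qed.

Lemma analyticN f z : analytic_at f z -> analytic_at (fun u => - f u) z.
Proof.
move=> fz; have := analyticM (analytic_cst (-1) z) fz.
by under eq_fun do rewrite mulN1r.
Qed.

Lemma analyticB f g z : analytic_at f z -> analytic_at g z ->
  analytic_at (fun u => f u - g u) z.
Proof. by move=> fz gz; apply: analyticD => //; exact: analyticN. Qed.

Lemma analyticX f n z : analytic_at f z -> analytic_at (fun u => f u ^+ n) z.
Proof.
move=> fz; elim: n => [|n IH]; first exact: analytic_cst.
by under eq_fun do rewrite exprS; exact: analyticM.
Qed.

Lemma analytic_sum (J : Type) (s : seq J) (F : J -> C -> C) z :
  (forall j, analytic_at (F j) z) ->
  analytic_at (fun u => \sum_(j <- s) F j u) z.
Proof.
move=> FA; elim: s => [|j s IH].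
  by under eq_fun do rewrite big_nil; exact: analytic_cst.
by under eq_fun do rewrite big_cons; exact: analyticD.
Qed.

Lemma analytic_near f g z (d : R) : 0 < d ->
  (forall v, cmod (v - z) < d -> f v = g v) ->
  analytic_at f z -> analytic_at g z.
Proof.
move=> d0 fg [f1 [f2 [M [e [M1 e0 H]]]]].
have zz : f z = g z by apply: fg; rewrite subrr cmod0.
exists f1, f2, M, (Num.min d e); split => //; first by rewrite lt_min d0.
move=> i Si; have [a0 a1 a2 ar] := H i Si; split => //; rewrite -zz //.
move=> h; rewrite lt_min => /andP[hd he]; rewrite -fg; first exact: ar.
by rewrite addrAC subrr add0r.
Qed.

Definition ccontinuous f z := forall e : R, 0 < e ->
  exists2 d : R, 0 < d & forall v, cmod (v - z) < d -> cmod (f v - f z) < e.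

Lemma analytic_quadratic f z : analytic_at f z ->
  exists a : C, exists K d : R, [/\ 0 <= K, 0 < d & forall v, cmod (v - z) < d ->
    cmod (f v - f z - a * (v - z)) <= K * cmod (v - z) ^+ 2].
Proof.
move=> /analytic_expansion[a [b [M [d [M0 d0 H]]]]].
exists a, (M + cmod b), (Num.min 1 d).
have b0 := cmod_ge0 b; split; [lra|by rewrite lt_min ltr01|].
move=> v; rewrite lt_min => /andP[v1 vd].
have := H (v - z) vd; rewrite [z + _]addrC subrK.
set h := v - z in v1 vd *; move=> Hh.
have -> : f v - f z - a * h =
  (f v - (f z + a * h + b * h ^+ 2)) + b * h ^+ 2 by ring.
have := cmod_add_le Hh (lexx (cmod (b * h ^+ 2))).
rewrite cmodM cmodX => H1; apply: (le_trans H1).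
rewrite mulrDl lerD2r; apply: ler_wpM2l => //.
by rewrite exprS ler_piMl ?exprn_ge0 ?cmod_ge0 // ltW.
Qed.

Lemma analytic_lipschitz f z : analytic_at f z ->
  exists K d : R, [/\ 0 <= K, 0 < d & forall v, cmod (v - z) < d ->
    cmod (f v - f z) <= K * cmod (v - z)].
Proof.
move=> /analytic_quadratic[a [K [d [K0 d0 H]]]].
exists (cmod a + K), (Num.min 1 d).
have a0 := cmod_ge0 a; split; [lra|by rewrite lt_min ltr01|].
move=> v; rewrite lt_min => /andP[v1 vd].
have := cmod_add_le (H v vd) (lexx (cmod (a * (v - z)))).
rewrite subrK cmodM => H1; apply: (le_trans H1).
rewrite mulrDl addrC lerD2l; apply: ler_wpM2l => //.
by rewrite expr2 ler_piMl ?cmod_ge0 // ltW.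
Qed.

Lemma lipschitz_ccontinuous f z (K d : R) : 0 < d ->
  (forall v, cmod (v - z) < d -> cmod (f v - f z) <= K * cmod (v - z)) ->
  ccontinuous f z.
Proof.
move=> d0 H e e0; exists (Num.min d (e / (`|K| + 1))).
  by rewrite lt_min d0 divr_gt0 // ltr_wpDl.
move=> v; rewrite lt_min ltr_pdivlMr ?ltr_wpDl // => /andP[vd ve].
apply: le_lt_trans (H v vd) _; apply: le_lt_trans ve.
rewrite mulrC ler_wpM2l ?cmod_ge0 //.
by have := ler_norm K; lra.
Qed.

Lemma analytic_ccontinuous f z : analytic_at f z -> ccontinuous f z.
Proof.
by move=> /analytic_lipschitz[K [d [K0 d0 H]]]; exact: lipschitz_ccontinuous H.
Qed.

End AnalyticAt.

(** * Compact sets of complex numbers and the maximum principle *)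

Section Compact.
Context {R : realType}.
Local Notation C := R[i].

(** Distances between complex numbers are measured here by the real-valued
modulus, whose topology is that of the plane [R * R]. *)
Definition ccompact (K : set C) :=
  compact [set p : R * R | K (Complex p.1 p.2)].

Lemma near_pairP (p : R * R) (P : set (R * R)) :
  nbhs p P <-> exists2 d : R, 0 < d &
    forall q, cmod (Complex (q.1 - p.1) (q.2 - p.2)) < d -> P q.
Proof.
split.
  move=> /nbhs_ballP[e /= e0 H]; exists e => // q hq; apply: H.
  split; rewrite /ball /= distrC.
    exact: le_lt_trans (cmod_Re (Complex (q.1 - p.1) (q.2 - p.2))) hq.
  exact: le_lt_trans (cmod_Im (Complex (q.1 - p.1) (q.2 - p.2))) hq.
move=> [d d0 H]; apply/nbhs_ballP; exists (d / 2); first by rewrite /= divr_gt0.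
move=> q [] /=; rewrite /ball /= => h1 h2; apply: H.
apply: le_lt_trans (cmod_le _) _ => /=.
by rewrite [`|_ - _|]distrC [`|q.2 - _|]distrC [ltRHS]splitr ltrD.
Qed.

Lemma ccompact_bounded_closed (K : set C) (L : R) :
  (forall u, K u -> cmod u <= L) ->
  (forall u, ~ K u -> exists2 d : R, 0 < d & forall v, cmod (v - u) < d -> ~ K v) ->
  ccompact K.
Proof.
move=> KL Kc.
apply: (@subclosed_compact _ _ (`[- L, L] `*` `[- L, L])).
- rewrite -openC openE => p /= /Kc[d d0 H]; apply/near_pairP.
  by exists d => // q hq /=; exact: H.
- by apply: compact_setX; exact: segment_compact.
- move=> p /= /KL; case: p => x y /= H.
  by split; rewrite /= in_itv /= -ler_norml; apply: le_trans H;
     [exact: (cmod_Re (Complex x y))|exact: (cmod_Im (Complex x y))].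
Qed.

Lemma ccompact_max (K : set C) (phi : C -> R) z1 : ccompact K -> K z1 ->
  (forall z, K z -> forall e : R, 0 < e ->
     exists2 d : R, 0 < d & forall v, cmod (v - z) < d -> `|phi v - phi z| < e) ->
  exists2 z0, K z0 & forall z, K z -> phi z <= phi z0.
Proof.
move=> cK Kz1 cphi.
have [] := @compact_EVT_max _ R (fun p : R * R => phi (Complex p.1 p.2)) _ _ cK.
- by exists (Re z1, Im z1) => /=; case: z1 Kz1.
- apply: continuous_in_subspaceT => p; rewrite inE /= => Kp.
  apply/cvgrPdist_lt => e e0; apply/near_pairP.
  have [d d0 H] := cphi _ Kp e e0; exists d => // q hq /=.
  by rewrite distrC; exact: H.
move=> p /[!inE] Kp H; exists (Complex p.1 p.2) => // -[x y] Kz.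
exact: (H (x, y) (mem_set Kz)).
Qed.

Lemma ccompact_cluster (K : set C) (Q : R -> set C) : ccompact K ->
  (forall e : R, 0 < e -> exists2 u, K u & Q e u) ->
  (forall e e' u, 0 < e -> e <= e' -> Q e u -> Q e' u) ->
  exists2 u, K u & forall e d : R, 0 < e -> 0 < d ->
    exists2 v, cmod (v - u) < d & K v /\ Q e v.
Proof.
move=> cK Qn Qm.
pose F := filter_from [set e : R | 0 < e]
  (fun e => [set p : R * R | K (Complex p.1 p.2) /\ Q e (Complex p.1 p.2)]).
have FF : Filter F.
  apply: filter_from_filter; first by exists 1 => /=.
  move=> e e' /= e0 e'0; exists (Num.min e e') => /=; first by rewrite lt_min e0.
  have m0 : 0 < Num.min e e' by rewrite lt_min e0.
  move=> p /= [Kp Qp]; split; split=> //.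
    by apply: (Qm (Num.min e e')) => //; rewrite ge_min lexx.
  by apply: (Qm (Num.min e e')) => //; rewrite ge_min lexx orbT.
have PF : ProperFilter F.
  apply: filter_from_proper => e /= e0; have [u Ku Qu] := Qn e e0.
  by exists (Re u, Im u) => /=; case: u Ku Qu.
have FK : F [set p : R * R | K (Complex p.1 p.2)].
  by exists 1 => //= p [].
have [p [Kp clp]] := cK F PF FK.
exists (Complex p.1 p.2) => // e d e0 d0.
have := clp [set p | K (Complex p.1 p.2) /\ Q e (Complex p.1 p.2)]
  [set q | cmod (Complex (q.1 - p.1) (q.2 - p.2)) < d].
case.
- by exists e.
- by apply/near_pairP; exists d.
by move=> q [KQ hq]; exists (Complex q.1 q.2).
Qed.

Local Definition cdot (a w : C) : R := Re a * Re w + Im a * Im w.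

Lemma cmod_sqr_ge (a w : C) : 2 * cdot a w - cmod a ^+ 2 <= cmod w ^+ 2.
Proof.
rewrite /cdot !cmod_sqr.
have h1 := sqr_ge0 (Re w - Re a); have h2 := sqr_ge0 (Im w - Im a); nra.
Qed.

Lemma cdot_le (a w : C) : `|cdot a w| <= (`|Re a| + `|Im a|) * cmod w.
Proof.
apply: (le_trans (ler_normD _ _)); rewrite !normrM mulrDl.
by apply: lerD; apply: ler_wpM2l => //; [exact: cmod_Re|exact: cmod_Im].
Qed.

(** The four values at [z + t], [z + it], [z - t], [z - it] of an expansion to
second order have mean [f z] up to [O(t^3)], so that [|f|^2 + e |z|^2], which
gains [4 e t^2] on these points, has no interior maximum. *)
Lemma no_interior_max (f : C -> C) z (e : R) : 0 < e -> analytic_at f z ->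
  ~ (exists2 d : R, 0 < d & forall v, cmod (v - z) < d ->
      cmod (f v) ^+ 2 + e * cmod v ^+ 2 <= cmod (f z) ^+ 2 + e * cmod z ^+ 2).
Proof.
move=> e0 /analytic_expansion[a [b [M [d [M0 d0 H]]]]] [d' d'0 hmax].
pose A := `|Re (f z)| + `|Im (f z)|.
have A0 : 0 <= A by rewrite addr_ge0.
pose K := 2 * A * M + 1.
have K0 : 0 < K by rewrite ltr_wpDl // !mulr_ge0.
pose t := Num.min (Num.min d d') (e / K) / 2.
have t0 : 0 < t by rewrite divr_gt0 // !lt_min d0 d'0 divr_gt0.
have tlt x : t < x -> t < x by [].
have tm : t < Num.min (Num.min d d') (e / K).
  have m0 : 0 < Num.min (Num.min d d') (e / K) by rewrite !lt_min d0 d'0 divr_gt0.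
  by rewrite /t; lra.
move: tm; rewrite !lt_min ltr_pdivlMr // => /andP[/andP[td td'] tK].
have key (s : C) : cmod s = t ->
  2 * cdot (f z) (f z + a * s + b * s ^+ 2) - 2 * A * M * t ^+ 3
    - cmod (f z) ^+ 2 + e * cmod (z + s) ^+ 2
  <= cmod (f z) ^+ 2 + e * cmod z ^+ 2.
  move=> st; have := hmax (z + s); rewrite addrAC subrr add0r st => /(_ td').
  have := H s; rewrite st => /(_ td) Hs.
  have := cmod_sqr_ge (f z) (f (z + s)).
  set r := f (z + s) - _ in Hs.
  have -> : f (z + s) = (f z + a * s + b * s ^+ 2) + r by rewrite /r; ring.
  have -> : cdot (f z) (f z + a * s + b * s ^+ 2 + r) =
     cdot (f z) (f z + a * s + b * s ^+ 2) + cdot (f z) r.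
    by rewrite /cdot !ReImE; ring.
  have : - (A * (M * t ^+ 3)) <= cdot (f z) r.
    rewrite lerNl; apply: le_trans (_ : `|cdot (f z) r| <= _).
      by rewrite -normrN ler_norm.
    by apply: le_trans (cdot_le _ _) _; exact: ler_wpM2l.
  lra.
have ct (x y : R) : x ^+ 2 + y ^+ 2 = t ^+ 2 -> cmod (Complex x y) = t.
  by move=> xy; rewrite cmodE /= xy sqrtr_sqr gtr0_norm.
have key' (p q : R) : p ^+ 2 + q ^+ 2 = t ^+ 2 ->
  2 * (Re (f z) * (Re a * p - Im a * q + Re b * (p ^+ 2 - q ^+ 2)
         - 2 * Im b * p * q) +
       Im (f z) * (Re a * q + Im a * p + Im b * (p ^+ 2 - q ^+ 2)
         + 2 * Re b * p * q)) +
  e * (2 * Re z * p + 2 * Im z * q + t ^+ 2) <= 2 * A * M * t ^+ 3.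
  move=> pq; have := key _ (ct p q pq).
  rewrite !cmod_sqr /cdot ![Complex _ _ ^+ 2]expr2 !ReImE; nra.
have k1 := key' t 0; have k2 := key' 0 t.
have k3 := key' (- t) 0; have k4 := key' 0 (- t).
move: k1 k2 k3 k4; rewrite !sqrrN !expr0n /= !addr0 !add0r.
move=> /(_ erefl) k1 /(_ erefl) k2 /(_ erefl) k3 /(_ erefl) k4.
have : e * (t * t) <= 2 * A * M * t ^+ 3.
  by move: k1 k2 k3 k4; clear; nra.
have tt : 0 < t * t by rewrite mulr_gt0.
have -> : 2 * A * M * t ^+ 3 = (2 * A * M * t) * (t * t) by ring.
rewrite ler_pM2r //; have : t * K = 2 * A * M * t + t by rewrite /K; ring.
lra.
Qed.

(** If [|f|] exceeded [M] somewhere then, for small [e > 0], a maximum point of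
[|f|^2 + e |z|^2] over the compact set would satisfy the second alternative,
and there is no interior maximum. *)
Lemma max_principle (K : set C) (f : C -> C) (M : R) : ccompact K ->
  (forall z, K z -> ccontinuous f z) ->
  (forall z, K z -> cmod (f z) <= M \/ (analytic_at f z /\
     exists2 d : R, 0 < d & forall v, cmod (v - z) < d -> K v)) ->
  forall z, K z -> cmod (f z) <= M.
Proof.
move=> cK fc HK z1 Kz1; rewrite leNgt; apply/negP => Mf.
have M0 : 0 <= M \/ M < 0 by case: (leP 0 M); [left|right].
pose phi (e : R) z := cmod (f z) ^+ 2 + e * cmod z ^+ 2.
have cont_sqr (g : C -> C) z : ccontinuous g z -> forall e : R, 0 < e ->
    exists2 d : R, 0 < d & forall v, cmod (v - z) < d ->
      `|cmod (g v) ^+ 2 - cmod (g z) ^+ 2| < e.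
  move=> gc e e0; have B0 := cmod_ge0 (g z).
  have D0 : 0 < 2 * cmod (g z) + 1 by lra.
  have m0 : 0 < Num.min 1 (e / (2 * cmod (g z) + 1)).
    by rewrite lt_min ltr01 divr_gt0.
  have [d d0 H] := gc _ m0; exists d => // v /H.
  rewrite lt_min ltr_pdivlMr // => /andP[v1 v2].
  have h1 := cmod_lerB (g v) (g z); have h2 := cmod_lerB (g z) (g v).
  rewrite cmodB in h2; have hv := cmod_ge0 (g v); have hd := cmod_ge0 (g v - g z).
  rewrite subr_sqr normrM (ger0_norm (_ : 0 <= cmod (g v) + cmod (g z))); last lra.
  have h3 : `|cmod (g v) - cmod (g z)| <= cmod (g v - g z).
    by rewrite ler_norml; lra.
  apply: le_lt_trans v2; apply: ler_pM => //; lra.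
have cphi e : 0 < e -> forall z, K z -> forall e1 : R, 0 < e1 ->
   exists2 d : R, 0 < d & forall v, cmod (v - z) < d -> `|phi e v - phi e z| < e1.
  move=> e0 z Kz e1 e10.
  have [d d0 H] := cont_sqr f z (fc z Kz) (e1 / 2) (divr_gt0 e10 (ltr0Sn _ 1)).
  have e2 : 0 < (e1 / 2) / e by rewrite !divr_gt0.
  have [d' d'0 H'] := cont_sqr id z (analytic_ccontinuous (analytic_id z)) _ e2.
  exists (Num.min d d'); first by rewrite lt_min d0.
  move=> v; rewrite lt_min => /andP[/H h1 /H' /= h2].
  have -> : phi e v - phi e z = (cmod (f v) ^+ 2 - cmod (f z) ^+ 2) +
    e * (cmod v ^+ 2 - cmod z ^+ 2) by rewrite /phi; ring.
  apply: le_lt_trans (ler_normD _ _) _; rewrite [ltRHS]splitr; apply: ltrD => //.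
  by rewrite normrM gtr0_norm // mulrC -ltr_pdivlMr.
have [B KB] : exists B : R, forall z, K z -> cmod z ^+ 2 <= B.
  have [z0 Kz0 H] := @ccompact_max K (fun z => cmod z ^+ 2) z1 cK Kz1
    (fun z _ => cont_sqr id z (analytic_ccontinuous (analytic_id z))).
  by exists (cmod z0 ^+ 2).
have B0 : 0 <= B by apply: le_trans (KB z1 Kz1); exact: sqr_ge0.
pose M' := Num.max 0 M.
have M'0 : 0 <= M' by rewrite le_max lexx.
have M'f : M' < cmod (f z1) \/ M < 0.
  case: M0 => [M0|]; last by right.
  by left; rewrite /M' max_r.
have gap : M' ^+ 2 < cmod (f z1) ^+ 2 \/ M < 0.
  case: M'f => [h|]; last by right.
  by left; rewrite ltrXn2r // nnegrE cmod_ge0.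
pose e := if M < 0 then 1 else (cmod (f z1) ^+ 2 - M' ^+ 2) / (B + 1).
have e0 : 0 < e.
  rewrite /e; case: ifPn => // Mn; case: gap => [g|]; last by rewrite (negbTE Mn).
  by rewrite divr_gt0; lra.
have [z0 Kz0 H] := ccompact_max cK Kz1 (cphi e e0).
case: (HK z0 Kz0) => [fM|[az0 [d d0 Kd]]]; last first.
  by apply: (no_interior_max e0 az0); exists d => // v /Kd /H.
have : ~~ (M < 0) by rewrite -leNgt (le_trans (cmod_ge0 _) fM).
move=> Mn; case: gap => [g|]; last by rewrite (negbTE Mn).
have := H z1 Kz1; rewrite /phi => Hz.
have h0 : cmod (f z0) ^+ 2 <= M' ^+ 2.
  by rewrite ler_pXn2r ?nnegrE ?cmod_ge0 // (le_trans fM) // le_max lexx orbT.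
have h1 : e * cmod z0 ^+ 2 <= e * B by rewrite ler_pM2l // KB.
have h2 : e * (B + 1) = cmod (f z1) ^+ 2 - M' ^+ 2.
  by rewrite /e (negbTE Mn) divfK // gt_eqF //; lra.
have h3 : 0 <= e * cmod z1 ^+ 2 by rewrite mulr_ge0 ?sqr_ge0 // ltW.
lra.
Qed.

Lemma le_of_expr (x y : R) : 0 <= x -> 0 <= y ->
  (forall n, x ^+ n.+1 <= y ^+ n) -> x <= y.
Proof.
move=> x0 y0 H; rewrite leNgt; apply/negP => yx.
have xp : 0 < x by lra.
have : (fun n => (y / x) ^+ n) @ \oo --> (0 : R).
  by apply: cvg_expr; rewrite ger0_norm ?divr_ge0 // ltr_pdivrMr // mul1r.
move=> /cvgrPdist_lt /(_ x xp) [n _ /(_ n (leqnn n))] /=.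
rewrite sub0r normrN ger0_norm ?exprn_ge0 ?divr_ge0 // expr_div_n.
by rewrite ltr_pdivrMr ?exprn_gt0 // -exprS ltNge H.
Qed.

(** The quotient [num / den] is bounded by its boundary values although it may
have a removable singularity at [z0]: the powers [num^(n+1) / den^n] vanish at
[z0], and the loss of the extra factor [num] disappears as [n] grows. *)
Lemma quotient_max_principle (K : set C) (num den : C -> C) z0 (M m : R) :
  0 < M -> 0 < m -> ccompact K -> num z0 = 0 -> den z0 = 0 ->
  (forall v, K v -> analytic_at num v) -> (forall v, K v -> analytic_at den v) ->
  (forall v, K v -> den v = 0 -> v = z0) ->
  (exists B d : R, [/\ 0 <= B, 0 < d & forall v, cmod (v - z0) < d ->
     cmod (num v) <= B * cmod (den v)]) ->
  (forall v, K v -> (cmod (num v) <= M /\ m <= cmod (den v)) \/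
     exists2 d : R, 0 < d & forall w, cmod (w - v) < d -> K w) ->
  forall v, K v -> m * cmod (num v) <= M * cmod (den v).
Proof.
move=> M0 m0 cK num0 den0 numA denA denz [B [d [B0 d0 HB]]] Kb v Kv.
suff H n : (cmod (num v) / M) ^+ n.+1 <= (cmod (den v) / m) ^+ n.
  have := le_of_expr (divr_ge0 (cmod_ge0 _) (ltW M0))
    (divr_ge0 (cmod_ge0 _) (ltW m0)) H.
  by rewrite ler_pdivrMr // mulrAC ler_pdivlMr // mulrC [leRHS]mulrC.
pose p u := num u ^+ n.+1 * (den u ^+ n)^-1.
have pA u : K u -> u != z0 -> analytic_at p u.
  move=> Ku uz; apply: analyticM; first by apply: analyticX; exact: numA.
  apply: analyticV; last by apply: analyticX; exact: denA.
  by rewrite expf_neq0 //; apply: contra uz => /eqP/denz->.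
have p0 : p z0 = 0 by rewrite /p num0 exprS mul0r mul0r.
have pc u : K u -> ccontinuous p u.
  move=> Ku; have [uz|uz] := eqVneq u z0; last first.
    exact: analytic_ccontinuous (pA _ Ku uz).
  have Kz0 : K z0 by rewrite -uz.
  have [L [d' [L0 d'0 HL]]] := analytic_lipschitz (numA _ Kz0).
  rewrite uz; apply: (@lipschitz_ccontinuous _ _ _ (B ^+ n * L) (Num.min d d')).
    by rewrite lt_min d0.
  move=> w; rewrite lt_min => /andP[wd wd']; rewrite p0 subr0 /p.
  have := HL w wd'; rewrite num0 subr0 => HLw.
  rewrite cmodM cmodV !cmodX exprSr.
  have [dw|dw] := eqVneq (den w) 0.
    have nw : num w = 0.
      apply/eqP; rewrite -cmod_eq0; apply/eqP/le_anti.
      by rewrite cmod_ge0 andbT (le_trans (HB w wd)) // dw cmod0 mulr0.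
    by rewrite nw cmod0 mulr0 mul0r !mulr_ge0 ?exprn_ge0 ?cmod_ge0.
  have dw0 : 0 < cmod (den w) ^+ n by rewrite exprn_gt0 // cmod_gt0.
  rewrite mulrAC -[leRHS]mulrA; apply: ler_pM => //.
  - by rewrite divr_ge0 ?exprn_ge0 ?cmod_ge0.
  - exact: cmod_ge0.
  - rewrite ler_pdivrMr // -exprMn.
    by rewrite lerXn2r ?nnegrE ?cmod_ge0 ?mulr_ge0 ?cmod_ge0 // HB.
have := @max_principle K p (M ^+ n.+1 / m ^+ n) cK pc _ v Kv.
have Mm : 0 <= M ^+ n.+1 / m ^+ n by rewrite divr_ge0 ?exprn_ge0 ?ltW.
rewrite !expr_div_n => Hp.
have [dv|dv] := eqVneq (den v) 0.
  have vz : v = z0 by exact: denz.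
  rewrite vz num0 cmod0 exprS !mul0r divr_ge0 ?exprn_ge0 ?cmod_ge0 //.
  exact: ltW.
have dv0 : 0 < cmod (den v) ^+ n by rewrite exprn_gt0 // cmod_gt0.
have {Hp} : cmod (p v) <= M ^+ n.+1 / m ^+ n.
  apply: Hp => u Ku; have [uz|uz] := eqVneq u z0.
    by left; rewrite uz p0 cmod0.
  case: (Kb u Ku) => [[h1 h2]|h]; last by right; split => //; exact: pA.
  left; rewrite /p cmodM cmodV !cmodX.
  have du : 0 < cmod (den u) by apply: lt_le_trans h2.
  apply: ler_pM; rewrite ?exprn_ge0 ?invr_ge0 ?exprn_ge0 ?cmod_ge0 //.
    by rewrite lerXn2r ?nnegrE ?cmod_ge0 // ltW.
  by rewrite lef_pV2 ?posrE ?exprn_gt0 // lerXn2r ?nnegrE // ltW.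
rewrite /p cmodM cmodV !cmodX ler_pdivrMr // => H.
rewrite ler_pdivrMr ?exprn_gt0 //.
by apply: (le_trans H); rewrite mulrC mulrA mulrAC.
Qed.

Lemma closed_disc_compact (z0 : C) (rho : R) :
  ccompact [set v | cmod (v - z0) <= rho].
Proof.
apply: (@ccompact_bounded_closed _ (rho + cmod z0)).
  move=> u /= h; have := cmodD (u - z0) z0; rewrite subrK; lra.
move=> u /= /negP; rewrite -ltNge => h; exists (cmod (u - z0) - rho).
  by rewrite subr_gt0.
move=> v hv; apply/negP; rewrite -ltNge.
have := cmodD (u - v) (v - z0); rewrite addrA subrK cmodB; lra.
Qed.

(** The quotient of [f - f z0] by [z - z0] is bounded by its values on the
circle of radius [rho]. *)
Lemma schwarz (f : C -> C) z0 (rho M : R) : 0 < rho -> 0 < M ->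
  (forall v, cmod (v - z0) <= rho -> analytic_at f v) ->
  (forall v, cmod (v - z0) <= rho -> cmod (f v - f z0) <= M) ->
  forall v, cmod (v - z0) <= rho ->
    rho * cmod (f v - f z0) <= M * cmod (v - z0).
Proof.
move=> rho0 M0 fA fM v hv.
apply: (@quotient_max_principle [set v | cmod (v - z0) <= rho]
  (fun v => f v - f z0) (fun v => v - z0) z0) => //.
- exact: closed_disc_compact.
- by rewrite subrr.
- by rewrite subrr.
- by move=> u /fA fu; apply: analyticB => //; exact: analytic_cst.
- move=> u _; apply: analyticB; [exact: analytic_id|exact: analytic_cst].
- by move=> u _ /eqP; rewrite subr_eq0 => /eqP.
- have z0A : analytic_at f z0 by apply: fA; rewrite subrr cmod0 ltW.
  exact: (analytic_lipschitz z0A).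
- move=> u /= hu; have [ru|ru] := leP rho (cmod (u - z0)).
    by left; split => //; exact: fM.
  right; exists (rho - cmod (u - z0)); first by rewrite subr_gt0.
  move=> w hw; have := cmodD (w - u) (u - z0); rewrite addrA subrK; lra.
Qed.

(** Near [z0] the function [f - a z] varies little on discs whose radius is
comparable to the distance to [z0], and the Schwarz lemma turns this into a
small Lipschitz constant. *)
Lemma strict_derivative (f : C -> C) z0 (a : C) (d0 : R) : 0 < d0 ->
  (forall v, cmod (v - z0) < d0 -> analytic_at f v) ->
  (exists K d : R, [/\ 0 <= K, 0 < d & forall v, cmod (v - z0) < d ->
    cmod (f v - f z0 - a * (v - z0)) <= K * cmod (v - z0) ^+ 2]) ->
  forall e : R, 0 < e -> exists2 d : R, 0 < d & forall u v,
    cmod (u - z0) < d -> cmod (v - z0) < d ->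
    cmod (f u - f v - a * (u - v)) <= e * cmod (u - v).
Proof.
move=> d00 fA [K [d [K0 dp HK]]] e e0.
pose rho := Num.min (Num.min d0 d) (e / (9 * K + 1)) / 4.
have D0 : 0 < 9 * K + 1 by lra.
have m0 : 0 < Num.min (Num.min d0 d) (e / (9 * K + 1)).
  by rewrite !lt_min d00 dp divr_gt0.
have rho0 : 0 < rho by rewrite divr_gt0.
have : 4 * rho <= Num.min (Num.min d0 d) (e / (9 * K + 1)) by rewrite /rho; lra.
rewrite !le_min ler_pdivlMr // => /andP[/andP[r1 r2] r3].
exists (rho / 2); first by rewrite divr_gt0.
move=> u v hu hv.
pose g w := f w - a * w.
have gA w : cmod (w - v) <= rho -> analytic_at g w.
  move=> hw; apply: analyticB; last first.
    by apply: analyticM; [exact: analytic_cst|exact: analytic_id].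
  by apply: fA; have := cmodD (w - v) (v - z0); rewrite addrA subrK; lra.
have gE w : cmod (w - z0) <= 2 * rho ->
  cmod (g w - g z0) <= K * (2 * rho) ^+ 2.
  move=> hw; have -> : g w - g z0 = f w - f z0 - a * (w - z0) by rewrite /g; ring.
  apply: le_trans (HK w _) _; first lra.
  by apply: ler_wpM2l => //; rewrite lerXn2r ?nnegrE ?cmod_ge0 //; lra.
have gM w : cmod (w - v) <= rho -> cmod (g w - g v) <= 8 * K * rho ^+ 2 + e * rho / 9.
  move=> hw; have -> : g w - g v = (g w - g z0) - (g v - g z0) by ring.
  have h1 : cmod (g w - g z0) <= K * (2 * rho) ^+ 2.
    by apply: gE; have := cmodD (w - v) (v - z0); rewrite addrA subrK; lra.
  have h2 : cmod (- (g v - g z0)) <= K * (2 * rho) ^+ 2 by rewrite cmodN gE //; lra.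
  apply: le_trans (cmod_add_le h1 h2) _.
  have : 0 <= e * rho / 9 by rewrite !mulr_ge0 // ltW.
  rewrite exprMn; lra.
have M0 : 0 < 8 * K * rho ^+ 2 + e * rho / 9.
  rewrite ltr_wpDl //; last by rewrite !mulr_gt0.
  by rewrite !mulr_ge0 // ltW.
have := schwarz rho0 M0 gA gM (v := u).
have uv : cmod (u - v) <= rho.
  by have := cmodD (u - z0) (z0 - v); rewrite addrA subrK cmodB [cmod (z0 - v)]cmodB; lra.
move=> /(_ uv) H.
have -> : f u - f v - a * (u - v) = g u - g v by rewrite /g; ring.
rewrite -(ler_pM2l rho0); apply: (le_trans H); rewrite [leRHS]mulrA.
apply: ler_wpM2r; first exact: cmod_ge0.
have : K * rho <= e / 36 by lra.
move=> hK; have : rho * (K * rho) <= rho * (e / 36) by rewrite ler_pM2l.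
by rewrite expr2; lra.
Qed.

End Compact.

(** * Proper analytic maps of degree one onto the lower half-plane *)

Section IntervalInduction.
Context {R : realType}.

(** Connectedness of the segment, in the form used to propagate a property along
a segment of values. *)
Lemma unit_interval_induction (P : R -> Prop) : P 0 ->
  (forall t, 0 <= t <= 1 -> P t -> exists2 d : R, 0 < d &
     forall s, 0 <= s <= 1 -> `|s - t| < d -> P s) ->
  (forall t, 0 <= t <= 1 -> (forall d : R, 0 < d -> exists2 s : R,
     0 <= s <= 1 & `|s - t| < d /\ P s) -> P t) ->
  P 1.
Proof.
move=> P0 Po Pc.
have I01 t : `[0, 1]%classic t <-> (0 <= t <= 1 :> Prop).
  by rewrite /= in_itv.
have H : `[0, 1] `&` P = `[0, 1]%classic.
  apply: (@segment_connected R 0 1).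
  - by exists 0; split => //; apply/I01; rewrite lexx ler01.
  - exists (interior [set s | 0 <= s <= 1 -> P s]); first exact: open_interior.
    apply/seteqP; split => t [] /I01 It.
      move=> Pt; split; first exact/I01.
      have [d d0 Hd] := Po t It Pt; apply/nbhs_ballP; exists d => //.
      by move=> s; rewrite /ball /= distrC => st I1; exact: Hd.
    by move=> /interior_subset Pt; split; [exact/I01|exact: Pt].
  - exists (closure (`[0, 1] `&` P)); first exact: closed_closure.
    apply/seteqP; split => t [] It.
      by move=> Pt; split => //; apply: subset_closure.
    move=> ct; split => //; apply: Pc; first exact/I01.
    move=> d d0; have [s [[/I01 Is Ps] bs]] := ct (ball t d) (nbhsx_ballx _ _ d0).
    by exists s => //; split => //; rewrite distrC.
have : (`[0, 1] `&` P) 1 by rewrite H /= in_itv /= ler01 lexx.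
by case.
Qed.

End IntervalInduction.

Section DegreeOne.
Context {R : realType}.
Local Notation C := R[i].

(** [g] pulls back compact subsets of the lower half-plane to compact subsets
of [T]: its values have nonnegative imaginary part, in the limit, wherever the
argument leaves [T] at finite distance, and also at infinity unless they are
unbounded there. *)
Record lower_proper (c : R) (T : set C) (g : C -> C) : Prop := LowerProper {
  lp_open : forall u, T u -> exists2 d : R, 0 < d &
    forall v, cmod (v - u) < d -> T v;
  lp_an : forall u, T u -> analytic_at g u;
  lp_im : forall u, T u -> - c < Im u;
  lp_bdry : forall u0, ~ T u0 -> forall e : R, 0 < e -> exists2 d : R, 0 < d &
    forall u, T u -> cmod (u - u0) < d -> - e < Im (g u);
  lp_inf : forall e : R, 0 < e -> exists L : R, forall u, T u -> L < cmod u ->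
    - e < Im (g u) \/ e^-1 < cmod (g u) }.

Context (c : R) (T : set C) (g : C -> C) (LP : lower_proper c T g).

Lemma preimage_disc_compact w (rho : R) : rho < - Im w ->
  ccompact [set u | T u /\ cmod (g u - w) <= rho].
Proof.
move=> rw.
have Imw u : cmod (g u - w) <= rho -> Im (g u) <= Im w + rho.
  move=> h; have := ler_norm (Im (g u - w)).
  by have := cmod_Im (g u - w); rewrite ImD ImN; lra.
have Nw u : cmod (g u - w) <= rho -> cmod (g u) <= cmod w + rho.
  by move=> h; have := cmodD (g u - w) w; rewrite subrK; lra.
pose e := Num.min (- Im w - rho) (`|cmod w + rho| + 1)^-1.
have D0 : 0 < `|cmod w + rho| + 1 by rewrite ltr_wpDl.
have e0 : 0 < e by rewrite lt_min invr_gt0 D0 andbT subr_gt0.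
have e1 : e <= - Im w - rho by rewrite ge_min lexx.
have e2 : cmod w + rho <= e^-1.
  apply: le_trans (_ : `|cmod w + rho| + 1 <= _).
    by have := ler_norm (cmod w + rho); lra.
  by rewrite -[leLHS]invrK lef_pV2 ?posrE ?invr_gt0 // ge_min lexx orbT.
have [L HL] := lp_inf LP e0.
apply: (@ccompact_bounded_closed _ _ L).
  move=> u [Tu hu]; rewrite leNgt; apply/negP => Lu.
  by have := HL u Tu Lu; have := Imw u hu; have := Nw u hu; case=> *; lra.
move=> u nK; have [Tu|nTu] := pselect (T u).
  have gu : rho < cmod (g u - w) by rewrite ltNge; apply/negP => h; exact: nK.
  have gu' : 0 < cmod (g u - w) - rho by rewrite subr_gt0.
  have [d d0 Hd] := analytic_ccontinuous (lp_an LP Tu) gu'.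
  exists d => // v /Hd hv [_ hw]; have := cmodD (g u - g v) (g v - w).
  by rewrite addrA subrK [cmod (g u - g v)]cmodB; lra.
have [d d0 Hd] := lp_bdry LP nTu e0.
exists d => // v vd [Tv hv]; have := Hd v Tv vd; have := Imw v hv; lra.
Qed.

(** A bounded injective coordinate on [T]. *)
Definition kappa (u : C) : C := (u + Complex 0 (c + 1))^-1.

Lemma kappa_den u : T u -> 1 <= cmod (u + Complex 0 (c + 1)).
Proof.
move=> Tu; have := lp_im LP Tu; have := cmod_Im (u + Complex 0 (c + 1)).
have := ler_norm (Im (u + Complex 0 (c + 1))); rewrite !ReImE; lra.
Qed.

Lemma kappa_le u : T u -> cmod (kappa u) <= 1.
Proof.
move=> Tu; rewrite /kappa cmodV invf_le1 ?kappa_den //.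
by apply: lt_le_trans (kappa_den Tu).
Qed.

Lemma kappa_den_neq0 u : T u -> u + Complex 0 (c + 1) != 0.
Proof. by move=> /kappa_den h; rewrite -cmod_gt0; apply: lt_le_trans h. Qed.

Lemma kappa_an u : T u -> analytic_at kappa u.
Proof.
move=> Tu; apply: analyticV; first exact: kappa_den_neq0.
by apply: analyticD; [exact: analytic_id|exact: analytic_cst].
Qed.

Lemma kappaB u v : T u -> T v -> cmod (kappa v - kappa u) =
  cmod (v - u) / (cmod (v + Complex 0 (c + 1)) * cmod (u + Complex 0 (c + 1))).
Proof.
move=> Tu Tv; have u0 := kappa_den_neq0 Tu; have v0 := kappa_den_neq0 Tv.
rewrite -cmodM -cmodV -cmodM -cmodN; congr cmod; rewrite /kappa.
by field; rewrite u0 v0.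
Qed.

Lemma kappa_lip u v : T u -> T v -> cmod (kappa v - kappa u) <= cmod (v - u).
Proof.
move=> Tu Tv; rewrite kappaB //; have := kappa_den Tu; have := kappa_den Tv => hv hu.
rewrite ler_pdivrMr ?mulr_gt0 //; try lra.
by rewrite ler_peMr ?cmod_ge0 // mulr_ege1.
Qed.

Lemma kappaB_le2 u v : T u -> T v -> cmod (kappa v - kappa u) <= 2.
Proof.
move=> Tu Tv; have := cmodD (kappa v) (- kappa u); rewrite cmodN.
by have := kappa_le Tu; have := kappa_le Tv; lra.
Qed.

(** The inequality expresses quantitatively that [u] is the only preimage of [w]
and a simple one; unlike that property it is stable under limits of [w] and
[u]. *)
Definition sole_preimage w u := [/\ T u, g u = w &
  forall v, T v -> - Im w * cmod (kappa v - kappa u) <= 4 * cmod (g v - w)].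

(** The quotient of [kappa v - kappa u] by [g v - w] has its only singularity at
[u], where it is bounded because the preimage is simple. It is therefore bounded
by its values at the boundary of the preimage of a disc around [w], and that
preimage is compact. *)
Lemma sole_preimage_intro w u : Im w < 0 -> T u -> g u = w ->
  (forall v, T v -> g v = w -> v = u) ->
  (exists k d : R, [/\ 0 < k, 0 < d & forall v, cmod (v - u) < d ->
     k * cmod (v - u) <= cmod (g v - w)]) ->
  sole_preimage w u.
Proof.
move=> w0 Tu gu uniq [k [d [k0 d0 Hk]]]; split => // v Tv.
have [big|small] := leP (- Im w / 2) (cmod (g v - w)).
  by have := kappaB_le2 Tu Tv; have := cmod_ge0 (kappa v - kappa u); nra.
suff : (- Im w / 2) * cmod (kappa v - kappa u) <= 2 * cmod (g v - w) by lra.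
apply: (@quotient_max_principle _ [set v | T v /\ cmod (g v - w) <= - Im w / 2]
  (fun v => kappa v - kappa u) (fun v => g v - w) u) => //.
- lra.
- by apply: preimage_disc_compact; lra.
- by rewrite subrr.
- by rewrite gu subrr.
- move=> z [Tz _]; apply: analyticB; [exact: kappa_an|exact: analytic_cst].
- move=> z [Tz _]; apply: analyticB; [exact: (lp_an LP)|exact: analytic_cst].
- by move=> z [Tz _] /eqP; rewrite subr_eq0 => /eqP; exact: uniq.
- have [K [d' [K0 d'0 HK]]] := analytic_lipschitz (kappa_an Tu).
  exists (K / k), (Num.min d d'); split; [by rewrite divr_ge0 // ltW|by rewrite lt_min d0|].
  move=> z; rewrite lt_min => /andP[/Hk h1 /HK h2]; apply: (le_trans h2).
  by rewrite -mulrA ler_wpM2l // mulrC ler_pdivlMr // mulrC.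
- move=> z [Tz hz]; have [hb|hs] := leP (- Im w / 2) (cmod (g z - w)).
    by left; split => //; exact: kappaB_le2.
  right; have [d1 d10 H1] := lp_open LP Tz.
  have hs' : 0 < - Im w / 2 - cmod (g z - w) by rewrite subr_gt0.
  have [d2 d20 H2] := analytic_ccontinuous (lp_an LP Tz) hs'.
  exists (Num.min d1 d2); first by rewrite lt_min d10.
  move=> y; rewrite lt_min => /andP[/H1 Ty /H2 hy]; split => //.
  by have := cmodD (g y - g z) (g z - w); rewrite addrA subrK; lra.
- by split => //; exact: ltW.
Qed.

(** If a value [w'] close to the attained value [w] were omitted, then
[1 / (g - w')] would break the maximum principle on the preimage of a disc. *)
Lemma attained_near w u w' : Im w < 0 -> T u -> g u = w ->
  cmod (w' - w) < - Im w / 4 -> exists2 v, T v & g v = w'.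
Proof.
move=> w0 Tu gu hw; apply: contrapT => nv.
have ne z : T z -> g z - w' != 0.
  by move=> Tz; rewrite subr_eq0; apply/eqP => h; apply: nv; exists z.
pose rho := - Im w / 2.
have rho0 : 0 < rho - cmod (w' - w) by rewrite /rho; lra.
have fA z : T z -> analytic_at (fun v => (g v - w')^-1) z.
  move=> Tz; apply: analyticV; first exact: ne.
  by apply: analyticB; [exact: (lp_an LP)|exact: analytic_cst].
suff : cmod (g u - w')^-1 <= (rho - cmod (w' - w))^-1.
  by rewrite cmodV lef_pV2 ?posrE ?cmod_gt0 ?ne // gu [cmod (w - w')]cmodB /rho => ?; lra.
apply: (@max_principle _ [set v | T v /\ cmod (g v - w) <= rho]
  (fun v => (g v - w')^-1)).
- by apply: preimage_disc_compact; rewrite /rho; lra.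
- by move=> z [Tz _]; apply: analytic_ccontinuous; exact: fA.
- move=> z [Tz hz]; have [hb|hs] := leP rho (cmod (g z - w)).
    left; rewrite cmodV lef_pV2 ?posrE ?cmod_gt0 ?ne //.
    by have := cmodD (g z - w') (w' - w); rewrite addrA subrK; lra.
  right; split; first exact: fA.
  have [d1 d10 H1] := lp_open LP Tz.
  have hs' : 0 < rho - cmod (g z - w) by rewrite subr_gt0.
  have [d2 d20 H2] := analytic_ccontinuous (lp_an LP Tz) hs'.
  exists (Num.min d1 d2); first by rewrite lt_min d10.
  move=> y; rewrite lt_min => /andP[/H1 Ty /H2 hy]; split => //.
  by have := cmodD (g y - g z) (g z - w); rewrite addrA subrK; lra.
- by split => //; rewrite gu subrr cmod0 /rho; lra.
Qed.

(** The inverse of [kappa] is Lipschitz on bounded sets, so that close values have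
close preimages. *)
Lemma sole_preimage_close w u v (e : R) : Im w < 0 -> sole_preimage w u ->
  T v -> 0 < e -> e <= 1 ->
  16 * cmod (g v - w) * cmod (u + Complex 0 (c + 1)) ^+ 2 <= - Im w * e ->
  cmod (v - u) <= e.
Proof.
move=> w0 [Tu gu H] Tv e0 e1 hv; have := H v Tv; rewrite kappaB //.
set D := cmod (u + Complex 0 (c + 1)) in hv *.
set D' := cmod (v + Complex 0 (c + 1)).
have D1 : 1 <= D by exact: kappa_den.
have D'1 : 1 <= D' by exact: kappa_den.
have D'D : D' <= D + cmod (v - u).
  have := cmodD (u + Complex 0 (c + 1)) (v - u).
  by rewrite [u + _ + _]addrC addrA subrK /D /D'.
set x := cmod (v - u) in D'D *; set y := cmod (g v - w) in hv *.
have x0 : 0 <= x by exact: cmod_ge0.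
have y0 : 0 <= y by exact: cmod_ge0.
rewrite mulrA ler_pdivrMr; last by rewrite mulr_gt0; lra.
move=> h; rewrite leNgt; apply/negP => ex.
have h1 : - Im w * x <= 4 * y * (D + x) * D.
  apply: (le_trans h); rewrite -!mulrA ler_pM2l // !mulrA.
  apply: ler_wpM2r; first lra.
  by apply: ler_wpM2l.
have D2 : D <= D ^+ 2 by rewrite expr2 ler_peMr //; lra.
have h2 : 4 * y * (D + x) * D <= 4 * y * D ^+ 2 * (1 + x).
  have -> : 4 * y * (D + x) * D = 4 * y * (D ^+ 2 + x * D) by ring.
  have -> : 4 * y * D ^+ 2 * (1 + x) = 4 * y * (D ^+ 2 + x * D ^+ 2) by ring.
  apply: ler_wpM2l; first by rewrite mulr_ge0.
  by rewrite lerD2l ler_wpM2l.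
have h3 : 4 * y * D ^+ 2 * (1 + x) <= - Im w * e / 4 * (1 + x).
  apply: ler_wpM2r; lra.
have : - Im w * (x - e / 4 * (1 + x)) <= 0 by lra.
rewrite pmulr_rle0; last lra.
nra.
Qed.

(** For [v] tending to [u] the inequality bounds the derivative of [g] at [u]
from below, and the derivative of an analytic function is strict. *)
Lemma sole_preimage_derivative w u : Im w < 0 -> sole_preimage w u ->
  exists k d : R, [/\ 0 < k, 0 < d & forall v1 v2, cmod (v1 - u) < d ->
     cmod (v2 - u) < d -> k * cmod (v1 - v2) <= cmod (g v1 - g v2)].
Proof.
move=> w0 [Tu gu H].
have [d1 d10 H1] := lp_open LP Tu.
have [a [K [d [K0 d0 HK]]]] := analytic_quadratic (lp_an LP Tu).
set D := cmod (u + Complex 0 (c + 1)).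
have D1 : 1 <= D by exact: kappa_den.
have D0 : 0 < D by exact: lt_le_trans ltr01 D1.
pose k := - Im w / (4 * ((D + 1) * D)).
have DD : 0 < 4 * ((D + 1) * D) by rewrite !mulr_gt0 //; lra.
have k0 : 0 < k by rewrite divr_gt0 // oppr_gt0.
have ka : k <= cmod a.
  rewrite leNgt; apply/negP => ak.
  pose t := Num.min (Num.min (Num.min 1 d1) d) ((k - cmod a) / (K + 1)) / 2.
  have m0 : 0 < Num.min (Num.min (Num.min 1 d1) d) ((k - cmod a) / (K + 1)).
    rewrite !lt_min ltr01 d10 d0 /= divr_gt0 //; lra.
  have t0 : 0 < t by rewrite divr_gt0.
  have : t < Num.min (Num.min (Num.min 1 d1) d) ((k - cmod a) / (K + 1)).
    by rewrite /t; lra.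
  rewrite !lt_min ltr_pdivlMr; last lra.
  move=> /andP[/andP[/andP[t1 td1] td] tK].
  pose v := u + Complex t 0.
  have vu : cmod (v - u) = t.
    by rewrite /v addrAC subrr add0r cmodE /= expr0n addr0 sqrtr_sqr gtr0_norm.
  have Tv : T v by apply: H1; rewrite vu.
  have := HK v; rewrite vu => /(_ td) h.
  have := H v Tv; rewrite kappaB // vu -/D gu in h *.
  set D' := cmod (v + Complex 0 (c + 1)).
  have D'0 : 0 < D' by apply: lt_le_trans ltr01 _; exact: kappa_den.
  have D'D : D' <= D + 1.
    have := cmodD (u + Complex 0 (c + 1)) (v - u).
    rewrite [u + _ + _]addrC addrA subrK /D /D' vu; lra.
  have h2 : cmod (g v - w) <= K * t ^+ 2 + cmod a * t.
    have := cmod_add_le h (lexx (cmod (a * (v - u)))).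
    by rewrite subrK cmodM vu.
  have : k * t <= - Im w * (t / (D' * D)) / 4.
    have -> : - Im w * (t / (D' * D)) / 4 = - Im w * t / (4 * (D' * D)).
      by field; rewrite !gt_eqF.
    rewrite /k mulrAC; apply: ler_wpM2l.
      by apply: mulr_ge0; rewrite ?oppr_ge0; exact: ltW.
    rewrite lef_pV2 ?posrE //; last by rewrite !mulr_gt0.
    by rewrite ler_pM2l // ler_pM2r.
  move=> h3 h4.
  have : k * t <= K * t ^+ 2 + cmod a * t by lra.
  have -> : K * t ^+ 2 + cmod a * t = (K * t + cmod a) * t by ring.
  rewrite ler_pM2r //; lra.
have k20 : 0 < k / 2 by rewrite divr_gt0.
have [d2 d20 H2] := strict_derivative d10 (fun v h => lp_an LP (H1 v h))
  (ex_intro _ K (ex_intro _ d (And3 K0 d0 HK))) k20.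
 exists (k / 2), d2; split => //.
move=> v1 v2 h1 h2; have h := H2 v1 v2 h1 h2.
have := cmod_lerB (a * (v1 - v2)) (a * (v1 - v2) - (g v1 - g v2)).
rewrite subKr cmodM [cmod (_ - (_ - _))]cmodB.
have := cmod_ge0 (v1 - v2) => x0.
have : k * cmod (v1 - v2) <= cmod a * cmod (v1 - v2) by exact: ler_wpM2r.
lra.
Qed.

(** A value close to [w] is attained; the inequality for [w] forces all its
preimages to be close to [u], where [g] is injective. *)
Lemma sole_preimage_open w u : Im w < 0 -> sole_preimage w u ->
  exists2 d : R, 0 < d & forall w', cmod (w' - w) < d ->
    exists u', sole_preimage w' u'.
Proof.
move=> w0 S; have [Tu gu H] := S.
have [k [d [k0 d0 Hk]]] := sole_preimage_derivative w0 S.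
set D := cmod (u + Complex 0 (c + 1)).
have D1 : 1 <= D by exact: (kappa_den Tu).
have D20 : 0 < 16 * D ^+ 2 by rewrite mulr_gt0 ?exprn_gt0 //; lra.
pose e := Num.min 1 (d / 2).
have e0 : 0 < e by rewrite lt_min ltr01 divr_gt0.
pose d' := Num.min (- Im w / 4) (- Im w * e / (16 * D ^+ 2)).
have d'0 : 0 < d'.
  by rewrite lt_min !divr_gt0 ?mulr_gt0 //; lra.
exists d' => // w'; rewrite lt_min => /andP[hw1].
rewrite ltr_pdivlMr // => hw2.
have [u' Tu' gu'] := attained_near w0 Tu gu hw1.
have near v : T v -> g v = w' -> cmod (v - u) < d.
  move=> Tv gv; apply: (@le_lt_trans _ _ e); last first.
    by rewrite /e gt_min; apply/orP; right; lra.
  apply: (sole_preimage_close w0 S) => //; first by rewrite ge_min lexx.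
  rewrite gv -/D; lra.
have w'0 : Im w' < 0.
  have := cmod_Im (w' - w); rewrite ImD ImN.
  have := ler_norm (Im w' - Im w); lra.
exists u'; apply: sole_preimage_intro => //.
  move=> v Tv gv; have := Hk v u' (near v Tv gv) (near u' Tu' gu').
  rewrite gv gu' subrr cmod0 pmulr_rle0 // => h.
  apply/eqP; rewrite -subr_eq0 -cmod_eq0; apply/eqP/le_anti.
  by rewrite h cmod_ge0.
have hu' := near u' Tu' gu'.
exists k, (d - cmod (u' - u)); split => //; first by rewrite subr_gt0.
move=> v hv; rewrite -gu'; apply: Hk => //.
by have := cmodD (v - u') (u' - u); rewrite addrA subrK; lra.
Qed.

(** The preimages stay in a compact set, and the inequality passes to a cluster
point. *)
Lemma sole_preimage_closed w : Im w < 0 ->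
  (forall e : R, 0 < e -> exists2 w', cmod (w' - w) < e &
     exists u', sole_preimage w' u') ->
  exists u, sole_preimage w u.
Proof.
move=> w0 H; pose rho := - Im w / 2.
have rho0 : 0 < rho by rewrite /rho; lra.
have cK : ccompact [set u | T u /\ cmod (g u - w) <= rho].
  by apply: preimage_disc_compact; rewrite /rho; lra.
have [||u [Tu hu] Hu] := ccompact_cluster (Q := fun e u =>
  exists2 w', cmod (w' - w) < e & sole_preimage w' u) cK.
- move=> e e0; have m0 : 0 < Num.min e rho by rewrite lt_min e0.
  have [w' hw' [u' S]] := H _ m0; exists u'; last first.
    by exists w' => //; rewrite lt_min in hw'; case/andP: hw'.
  case: S => Tu' gu' _; split => //; rewrite gu'.
  by rewrite lt_min in hw'; case/andP: hw' => _ /ltW.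
- by move=> e e' u _ ee' [w' hw' S]; exists w' => //; exact: lt_le_trans ee'.
exists u; split => //.
  apply/eqP; rewrite -subr_eq0 -cmod_eq0; apply/eqP/le_anti.
  rewrite cmod_ge0 andbT; apply/ler_addgt0Pr => e e0; rewrite add0r.
  have e20 : 0 < e / 2 by rewrite divr_gt0.
  have [d d0 Hd] := analytic_ccontinuous (lp_an LP Tu) e20.
  have [v /Hd hv [[Tv _] [w' hw' [_ gv _]]]] := Hu (e / 2) d e20 d0.
  have := cmodD (g u - g v) (g v - w); rewrite addrA subrK gv.
  by rewrite gv cmodB in hv; lra.
move=> v Tv; apply/ler_addgt0Pr => e e0.
pose e1 := e / (6 - Im w).
have B0 : 0 < 6 - Im w by lra.
have e10 : 0 < e1 by rewrite divr_gt0.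
have [u' hu' [[Tu' _] [w' hw' [_ gu' Hu']]]] := Hu e1 e1 e10 e10.
have h1 := Hu' v Tv.
have h2 := kappa_lip Tu Tu'; have h3 := kappaB_le2 Tu' Tv.
have h4 : cmod (kappa v - kappa u) <= cmod (kappa v - kappa u') + e1.
  by have := cmodD (kappa v - kappa u') (kappa u' - kappa u);
     rewrite addrA subrK; lra.
have h5 : - Im w <= - Im w' + e1.
  have := cmod_Im (w' - w); rewrite ImD ImN; have := ler_norm (Im w' - Im w); lra.
have h6 : cmod (g v - w') <= cmod (g v - w) + e1.
  by have := cmodD (g v - w) (w - w'); rewrite addrA subrK [cmod (w - w')]cmodB; lra.
have h7 : e1 * (6 - Im w) = e by rewrite divfK // gt_eqF.
have h8 : - Im w * cmod (kappa v - kappa u) <=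
   - Im w * (cmod (kappa v - kappa u') + e1) by apply: ler_wpM2l => //; lra.
have h9 : - Im w * cmod (kappa v - kappa u') <=
   (- Im w' + e1) * cmod (kappa v - kappa u') by apply: ler_wpM2r => //; exact: cmod_ge0.
have h10 : e1 * cmod (kappa v - kappa u') <= e1 * 2 by rewrite ler_pM2l.
lra.
Qed.

(** The values with a sole preimage form an open and closed part of the segment
that joins [g u0] to any other point of the lower half-plane. *)
Theorem degree_one u0 : T u0 -> Im (g u0) < 0 ->
  (forall v, T v -> g v = g u0 -> v = u0) ->
  (exists k d : R, [/\ 0 < k, 0 < d & forall v, cmod (v - u0) < d ->
     k * cmod (v - u0) <= cmod (g v - g u0)]) ->
  forall w, Im w < 0 -> exists u, sole_preimage w u.
Proof.
move=> Tu0 g0 uniq simple w w0.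
pose z (t : R) : C := g u0 + t%:C%C * (w - g u0).
have zE t s : cmod (z s - z t) = `|s - t| * cmod (w - g u0).
  by rewrite -cmod_real -cmodM; congr cmod; rewrite /z rmorphB; ring.
have zI t : 0 <= t <= 1 -> Im (z t) < 0.
  move=> /andP[t0 t1]; rewrite /z !ReImE mul0r addr0; nra.
have small (d : R) : 0 < d -> exists2 e : R, 0 < e & forall s t : R,
    `|s - t| < e -> cmod (z s - z t) < d.
  move=> d0; have D0 : 0 < cmod (w - g u0) + 1 by rewrite ltr_wpDl ?cmod_ge0.
  exists (d / (cmod (w - g u0) + 1)); first by rewrite divr_gt0.
  move=> s t; rewrite ltr_pdivlMr // => h; rewrite zE.
  by have := normr_ge0 (s - t); lra.
have -> : w = z 1 by rewrite /z mul1r addrC subrK.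
apply: (@unit_interval_induction R (fun t => exists u, sole_preimage (z t) u)).
- exists u0; rewrite /z mul0r addr0; exact: sole_preimage_intro.
- move=> t /zI zt [u S]; have [d d0 Hd] := sole_preimage_open zt S.
  have [e e0 He] := small d d0; exists e => // s _ st.
  by apply: Hd; exact: He.
- move=> t /zI zt H; apply: sole_preimage_closed => // d d0.
  have [e e0 He] := small d d0; have [s _ [st S]] := H e e0.
  by exists (z s) => //; exact: He.
Qed.

Lemma sole_preimage_inj w u : Im w < 0 -> sole_preimage w u ->
  forall v, T v -> g v = w -> v = u.
Proof.
move=> w0 [Tu gu H] v Tv gv; have := H v Tv; rewrite gv subrr cmod0 mulr0.
rewrite pmulr_rle0; last lra.
rewrite kappaB // => h; apply/eqP; rewrite -subr_eq0 -cmod_eq0; apply/eqP/le_anti.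
rewrite cmod_ge0 andbT; move: h; rewrite pmulr_lle0 // invr_gt0 mulr_gt0 //.
  by apply: lt_le_trans (kappa_den Tv).
by apply: lt_le_trans (kappa_den Tu).
Qed.

End DegreeOne.

(** * Complex derivatives *)

Section Derivative.
Context {R : realType}.
Local Notation C := R[i].

Definition cderivative (f : C -> C) (z a : C) := forall e : R, 0 < e ->
  exists2 d : R, 0 < d & forall v, cmod (v - z) < d ->
    cmod (f v - f z - a * (v - z)) <= e * cmod (v - z).

Lemma analytic_cderivative f z : analytic_at f z -> exists a, cderivative f z a.
Proof.
move=> /analytic_quadratic[a [K [d [K0 d0 H]]]]; exists a => e e0.
exists (Num.min d (e / (K + 1))); first by rewrite lt_min d0 divr_gt0 //; lra.
move=> v; rewrite lt_min ltr_pdivlMr; last lra.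
move=> /andP[/H h1 h2]; apply: (le_trans h1); rewrite expr2 mulrA.
by apply: ler_wpM2r; [exact: cmod_ge0|have := cmod_ge0 (v - z); lra].
Qed.

Lemma cderivative_derivable f z a : cderivative f z a ->
  derivable (f : R[i]^o -> R[i]^o) z 1.
Proof.
move=> H; apply/cvg_ex; exists a; apply/cvgrPdist_lt => e e0.
have [x x0 ex] : exists2 x : R, 0 < x & e = x%:C%C.
  by case: e e0 => x y; rewrite ltcE /= => /andP[/eqP -> x0]; exists x.
have x20 : 0 < x / 2 by rewrite divr_gt0.
have [d d0 Hd] := H _ x20.
apply/nbhs_ballP; exists (d%:C%C); first by rewrite /= ltcR.
move=> h; rewrite /ball /= sub0r normrN => hd h0.
have hd' : cmod h < d by rewrite -ltcR.
have := Hd (h + z); rewrite addrK => /(_ hd') hh.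
rewrite ex -[X in X < _]/((cmod _)%:C%C) ltcR.
rewrite /shift /= -[h *: 1]/(h * 1) mulr1 -[_ *: _]/(_ * _).
have hp : 0 < cmod h by rewrite cmod_gt0.
have -> : a - h^-1 * (f (h + z) - f z) = - h^-1 * (f (h + z) - f z - a * h).
  by field.
rewrite cmodM cmodN cmodV mulrC ltr_pdivrMr //.
apply: (le_lt_trans hh); rewrite ltr_pM2r //; lra.
Qed.

Lemma cderivative_comp f g z a b : cderivative f z a -> cderivative g (f z) b ->
  cderivative (fun u => g (f u)) z (b * a).
Proof.
move=> Hf Hg e e0.
have a0 := cmod_ge0 a; have b0 := cmod_ge0 b.
pose e1 := Num.min 1 (e / (2 * (cmod b + 1))).
pose e2 := e / (2 * (cmod a + 1)).
have B0 : 0 < 2 * (cmod b + 1) by lra.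
have A0 : 0 < 2 * (cmod a + 1) by lra.
have e10 : 0 < e1 by rewrite lt_min ltr01 divr_gt0.
have e20 : 0 < e2 by rewrite divr_gt0.
have [d1 d10 H1] := Hf _ e10; have [d2 d20 H2] := Hg _ e20.
exists (Num.min d1 (d2 / (cmod a + 1))); first by rewrite lt_min d10 divr_gt0 //; lra.
move=> v; rewrite lt_min ltr_pdivlMr; last lra.
move=> /andP[/H1 h1 h2]; have x0 := cmod_ge0 (v - z).
have E1 : e1 <= 1 by rewrite ge_min lexx.
have E2 : e1 * (2 * (cmod b + 1)) <= e by rewrite -ler_pdivlMr // ge_min lexx orbT.
have E3 : e2 * (2 * (cmod a + 1)) = e by rewrite divfK // gt_eqF.
have fv : cmod (f v - f z) <= (cmod a + 1) * cmod (v - z).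
  have := cmod_add_le h1 (lexx (cmod (a * (v - z)))); rewrite subrK cmodM => h.
  by apply: (le_trans h); nra.
have fd : cmod (f v - f z) < d2 by lra.
have h3 := H2 (f v) fd.
have {}h3 : cmod (g (f v) - g (f z) - b * (f v - f z)) <=
   e2 * ((cmod a + 1) * cmod (v - z)).
  by apply: le_trans h3 _; rewrite ler_pM2l.
have -> : g (f v) - g (f z) - b * a * (v - z) =
  (g (f v) - g (f z) - b * (f v - f z)) + b * (f v - f z - a * (v - z)) by ring.
apply: le_trans (cmod_add_le h3 (cmod_mul_le (lexx (cmod b)) h1)) _.
have : cmod b * (e1 * cmod (v - z)) <= e / 2 * cmod (v - z).
  by rewrite mulrA; apply: ler_wpM2r => //; nra.
have -> : e2 * ((cmod a + 1) * cmod (v - z)) = e / 2 * cmod (v - z).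
  by rewrite mulrA; congr (_ * _); lra.
lra.
Qed.

(** A right inverse [h] of [g] that is Lipschitz at [w] is differentiable
there, with the reciprocal derivative. *)
Lemma cderivative_inverse (g h : C -> C) w a (K d : R) : 0 < K -> 0 < d ->
  (forall w', cmod (w' - w) < d -> g (h w') = w') ->
  (forall w', cmod (w' - w) < d -> cmod (h w' - h w) <= K * cmod (w' - w)) ->
  cderivative g (h w) a -> a != 0 /\ cderivative h w a^-1.
Proof.
move=> K0 d0 gh hK Hg.
have ww : cmod (w - w) < d by rewrite subrr cmod0.
have an0 : a != 0.
  apply/eqP => a0; have e0 : 0 < (2 * K)^-1 by rewrite invr_gt0; lra.
  have [d1 d10 H1] := Hg _ e0.
  pose t := Num.min d (d1 / K) / 2.
  have m0 : 0 < Num.min d (d1 / K) by rewrite lt_min d0 divr_gt0.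
  have t0 : 0 < t by rewrite divr_gt0.
  have : t < Num.min d (d1 / K) by rewrite /t; lra.
  rewrite lt_min ltr_pdivlMr // => /andP[td tK].
  pose w' := w + t%:C%C.
  have w't : cmod (w' - w) = t by rewrite /w' addrAC subrr add0r cmod_real gtr0_norm.
  have := hK w'; rewrite w't => /(_ td) h1.
  have h2 : cmod (h w' - h w) < d1 by apply: le_lt_trans h1 _; lra.
  have := H1 _ h2; rewrite a0 mul0r subr0 !gh ?w't // => h3.
  have := le_trans h3 (ler_wpM2l (ltW e0) h1).
  have -> : (2 * K)^-1 * (K * t) = t / 2 by field; lra.
  lra.
split => // e e0.
have A0 : 0 < cmod a by rewrite cmod_gt0.
have e10 : 0 < e * cmod a / K by rewrite divr_gt0 // mulr_gt0.
have [d1 d10 H1] := Hg _ e10.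
exists (Num.min d (d1 / K)); first by rewrite lt_min d0 divr_gt0.
move=> v; rewrite lt_min ltr_pdivlMr // => /andP[vd vK].
have h1 := hK v vd; have h2 : cmod (h v - h w) < d1 by apply: le_lt_trans h1 _; lra.
have := H1 _ h2; rewrite !gh // => h3.
have -> : h v - h w - a^-1 * (v - w) = - a^-1 * (v - w - a * (h v - h w)).
  by field.
rewrite cmodM cmodN cmodV mulrC ler_pdivrMr //.
apply: (le_trans h3).
apply: (le_trans (ler_wpM2l (ltW e10) h1)).
have -> : e * cmod a / K * (K * cmod (v - w)) = e * cmod (v - w) * cmod a.
  by field; rewrite gt_eqF.
by [].
Qed.

End Derivative.

(** * Integrals of complex-valued functions on a segment *)

Section ComplexIntegral.
Context {R : realType}.
Local Notation C := R[i].
Local Notation mu := (@lebesgue_measure R).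
Implicit Types (p q : R) (f g : R -> C).

Definition Cint p q f : C :=
  Complex (\int[mu]_(x in `[p, q]) Re (f x)) (\int[mu]_(x in `[p, q]) Im (f x)).

Definition cmeasurable p q f :=
  measurable_fun `[p, q] (fun x => Re (f x)) /\
  measurable_fun `[p, q] (fun x => Im (f x)).

Definition cbounded p q f :=
  exists M : R, forall x, p <= x <= q -> cmod (f x) <= M.

(** Continuity on a segment is stated without reference to the exterior of the
segment, where the integrands below may be singular. *)
Definition ccontinuous_on p q f := forall x, p <= x <= q ->
  forall e : R, 0 < e -> exists2 d : R, 0 < d &
    forall y, p <= y <= q -> `|y - x| < d -> cmod (f y - f x) < e.

Lemma segmentE p q x : `[p, q]%classic x <-> (p <= x <= q :> Prop).
Proof. by rewrite /= in_itv. Qed.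

Lemma bounded_integrable p q (h : R -> R) (M : R) :
  measurable_fun `[p, q] h -> (forall x, p <= x <= q -> `|h x| <= M) ->
  mu.-integrable `[p, q] (EFin \o h).
Proof.
move=> mh hM; apply: measurable_bounded_integrable => //.
  by rewrite [X in (X < _)%E](lebesgue_measure_itv `[p, q]) /=; case: ifPn => // _; rewrite -EFinD ltry.
exists M; split; first exact: num_real.
by move=> y My x /segmentE xpq; apply: le_trans (hM x xpq) (ltW My).
Qed.

Lemma cintegrable_Re p q f : cmeasurable p q f -> cbounded p q f ->
  mu.-integrable `[p, q] (EFin \o (fun x => Re (f x))).
Proof.
move=> [mr _] [M fM]; apply: (bounded_integrable (M := M)) => // x /fM.
exact: le_trans (cmod_Re _).
Qed.

Lemma cintegrable_Im p q f : cmeasurable p q f -> cbounded p q f ->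
  mu.-integrable `[p, q] (EFin \o (fun x => Im (f x))).
Proof.
move=> [_ mi] [M fM]; apply: (bounded_integrable (M := M)) => // x /fM.
exact: le_trans (cmod_Im _).
Qed.

Lemma eq_cmeasurable p q f g : (forall x, p <= x <= q -> f x = g x) ->
  cmeasurable p q f -> cmeasurable p q g.
Proof.
move=> fg [m1 m2]; split; [apply: eq_measurable_fun m1|apply: eq_measurable_fun m2];
  by move=> x; rewrite inE => /segmentE /fg ->.
Qed.

Lemma eq_Cint p q f g : (forall x, p <= x <= q -> f x = g x) ->
  Cint p q f = Cint p q g.
Proof.
by move=> fg; rewrite /Cint; congr Complex; apply: eq_Rintegral => x;
  rewrite inE => /segmentE /fg ->.
Qed.

Lemma cmeasurable_cst p q (c : C) : cmeasurable p q (fun=> c).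
Proof. by split; exact: measurable_cst. Qed.

Lemma cmeasurableD p q f g : cmeasurable p q f -> cmeasurable p q g ->
  cmeasurable p q (fun x => f x + g x).
Proof.
move=> [m1 m2] [n1 n2]; split.
  apply: eq_measurable_fun (measurable_funD m1 n1) => x _.
  by symmetry; exact: ReD.
apply: eq_measurable_fun (measurable_funD m2 n2) => x _.
by symmetry; exact: ImD.
Qed.

Lemma cmeasurableM p q f g : cmeasurable p q f -> cmeasurable p q g ->
  cmeasurable p q (fun x => f x * g x).
Proof.
move=> [m1 m2] [n1 n2]; split.
  apply: eq_measurable_fun (measurable_funB (measurable_funM m1 n1)
    (measurable_funM m2 n2)) => x _.
  by symmetry; exact: ReM.
apply: eq_measurable_fun (measurable_funD (measurable_funM m1 n2)
  (measurable_funM m2 n1)) => x _.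
by symmetry; exact: ImM.
Qed.

Lemma cmeasurableN p q f : cmeasurable p q f -> cmeasurable p q (fun x => - f x).
Proof.
move=> mf; apply: eq_cmeasurable (cmeasurableM (cmeasurable_cst p q (-1)) mf).
by move=> x _; rewrite mulN1r.
Qed.

Lemma cboundedD p q f g : cbounded p q f -> cbounded p q g ->
  cbounded p q (fun x => f x + g x).
Proof.
by move=> [M fM] [N gN]; exists (M + N) => x h; apply: cmod_add_le; auto.
Qed.

Lemma cboundedM p q f g : cbounded p q f -> cbounded p q g ->
  cbounded p q (fun x => f x * g x).
Proof.
by move=> [M fM] [N gN]; exists (M * N) => x h; apply: cmod_mul_le; auto.
Qed.

Lemma cbounded_cst p q (c : C) : cbounded p q (fun=> c).
Proof. by exists (cmod c). Qed.

Lemma CintD p q f g : cmeasurable p q f -> cbounded p q f ->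
  cmeasurable p q g -> cbounded p q g ->
  Cint p q (fun x => f x + g x) = Cint p q f + Cint p q g.
Proof.
move=> mf bf mg bg; rewrite /Cint; apply: complex_eqP; rewrite !ReImE.
  transitivity (\int[mu]_(x in `[p, q]) (Re (f x) + Re (g x))).
    by apply: eq_Rintegral => x _; exact: ReD.
  by rewrite RintegralD //; exact: cintegrable_Re.
transitivity (\int[mu]_(x in `[p, q]) (Im (f x) + Im (g x))).
    by apply: eq_Rintegral => x _; exact: ImD.
by rewrite RintegralD //; exact: cintegrable_Im.
Qed.

Lemma CintZ p q (c : C) f : cmeasurable p q f -> cbounded p q f ->
  Cint p q (fun x => c * f x) = c * Cint p q f.
Proof.
move=> mf bf; have ir := cintegrable_Re mf bf; have ii := cintegrable_Im mf bf.
have scaled (k : R) (h : R -> R) : mu.-integrable `[p, q] (EFin \o h) ->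
    mu.-integrable `[p, q] (EFin \o (fun x => k * h x)).
  move=> ih; rewrite (_ : EFin \o _ = (fun x => k%:E * (EFin \o h) x)%E).
    exact: integrableZl.
  by apply/funext => x /=; rewrite EFinM.
rewrite /Cint; apply: complex_eqP; rewrite !ReImE.
  transitivity (\int[mu]_(x in `[p, q]) (Re c * Re (f x) - Im c * Im (f x))).
    by apply: eq_Rintegral => x _; exact: ReM.
  by rewrite RintegralB ?RintegralZl //; exact: scaled.
transitivity (\int[mu]_(x in `[p, q]) (Re c * Im (f x) + Im c * Re (f x))).
    by apply: eq_Rintegral => x _; exact: ImM.
by rewrite RintegralD ?RintegralZl //; exact: scaled.
Qed.

Lemma Cint_norm p q f (M : R) : p <= q -> cmeasurable p q f ->
  (forall x, p <= x <= q -> cmod (f x) <= M) ->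
  cmod (Cint p q f) <= 2 * (q - p) * M.
Proof.
move=> pq mf fM; have bf : cbounded p q f by exists M.
have key (h : R -> R) : mu.-integrable `[p, q] (EFin \o h) ->
    (forall x, p <= x <= q -> `|h x| <= M) ->
    `|\int[mu]_(x in `[p, q]) h x| <= (q - p) * M.
  move=> ih hM; apply: le_trans (le_normr_Rintegral _ ih) _ => //.
  have -> : (q - p) * M = \int[mu]_(x in `[p, q]) M.
    rewrite Rintegral_cst // mulrC; congr (_ * _).
    rewrite [X in fine X](lebesgue_measure_itv `[p, q]) /= lte_fin; case: ltP => //.
    by move=> qp; rewrite (le_anti (introT andP (conj pq qp))) subrr.
  apply: le_Rintegral => //.
  - by have := integrable_norm ih.
  - apply: (@bounded_integrable p q (fun=> M) `|M|) => //; exact: measurable_cst.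
have h0 := cmod_le (Cint p q f).
have h1 := key _ (cintegrable_Re mf bf) (fun x h => le_trans (cmod_Re _) (fM x h)).
have h2 := key _ (cintegrable_Im mf bf) (fun x h => le_trans (cmod_Im _) (fM x h)).
apply: (le_trans h0).
have -> : 2 * (q - p) * M = (q - p) * M + (q - p) * M by ring.
exact: lerD.
Qed.

Lemma cmeasurable_lim p q (fn : nat -> R -> C) f :
  (forall n, cmeasurable p q (fn n)) ->
  (forall x, p <= x <= q -> forall e : R, 0 < e ->
     exists n0, forall n, (n0 <= n)%N -> cmod (fn n x - f x) < e) ->
  cmeasurable p q f.
Proof.
move=> mfn lim; split.
  apply: (@measurable_fun_cvg _ _ _ _ (fun n x => Re (fn n x))).
    by move=> n; case: (mfn n).
  move=> x /segmentE /lim H; apply/cvgrPdist_lt => e /H[n0 Hn].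
  exists n0 => // n /= /Hn h; rewrite distrC -ReN -ReD.
  exact: le_lt_trans (cmod_Re _) h.
apply: (@measurable_fun_cvg _ _ _ _ (fun n x => Im (fn n x))).
  by move=> n; case: (mfn n).
move=> x /segmentE /lim H; apply/cvgrPdist_lt => e /H[n0 Hn].
exists n0 => // n /= /Hn h; rewrite distrC -ImN -ImD.
exact: le_lt_trans (cmod_Im _) h.
Qed.

Lemma ccontinuous_on_within p q f (P : C -> R) :
  (forall z, `|P z| <= cmod z) -> (forall z w, P (z - w) = P z - P w) ->
  ccontinuous_on p q f -> {within `[p, q], continuous (fun x => P (f x))}.
Proof.
move=> Pn PB fc; apply/subspace_continuousP => x /segmentE xpq.
apply/cvgrPdist_lt => e e0; have [d d0 H] := fc x xpq e e0.
rewrite /within /=; apply/nbhs_ballP; exists d => // y.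
rewrite /ball /= distrC => yd /segmentE ypq; rewrite distrC -PB.
by apply: le_lt_trans (Pn _) _; exact: H.
Qed.

Lemma ccontinuous_on_Re p q f : ccontinuous_on p q f ->
  {within `[p, q], continuous (fun x => Re (f x))}.
Proof.
apply: ccontinuous_on_within; first exact: cmod_Re.
by move=> z w; rewrite ReD ReN.
Qed.

Lemma ccontinuous_on_Im p q f : ccontinuous_on p q f ->
  {within `[p, q], continuous (fun x => Im (f x))}.
Proof.
apply: ccontinuous_on_within; first exact: cmod_Im.
by move=> z w; rewrite ImD ImN.
Qed.

Lemma ccontinuous_on_measurable p q f : ccontinuous_on p q f -> cmeasurable p q f.
Proof.
move=> fc; split; apply: subspace_continuous_measurable_fun => //.
  exact: ccontinuous_on_Re.
exact: ccontinuous_on_Im.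
Qed.

Lemma ccontinuous_on_bounded p q f : ccontinuous_on p q f -> cbounded p q f.
Proof.
have [qp|pq] := ltP q p.
  by move=> _; exists 0 => x /andP[px xq]; have := le_trans px xq; lra.
move=> fc.
have bd (h : R -> R) : {within `[p, q], continuous h} ->
    exists M, forall x, p <= x <= q -> `|h x| <= M.
  move=> hc; have [c1 _ H1] := EVT_max pq hc; have [c2 _ H2] := EVT_min pq hc.
  exists (`|h c1| + `|h c2|) => x xpq; have xi : x \in `[p, q] by rewrite in_itv.
  have := H1 x xi; have := H2 x xi; have := ler_norm (h c1).
  have := ler_norm (- h c2); rewrite normrN => *.
  have := normr_ge0 (h c1); have := normr_ge0 (h c2) => *.
  by rewrite ler_norml; apply/andP; split; lra.
have [M1 H1] := bd _ (ccontinuous_on_Re fc); have [M2 H2] := bd _ (ccontinuous_on_Im fc).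
exists (M1 + M2) => x xpq; apply: le_trans (cmod_le _) _.
by have := H1 x xpq; have := H2 x xpq; lra.
Qed.

Lemma ccontinuous_onD p q f g : ccontinuous_on p q f -> ccontinuous_on p q g ->
  ccontinuous_on p q (fun x => f x + g x).
Proof.
move=> fc gc x xpq e e0; have e20 : 0 < e / 2 by rewrite divr_gt0.
have [d d0 H] := fc x xpq _ e20; have [d' d'0 H'] := gc x xpq _ e20.
exists (Num.min d d'); first by rewrite lt_min d0.
move=> y ypq; rewrite lt_min => /andP[/(H y ypq) h /(H' y ypq) h'].
have -> : f y + g y - (f x + g x) = (f y - f x) + (g y - g x) by ring.
by have := cmodD (f y - f x) (g y - g x); lra.
Qed.

Lemma ccontinuous_on_comp p q f (G : C -> C) : ccontinuous_on p q f ->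
  (forall x, p <= x <= q -> ccontinuous G (f x)) ->
  ccontinuous_on p q (fun x => G (f x)).
Proof.
move=> fc Gc x xpq e e0; have [d d0 H] := Gc x xpq e e0.
have [d' d'0 H'] := fc x xpq d d0; exists d' => // y ypq yx.
by apply: H; exact: H'.
Qed.

Lemma ccontinuous_onM p q f g : ccontinuous_on p q f -> ccontinuous_on p q g ->
  ccontinuous_on p q (fun x => f x * g x).
Proof.
move=> fc gc x xpq e e0.
have x0 := cmod_ge0 (f x); have y0 := cmod_ge0 (g x).
pose K := cmod (f x) + cmod (g x) + 1.
have K0 : 0 < K by rewrite /K; lra.
pose e1 := Num.min 1 (e / (2 * K)).
have e10 : 0 < e1 by rewrite lt_min ltr01 divr_gt0 // mulr_gt0.
have [d d0 H] := fc x xpq _ e10; have [d' d'0 H'] := gc x xpq _ e10.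
exists (Num.min d d'); first by rewrite lt_min d0.
move=> y ypq; rewrite lt_min => /andP[/(H y ypq) /ltW h /(H' y ypq) /ltW h'].
have E1 : e1 <= 1 by rewrite ge_min lexx.
have E2 : e1 * (2 * K) <= e by rewrite -ler_pdivlMr ?mulr_gt0 // ge_min lexx orbT.
have -> : f y * g y - f x * g x = (f y - f x) * (g y - g x) + f x * (g y - g x)
   + (f y - f x) * g x by ring.
have := cmod_add_le (cmod_add_le (cmod_mul_le h h')
  (cmod_mul_le (lexx (cmod (f x))) h')) (cmod_mul_le h (lexx (cmod (g x)))).
move=> hh; apply: (le_lt_trans hh).
have : e1 * e1 + cmod (f x) * e1 + e1 * cmod (g x) <= e1 * K by rewrite /K; nra.
by nra.
Qed.

Lemma ccontinuous_on_cst p q (c : C) : ccontinuous_on p q (fun=> c).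
Proof. by move=> x _ e e0; exists 1 => // y _ _; rewrite subrr cmod0. Qed.

Lemma ccontinuous_on_real p q (h : R -> R) :
  (forall x, p <= x <= q -> {for x, continuous h}) ->
  ccontinuous_on p q (fun x => (h x)%:C%C).
Proof.
move=> hc x xpq e e0; have := hc x xpq; move=> /cvgrPdist_lt /(_ e e0).
move=> /nbhs_ballP[d d0 H]; exists d => // y _ yx.
rewrite -rmorphB cmod_real distrC; apply: H; by rewrite /ball /= distrC.
Qed.

Lemma Cint_FTC p q (F f : R -> C) : p < q ->
  ccontinuous_on p q f -> ccontinuous_on p q F ->
  (forall x, p < x < q -> is_derive x 1 (fun y => Re (F y)) (Re (f x)) /\
     is_derive x 1 (fun y => Im (F y)) (Im (f x))) ->
  Cint p q f = F q - F p.
Proof.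
move=> pq fc Fc dF.
have LR (G : R -> R) : {within `[p, q], continuous G} ->
    (forall x, p < x < q -> derivable G x 1) -> derivable_oo_LRcontinuous G p q.
  move=> /(continuous_within_itvP _ pq)[_ h1 h2] dG.
  by split => // x; rewrite in_itv; exact: dG.
have main (G g : R -> R) : {within `[p, q], continuous G} ->
    {within `[p, q], continuous g} ->
    (forall x, p < x < q -> is_derive x 1 G (g x)) ->
    \int[mu]_(x in `[p, q]) g x = G q - G p.
  move=> cG cg dG; rewrite /Rintegral (@continuous_FTC2 _ g G) //.
    by apply: LR => // x /dG [].
  by move=> x; rewrite in_itv /= => /dG [_ <-]; rewrite derive1E.
have dR x : p < x < q -> is_derive x 1 (fun y => Re (F y)) (Re (f x)).
  by move=> /dF[].
have dI x : p < x < q -> is_derive x 1 (fun y => Im (F y)) (Im (f x)).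
  by move=> /dF[].
have eR := main _ _ (ccontinuous_on_Re Fc) (ccontinuous_on_Re fc) dR.
have eI := main _ _ (ccontinuous_on_Im Fc) (ccontinuous_on_Im fc) dI.
by apply: complex_eqP; rewrite !ReImE; [exact: eR|exact: eI].
Qed.

Lemma conjc_Cint p q f : cmeasurable p q f -> cbounded p q f ->
  ((Cint p q f)^*)%C = Cint p q (fun x => ((f x)^*)%C).
Proof.
move=> mf bf; rewrite /Cint /=; congr Complex.
  by apply: eq_Rintegral => x _; case: (f x).
rewrite -mulN1r -RintegralZl //; last exact: cintegrable_Im.
apply: eq_Rintegral => x _.
by case: (f x) => u v /=; rewrite mulN1r.
Qed.

End ComplexIntegral.

(** * Integrals depending analytically on a parameter *)

Section ParameterIntegral.
Context {R : realType}.
Local Notation C := R[i].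

Lemma Im_Cint_eq0 p q (f : R -> C) : (forall x, p <= x <= q -> Im (f x) = 0) ->
  Im (Cint p q f) = 0.
Proof.
move=> f0; rewrite /Cint ImC.
transitivity (\int[@lebesgue_measure R]_(x in `[p, q]) (0 : R)).
  by apply: eq_Rintegral => x; rewrite inE => /segmentE; exact: f0.
by rewrite Rintegral_cst // mul0r.
Qed.

(** Expansions may be integrated term by term: their coefficients are limits of
difference quotients, hence measurable in the parameter. *)
Lemma unif_expansion_int {I : Type} (S : set I) p q (f : I -> R -> C -> C) z f1 f2 :
  p <= q ->
  unif_expansion [set ix : I * R | S ix.1 /\ p <= ix.2 <= q]
    (fun ix u => f ix.1 ix.2 u) z f1 f2 ->
  (exists2 d : R, 0 < d & forall i, S i -> forall h, cmod h < d ->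
     cmeasurable p q (fun x => f i x (z + h))) ->
  unif_expansion S (fun i u => Cint p q (fun x => f i x u)) z
    (fun i => Cint p q (fun x => f1 (i, x)))
    (fun i => Cint p q (fun x => f2 (i, x))).
Proof.
move=> pq [M [d [M1 d0 H]]] [d' d'0 mf].
pose dm := Num.min 1 (Num.min d d').
have dm0 : 0 < dm by rewrite !lt_min ltr01 d0.
have dm1 : dm <= 1 by rewrite ge_min lexx.
have dmd : dm <= d by rewrite !ge_min lexx orbT.
have dmd' : dm <= d' by rewrite !ge_min lexx !orbT.
have mfz i : S i -> cmeasurable p q (fun x => f i x z).
  move=> Si; have := mf i Si 0; rewrite cmod0 => /(_ d'0).
  by under eq_fun do rewrite addr0.
pose t (n : nat) : R := dm / n.+2%:R.
have t0 n : 0 < t n by rewrite divr_gt0.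
have tdm n : t n < dm.
  by rewrite /t ltr_pdivrMr // ltr_pMr // ltr1n.
have tlim (e : R) : 0 < e -> exists n0, forall n, (n0 <= n)%N -> t n < e.
  move=> e0; exists (Num.trunc (dm / e)) => n hn.
  rewrite /t ltr_pdivrMr // mulrC -ltr_pdivrMr //.
  apply: lt_le_trans (_ : (Num.trunc (dm / e)).+1%:R <= _).
    exact: truncnS_gt.
  by rewrite ler_nat ltnS (leq_trans hn).
have ct n : cmod (t n)%:C%C = t n by rewrite cmod_real gtr0_norm.
have tn0 n : (t n)%:C%C != 0 :> C by rewrite -cmod_gt0 ct.
have rem i x n : S i -> p <= x <= q ->
    cmod (f i x (z + (t n)%:C%C) -
      (f i x z + f1 (i, x) * (t n)%:C%C + f2 (i, x) * (t n)%:C%C ^+ 2))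
    <= M * t n ^+ 3.
  move=> Si xpq; have [_ _ _ ar] := H (i, x) (conj Si xpq).
  by have := ar (t n)%:C%C; rewrite ct; apply; have := tdm n; lra.
have mq i n : S i -> cmeasurable p q (fun x => f i x (z + (t n)%:C%C)).
  by move=> Si; apply: mf => //; rewrite ct; have := tdm n; lra.
have m1 i : S i -> cmeasurable p q (fun x => f1 (i, x)).
  move=> Si; apply: (@cmeasurable_lim _ p q
    (fun n x => (t n)%:C%C^-1 * (f i x (z + (t n)%:C%C) + - f i x z))).
    move=> n; apply: cmeasurableM; first exact: cmeasurable_cst.
    by apply: cmeasurableD; [exact: mq|apply: cmeasurableN; exact: mfz].
  move=> x xpq e e0; have e2 : 0 < e / (2 * M) by rewrite divr_gt0 //; lra.
  have [n0 Hn] := tlim _ e2; exists n0 => n /Hn.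
  have M20 : 0 < 2 * M by lra.
  rewrite ltr_pdivlMr // => tn.
  have [_ _ a2 _] := H (i, x) (conj Si xpq).
  have -> : (t n)%:C%C^-1 * (f i x (z + (t n)%:C%C) + - f i x z) - f1 (i, x) =
    (t n)%:C%C^-1 * (f i x (z + (t n)%:C%C) -
      (f i x z + f1 (i, x) * (t n)%:C%C + f2 (i, x) * (t n)%:C%C ^+ 2)) +
    f2 (i, x) * (t n)%:C%C by field; exact: tn0.
  have h1 : cmod ((t n)%:C%C^-1 * (f i x (z + (t n)%:C%C) -
      (f i x z + f1 (i, x) * (t n)%:C%C + f2 (i, x) * (t n)%:C%C ^+ 2)))
      <= M * t n ^+ 2.
    rewrite cmodM cmodV ct mulrC ler_pdivrMr //.
    by apply: le_trans (rem i x n Si xpq) _; rewrite -mulrA -exprSr.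
  have h2 : cmod (f2 (i, x) * (t n)%:C%C) <= M * t n.
    by apply: cmod_mul_le => //; rewrite ct.
  apply: le_lt_trans (cmod_add_le h1 h2) _.
  have tt : t n ^+ 2 <= t n.
    by rewrite expr2 ler_piMr ?(ltW (t0 n)) //; have := tdm n; lra.
  have : M * t n ^+ 2 <= M * t n by rewrite ler_pM2l //; lra.
  lra.
have m2 i : S i -> cmeasurable p q (fun x => f2 (i, x)).
  move=> Si; apply: (@cmeasurable_lim _ p q (fun n x => (t n)%:C%C^-1 ^+ 2 *
     (f i x (z + (t n)%:C%C) + - (f i x z + f1 (i, x) * (t n)%:C%C)))).
    move=> n; apply: cmeasurableM; first exact: cmeasurable_cst.
    apply: cmeasurableD; first exact: mq.
    apply: cmeasurableN; apply: cmeasurableD; first exact: mfz.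
    by apply: cmeasurableM; [exact: m1|exact: cmeasurable_cst].
  move=> x xpq e e0; have e2 : 0 < e / M by rewrite divr_gt0 //; lra.
  have [n0 Hn] := tlim _ e2; exists n0 => n /Hn.
  rewrite ltr_pdivlMr; last lra.
  move=> tn; apply: le_lt_trans tn.
  have -> : (t n)%:C%C^-1 ^+ 2 * (f i x (z + (t n)%:C%C) +
      - (f i x z + f1 (i, x) * (t n)%:C%C)) - f2 (i, x) =
    (t n)%:C%C^-1 ^+ 2 * (f i x (z + (t n)%:C%C) -
      (f i x z + f1 (i, x) * (t n)%:C%C + f2 (i, x) * (t n)%:C%C ^+ 2)).
    by field; exact: tn0.
  rewrite cmodM cmodX cmodV ct exprVn mulrC ler_pdivrMr ?exprn_gt0 //.
  apply: le_trans (rem i x n Si xpq) _.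
  by rewrite [t n * M]mulrC -mulrA -exprS.
pose L := 2 * (q - p) * M.
have L0 : 0 <= L by rewrite !mulr_ge0 //; lra.
exists (1 + L), dm; split => //; first lra.
move=> i Si.
have a0 x : p <= x <= q -> cmod (f i x z) <= M.
  by move=> xpq; have [] := H (i, x) (conj Si xpq).
have a1 x : p <= x <= q -> cmod (f1 (i, x)) <= M.
  by move=> xpq; have [] := H (i, x) (conj Si xpq).
have a2 x : p <= x <= q -> cmod (f2 (i, x)) <= M.
  by move=> xpq; have [] := H (i, x) (conj Si xpq).
have c0 := Cint_norm pq (mfz i Si) a0.
have c1 := Cint_norm pq (m1 i Si) a1.
have c2 := Cint_norm pq (m2 i Si) a2.
split; [rewrite /L in L0 *; lra..|] => h hd.
have ar x : p <= x <= q -> cmod (f i x (z + h) -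
    (f i x z + f1 (i, x) * h + f2 (i, x) * h ^+ 2)) <= M * cmod h ^+ 3.
  move=> xpq; have [_ _ _] := H (i, x) (conj Si xpq); apply; lra.
have mh : cmeasurable p q (fun x => f i x (z + h)) by apply: mf => //; lra.
have mr : cmeasurable p q (fun x => f i x z + (h * f1 (i, x) + h ^+ 2 * f2 (i, x))).
  apply: cmeasurableD; first exact: mfz.
  by apply: cmeasurableD; apply: cmeasurableM; [exact: cmeasurable_cst|exact: m1
    |exact: cmeasurable_cst|exact: m2].
have b0 : cbounded p q (fun x => f i x z) by exists M.
have b1 : cbounded p q (fun x => h * f1 (i, x)).
  by apply: cboundedM; [exact: cbounded_cst|exists M].
have b2 : cbounded p q (fun x => h ^+ 2 * f2 (i, x)).
  by apply: cboundedM; [exact: cbounded_cst|exists M].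
have n1 : cmeasurable p q (fun x => h * f1 (i, x)).
  by apply: cmeasurableM; [exact: cmeasurable_cst|exact: m1].
have n2 : cmeasurable p q (fun x => h ^+ 2 * f2 (i, x)).
  by apply: cmeasurableM; [exact: cmeasurable_cst|exact: m2].
pose rm x := f i x (z + h) + - (f i x z + (h * f1 (i, x) + h ^+ 2 * f2 (i, x))).
have mrm : cmeasurable p q rm.
  by apply: cmeasurableD => //; apply: cmeasurableN.
have arm x : p <= x <= q -> cmod (rm x) <= M * cmod h ^+ 3.
  move=> /ar; rewrite /rm; congr (cmod _ <= _); ring.
have -> : Cint p q (fun x => f i x (z + h)) =
    Cint p q (fun x => rm x + (f i x z + (h * f1 (i, x) + h ^+ 2 * f2 (i, x)))).
  by apply: eq_Cint => x _; rewrite /rm subrK.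
have brm : cbounded p q rm by exists (M * cmod h ^+ 3).
have n12 := cmeasurableD n1 n2; have b12 := cboundedD b1 b2.
have mz := mfz i Si; have b012 := cboundedD b0 b12.
have m1i := m1 i Si; have m2i := m2 i Si.
have c1b : cbounded p q (fun x => f1 (i, x)) by exists M.
have c2b : cbounded p q (fun x => f2 (i, x)) by exists M.
rewrite (CintD mrm brm mr b012) (CintD mz b0 n12 b12) (CintD n1 b1 n2 b2).
rewrite (CintZ h m1i c1b) (CintZ (h ^+ 2) m2i c2b).
set i0 := Cint p q (fun x => f i x z); set i1 := Cint p q (fun x => f1 (i, x)).
set i2 := Cint p q (fun x => f2 (i, x)).
have -> : Cint p q rm + (i0 + (h * i1 + h ^+ 2 * i2)) - (i0 + i1 * h + i2 * h ^+ 2)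
  = Cint p q rm by ring.
apply: le_trans (Cint_norm pq mrm arm) _.
rewrite [leLHS]mulrA -/L; apply: ler_wpM2r; last lra.
by rewrite exprn_ge0 ?cmod_ge0.
Qed.

End ParameterIntegral.

(** * The complex exponential *)

Section Exponential.
Context {R : realType}.
Local Notation C := R[i].
Implicit Types (z w : C).

Definition cexp z : C :=
  Complex (expR (Re z) * cos (Im z)) (expR (Re z) * sin (Im z)).

Lemma cexpD z w : cexp (z + w) = cexp z * cexp w.
Proof.
apply: complex_eqP; rewrite /cexp !ReImE expRD ?cosD ?sinD; ring.
Qed.

Lemma cexp0 : cexp 0 = 1.
Proof. by rewrite /cexp /= expR0 cos0 sin0 mulr1 mulr0. Qed.

Lemma cmod_cexp z : cmod (cexp z) = expR (Re z).
Proof.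
rewrite cmodE /cexp ReC ImC !exprMn -mulrDr cos2Dsin2 mulr1 sqrtr_sqr.
by rewrite ger0_norm // expR_ge0.
Qed.

Lemma cexp_neq0 z : cexp z != 0.
Proof. by rewrite -cmod_gt0 cmod_cexp expR_gt0. Qed.

Lemma cexpN z : cexp (- z) = (cexp z)^-1.
Proof.
apply: (mulfI (cexp_neq0 z)); rewrite -cexpD subrr cexp0 mulfV //.
exact: cexp_neq0.
Qed.

Lemma cexp_real (x : R) : cexp x%:C%C = (expR x)%:C%C.
Proof. by rewrite /cexp /= cos0 sin0 mulr1 mulr0. Qed.

Lemma cexp_eq1 z : cexp z = 1 -> `|Im z| < 2 * pi -> z = 0.
Proof.
move=> ez hz.
have Re0 : Re z = 0.
  by have := cmod_cexp z; rewrite ez cmod1 => /esym/eqP; rewrite -expR0 => /eqP/expR_inj.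
have [h1 h2] : cos (Im z) = 1 /\ sin (Im z) = 0.
  by move: ez; rewrite /cexp Re0 expR0 !mul1r => -[].
suff Im0 : Im z = 0 by apply: complex_eqP; rewrite ?Re0 ?Im0.
have cs : sin (Im z / 2) = 0.
  have e2 : Im z / 2 *+ 2 = Im z by rewrite -mulr_natr divfK ?pnatr_eq0.
  have := cos_mulr2n (Im z / 2); rewrite e2 h1.
  rewrite cos2sin2 => hh; apply/eqP; rewrite -sqrf_eq0; apply/eqP.
  by move: hh; rewrite mulr2n; lra.
have pos (y : R) : 0 < y < pi -> sin y != 0 by move=> /sin_gt0_pi h; rewrite gt_eqF.
move: hz; rewrite ltr_norml => /andP[l1 l2].
case: (ltgtP (Im z) 0) => // hz.
  have : sin (- (Im z / 2)) != 0 by apply: pos; lra.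
  by rewrite sinN cs oppr0 eqxx.
have : sin (Im z / 2) != 0 by apply: pos; lra.
by rewrite cs eqxx.
Qed.

Lemma cexp_path_continuous p q z :
  ccontinuous_on p q (fun s : R => cexp (s%:C%C * z)).
Proof.
have -> : (fun s : R => cexp (s%:C%C * z)) = (fun s : R =>
    (expR (s * Re z) * cos (s * Im z))%:C%C +
    Complex 0 1 * (expR (s * Re z) * sin (s * Im z))%:C%C).
  by apply/funext => s; apply: complex_eqP; rewrite /cexp !ReImE; 
     rewrite !(mul0r, mulr0, mul1r, subr0, addr0, add0r).
have cl (y : R) s : {for s, continuous (fun s : R => s * y)}.
  by apply: continuousM; [exact: cvg_id|exact: cst_continuous].
have ce s : {for s, continuous (fun s : R => expR (s * Re z))}.
  by apply: (continuous_comp (cl _ _)); exact: continuous_expR.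
apply: ccontinuous_onD.
  apply: ccontinuous_on_real => s _; apply: continuousM; first exact: ce.
  by apply: (continuous_comp (cl _ _)); exact: continuous_cos.
apply: ccontinuous_onM; first exact: ccontinuous_on_cst.
apply: ccontinuous_on_real => s _; apply: continuousM; first exact: ce.
by apply: (continuous_comp (cl _ _)); exact: continuous_sin.
Qed.

(** [expm1q z] is the entire function [(exp z - 1) / z]; its integral form
is regular at [0] and is bounded below where [exp z = 1] has only the trivial
solution. *)
Definition expm1q z : C := Cint 0 1 (fun s => cexp (s%:C%C * z)).

Lemma cexp_path_measurable p q z : cmeasurable p q (fun s : R => cexp (s%:C%C * z)).
Proof. by apply: ccontinuous_on_measurable; exact: cexp_path_continuous. Qed.

Lemma cexp_path_bounded p q z : cbounded p q (fun s : R => cexp (s%:C%C * z)).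
Proof. by apply: ccontinuous_on_bounded; exact: cexp_path_continuous. Qed.

Lemma mul_expm1q z : z * expm1q z = cexp z - 1.
Proof.
rewrite /expm1q -CintZ; last 2 first.
- exact: cexp_path_measurable.
- exact: cexp_path_bounded.
rewrite (@Cint_FTC _ 0 1 (fun s => cexp (s%:C%C * z))) ?ltr01 //.
- by rewrite mul1r mul0r cexp0.
- by apply: ccontinuous_onM; [exact: ccontinuous_on_cst|exact: cexp_path_continuous].
- exact: cexp_path_continuous.
move=> s _.
have dx (y : R) : is_derive s 1 (fun t : R => t * y) y.
  by apply: is_derive_eq; rewrite scaler0 add0r /GRing.scale /= mulr1.
have de : is_derive s 1 (fun t : R => expR (t * Re z)) (expR (s * Re z) * Re z).
  exact: (@is_derive1_comp _ expR (fun t => t * Re z)).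
have dc : is_derive s 1 (fun t : R => cos (t * Im z)) (- sin (s * Im z) * Im z).
  exact: (@is_derive1_comp _ cos (fun t => t * Im z)).
have ds : is_derive s 1 (fun t : R => sin (t * Im z)) (cos (s * Im z) * Im z).
  exact: (@is_derive1_comp _ sin (fun t => t * Im z)).
split.
  have -> : (fun y : R => Re (cexp (y%:C%C * z))) =
      (fun t => expR (t * Re z)) * (fun t => cos (t * Im z)).
    by apply/funext => y; rewrite /cexp !ReImE !(mul0r, subr0, addr0).
  apply: is_derive_eq; rewrite /cexp !ReImE !(mul0r, subr0, addr0) /GRing.scale /=.
  by ring.
have -> : (fun y : R => Im (cexp (y%:C%C * z))) =
    (fun t => expR (t * Re z)) * (fun t => sin (t * Im z)).
  by apply/funext => y; rewrite /cexp !ReImE !(mul0r, subr0, addr0).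
apply: is_derive_eq; rewrite /cexp !ReImE !(mul0r, subr0, addr0) /GRing.scale /=.
by ring.
Qed.

Lemma Cint_cst01 (c : C) : Cint 0 1 (fun=> c) = c.
Proof.
apply: complex_eqP; rewrite /Cint !ReImE Rintegral_cst // ?lebesgue_measure_itv /=;
  by rewrite [X in fine X](lebesgue_measure_itv `[0, 1]) /= lte_fin ltr01 /= subr0 mulr1.
Qed.

Lemma Cint_id01 : Cint 0 1 (fun s => s%:C%C) = (2^-1)%:C%C :> C.
Proof.
have cid p q : ccontinuous_on p q (fun s : R => s%:C%C).
  by apply: ccontinuous_on_real => s _; exact: cvg_id.
rewrite (@Cint_FTC _ 0 1 (fun s => (s ^+ 2 / 2)%:C%C)) ?ltr01 //.
- by rewrite -rmorphB expr1n expr0n /= mul0r subr0 mul1r.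
- apply: ccontinuous_on_real => s _; apply: continuousM; last exact: cst_continuous.
  exact: exprn_continuous.
move=> s _; split; last first.
  by rewrite /=; exact: is_derive_cst.
rewrite /=; apply: is_derive_eq; rewrite /GRing.scale /=.
by field.
Qed.

Let K := 2 * expR (1 : R).

(** Each of the following Taylor bounds results from the preceding one under the
integral [exp z - 1 = z * int_0^1 exp (s z) ds]. *)
Lemma cexp_taylor0 z : cmod z <= 1 -> cmod (cexp z - 1) <= K * cmod z.
Proof.
move=> z1; rewrite -mul_expm1q cmodM mulrC ler_wpM2r ?cmod_ge0 //.
have -> : K = 2 * (1 - 0) * expR 1 by rewrite subr0 mulr1.
rewrite /expm1q.
apply: Cint_norm => //; first exact: cexp_path_measurable.
move=> s /andP[s0 s1]; rewrite cmod_cexp ler_expR !ReImE mul0r subr0.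
have := ler_norm (Re z); have := cmod_Re z => h1 h2.
have h3 : s * Re z <= s * 1 by apply: ler_wpM2l => //; lra.
by lra.
Qed.

Lemma cexp_taylor1 z : cmod z <= 1 -> cmod (cexp z - 1 - z) <= 2 * K * cmod z ^+ 2.
Proof.
move=> z1.
have -> : cexp z - 1 - z = z * Cint 0 1 (fun s => cexp (s%:C%C * z) + -1).
  rewrite (CintD (cexp_path_measurable 0 1 z) (cexp_path_bounded 0 1 z)
    (cmeasurable_cst 0 1 (-1)) (cbounded_cst 0 1 (-1))).
  by rewrite Cint_cst01 -/(expm1q z) mulrDr mul_expm1q mulrN1.
rewrite cmodM mulrC expr2 mulrA ler_wpM2r ?cmod_ge0 //.
have -> : 2 * K * cmod z = 2 * (1 - 0) * (K * cmod z) by ring.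
apply: Cint_norm => //.
  by apply: cmeasurableD; [exact: cexp_path_measurable|exact: cmeasurable_cst].
move=> s /andP[s0 s1].
have sz : cmod (s%:C%C * z) <= cmod z.
  by rewrite cmodM cmod_real ger0_norm // ler_piMl ?cmod_ge0.
apply: le_trans (cexp_taylor0 _) _; first lra.
by apply: ler_wpM2l => //; rewrite mulr_ge0 // expR_ge0.
Qed.

Lemma cexp_taylor2 z : cmod z <= 1 ->
  cmod (cexp z - (1 + z + z ^+ 2 / 2)) <= 4 * K * cmod z ^+ 3.
Proof.
move=> z1.
have cid p q : ccontinuous_on p q (fun s : R => s%:C%C * - z).
  apply: ccontinuous_onM; last exact: ccontinuous_on_cst.
  by apply: ccontinuous_on_real => s _; exact: cvg_id.
have cid' p q : ccontinuous_on p q (fun s : R => s%:C%C).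
  by apply: ccontinuous_on_real => s _; exact: cvg_id.
have -> : cexp z - (1 + z + z ^+ 2 / 2) =
   z * Cint 0 1 (fun s => (cexp (s%:C%C * z) + -1) + - z * s%:C%C).
  rewrite (CintD (cmeasurableD (cexp_path_measurable 0 1 z)
      (cmeasurable_cst 0 1 (-1)))
    (cboundedD (cexp_path_bounded 0 1 z) (cbounded_cst 0 1 (-1)))
    (cmeasurableM (cmeasurable_cst 0 1 (- z))
      (ccontinuous_on_measurable (cid' 0 1)))
    (cboundedM (cbounded_cst 0 1 (- z)) (ccontinuous_on_bounded (cid' 0 1)))).
  rewrite (CintD (cexp_path_measurable 0 1 z) (cexp_path_bounded 0 1 z)
    (cmeasurable_cst 0 1 (-1)) (cbounded_cst 0 1 (-1))).
  rewrite (CintZ _ (ccontinuous_on_measurable (cid' 0 1))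
    (ccontinuous_on_bounded (cid' 0 1))).
  rewrite Cint_cst01 Cint_id01 -/(expm1q z) fmorphV rmorph_nat !mulrDr mul_expm1q.
  by field; rewrite ?pnatr_eq0.
rewrite cmodM mulrC exprSr mulrA ler_wpM2r ?cmod_ge0 //.
have -> : 4 * K * cmod z ^+ 2 = 2 * (1 - 0) * (2 * K * cmod z ^+ 2) by ring.
apply: Cint_norm => //.
  apply: cmeasurableD; last by apply: cmeasurableM; [exact: cmeasurable_cst|exact: ccontinuous_on_measurable].
  by apply: cmeasurableD; [exact: cexp_path_measurable|exact: cmeasurable_cst].
move=> s /andP[s0 s1].
have sz : cmod (s%:C%C * z) <= cmod z.
  by rewrite cmodM cmod_real ger0_norm // ler_piMl ?cmod_ge0.
have -> : cexp (s%:C%C * z) + -1 + - z * s%:C%C = cexp (s%:C%C * z) - 1 - s%:C%C * z.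
  by ring.
apply: le_trans (cexp_taylor1 _) _; first lra.
apply: ler_wpM2l; first by rewrite !mulr_ge0 // expR_ge0.
by rewrite lerXn2r ?nnegrE ?cmod_ge0.
Qed.

Lemma unif_expansion_cexp {I : Type} (S : set I) (b c : I -> C) z (M : R) :
  (forall i, S i -> cmod (b i) <= M) ->
  (forall i, S i -> cmod (cexp (b i * z + c i)) <= M) ->
  unif_expansion S (fun i u => cexp (b i * u + c i)) z
    (fun i => cexp (b i * z + c i) * b i)
    (fun i => cexp (b i * z + c i) * (b i ^+ 2 / 2)).
Proof.
move=> bM eM; pose L := Num.max 1 M.
have L1 : 1 <= L by rewrite le_max lexx.
have ML : M <= L by rewrite le_max lexx orbT.
have K0 : 2 <= K.
  by rewrite /K; have := expR_ge1Dx (1 : R); lra.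
pose B := L ^+ 3 + 4 * K * L ^+ 4.
have L3 : 1 <= L ^+ 3 by exact: exprn_ege1.
have L4 : 1 <= L ^+ 4 by exact: exprn_ege1.
have LL2 : L * L <= L ^+ 3.
  by rewrite -expr2; apply: ler_weXn2l.
have LL1 : L <= L ^+ 3 by apply: ler_eXnr.
have KL : 0 <= 4 * K * L ^+ 4 by rewrite !mulr_ge0 //; lra.
exists B, L^-1; split; [rewrite /B; lra|by rewrite invr_gt0; lra|].
move=> i Si; have bL := le_trans (bM i Si) ML; have eL := le_trans (eM i Si) ML.
have b2 : cmod (b i ^+ 2 / 2) <= L ^+ 2.
  rewrite cmodM cmodX cmodV.
  have -> : cmod (2 : C) = 2 by rewrite -(rmorph_nat (real_complex R)) cmod_real ger0_norm.
  have : cmod (b i) ^+ 2 <= L ^+ 2 by rewrite lerXn2r ?nnegrE ?cmod_ge0 //; lra.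
  have := sqr_ge0 (cmod (b i)); lra.
split.
- rewrite /B; lra.
- by apply: le_trans (cmod_mul_le eL bL) _; rewrite /B; lra.
- by apply: le_trans (cmod_mul_le eL b2) _; rewrite -exprS /B; lra.
move=> h hL.
have -> : cexp (b i * (z + h) + c i) = cexp (b i * z + c i) * cexp (b i * h).
  by rewrite -cexpD; congr cexp; ring.
have -> : cexp (b i * z + c i) * cexp (b i * h) - (cexp (b i * z + c i) +
   cexp (b i * z + c i) * b i * h + cexp (b i * z + c i) * (b i ^+ 2 / 2) * h ^+ 2) =
  cexp (b i * z + c i) * (cexp (b i * h) - (1 + b i * h + (b i * h) ^+ 2 / 2)).
  by field.
have bh : cmod (b i * h) <= L * cmod h by apply: cmod_mul_le.
have bh1 : cmod (b i * h) <= 1.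
  apply: le_trans bh _; rewrite mulrC -ler_pdivlMr; last lra.
  by rewrite mul1r ltW.
have T := cexp_taylor2 bh1.
apply: le_trans (cmod_mul_le eL T) _.
have : cmod (b i * h) ^+ 3 <= (L * cmod h) ^+ 3.
  by rewrite lerXn2r ?nnegrE ?cmod_ge0 ?mulr_ge0 ?cmod_ge0 //; lra.
rewrite exprMn => h3.
have h30 : 0 <= cmod h ^+ 3 by rewrite exprn_ge0 ?cmod_ge0.
have : L * (4 * K * cmod (b i * h) ^+ 3) <= L * (4 * K * (L ^+ 3 * cmod h ^+ 3)).
  by apply: ler_wpM2l; [lra|apply: ler_wpM2l => //; lra].
have -> : L * (4 * K * (L ^+ 3 * cmod h ^+ 3)) = 4 * K * L ^+ 4 * cmod h ^+ 3 by ring.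
rewrite /B; nra.
Qed.

End Exponential.

(** * Quotients of exponentials *)

Section Quotients.
Context {R : realType}.
Local Notation C := R[i].
Implicit Types (z w : C).

Lemma unif_analytic_cst {I : Type} (S : set I) (c : I -> C) (M : R) z :
  (forall i, S i -> cmod (c i) <= M) -> unif_analytic S (fun i _ => c i) z.
Proof. by move=> cM; do 2 eexists; exact: unif_expansion_cst cM. Qed.

Lemma unif_analyticD {I : Type} (S : set I) (f g : I -> C -> C) z :
  unif_analytic S f z -> unif_analytic S g z ->
  unif_analytic S (fun i u => f i u + g i u) z.
Proof.
move=> [f1 [f2 Hf]] [g1 [g2 Hg]].
by do 2 eexists; exact: (unif_expansionD Hf Hg).
Qed.

Lemma unif_analyticM {I : Type} (S : set I) (f g : I -> C -> C) z :
  unif_analytic S f z -> unif_analytic S g z ->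
  unif_analytic S (fun i u => f i u * g i u) z.
Proof.
move=> [f1 [f2 Hf]] [g1 [g2 Hg]].
by do 2 eexists; exact: (unif_expansionM Hf Hg).
Qed.

Lemma unif_analyticV {I : Type} (S : set I) (f : I -> C -> C) z (c : R) :
  0 < c -> (forall i, S i -> c <= cmod (f i z)) ->
  unif_analytic S f z -> unif_analytic S (fun i u => (f i u)^-1) z.
Proof.
move=> c0 fc [f1 [f2 Hf]]; do 2 eexists; exact: (unif_expansionV c0 fc Hf).
Qed.

Lemma unif_analytic_at {I : Type} (S : set I) (f : I -> C -> C) z i :
  S i -> unif_analytic S f z -> analytic_at (f i) z.
Proof.
move=> Si [f1 [f2 [M [d [M1 d0 H]]]]]; exists (fun=> f1 i), (fun=> f2 i), M, d.
by split => // _ _; exact: H.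
Qed.

Lemma unif_analytic_int {I : Type} (S : set I) p q (f : I -> R -> C -> C) z :
  p <= q ->
  unif_analytic [set ix : I * R | S ix.1 /\ p <= ix.2 <= q]
    (fun ix u => f ix.1 ix.2 u) z ->
  (exists2 d : R, 0 < d & forall i, S i -> forall h, cmod h < d ->
     cmeasurable p q (fun x => f i x (z + h))) ->
  unif_analytic S (fun i u => Cint p q (fun x => f i x u)) z.
Proof.
by move=> pq [f1 [f2 Hf]] mf; do 2 eexists; exact: (unif_expansion_int pq Hf mf).
Qed.

Lemma unif_analytic_cexp {I : Type} (S : set I) (b c : I -> C) z (M : R) :
  (forall i, S i -> cmod (b i) <= M) -> (forall i, S i -> cmod (b i * z + c i) <= M) ->
  unif_analytic S (fun i u => cexp (b i * u + c i)) z.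
Proof.
move=> bM zM; do 2 eexists; apply: (@unif_expansion_cexp _ _ _ _ _ _ (Num.max M (expR M))).
  by move=> i /bM h; rewrite le_max h.
move=> i /zM h; rewrite le_max cmod_cexp ler_expR; apply/orP; right.
by have := ler_norm (Re (b i * z + c i)); have := cmod_Re (b i * z + c i); lra.
Qed.

Lemma analytic_cexp z : analytic_at cexp z.
Proof.
have h1 (i : unit) : [set: unit] i -> cmod (1 : C) <= Num.max 1 (cmod (1 * z + 0)).
  by move=> _; rewrite cmod1 le_max lexx.
have h2 (i : unit) : [set: unit] i -> cmod (1 * z + 0) <= Num.max 1 (cmod (1 * z + 0)).
  by move=> _; rewrite le_max lexx orbT.
have := unif_analytic_cexp h1 h2.
by under eq_fun do under eq_fun do rewrite mul1r addr0.
Qed.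

Lemma unif_analytic_expm1q {I : Type} (S : set I) (b c : I -> C) z (M : R) :
  (forall i, S i -> cmod (b i) <= M) -> (forall i, S i -> cmod (b i * z + c i) <= M) ->
  unif_analytic S (fun i u => expm1q (b i * u + c i)) z.
Proof.
move=> bM zM.
apply: (@unif_analytic_int _ _ 0 1 (fun i s u => cexp (s%:C%C * (b i * u + c i)))) => //; last first.
  by exists 1 => // i _ h _; exact: cexp_path_measurable.
have scale (s : R) w : 0 <= s <= 1 -> cmod w <= M -> cmod (s%:C%C * w) <= M.
  move=> /andP[s0 s1] wM; apply: le_trans wM; rewrite cmodM cmod_real ger0_norm //.
  by rewrite ler_piMl ?cmod_ge0.
have -> : (fun (ix : I * R) u => cexp (ix.2%:C%C * (b ix.1 * u + c ix.1))) =
    (fun (ix : I * R) u => cexp ((ix.2%:C%C * b ix.1) * u + ix.2%:C%C * c ix.1)).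
  by apply/funext => ix; apply/funext => u; rewrite mulrDr mulrA.
apply: (@unif_analytic_cexp _ _ _ _ _ M).
  by move=> [i s] /= [Si s01]; apply: scale => //; exact: bM.
move=> [i s] /= [Si s01]; rewrite -mulrA -mulrDr; apply: scale => //; exact: zM.
Qed.

Lemma analytic_expm1q z : analytic_at expm1q z.
Proof.
have h1 (i : unit) : [set: unit] i -> cmod (1 : C) <= Num.max 1 (cmod (1 * z + 0)).
  by move=> _; rewrite cmod1 le_max lexx.
have h2 (i : unit) : [set: unit] i -> cmod (1 * z + 0) <= Num.max 1 (cmod (1 * z + 0)).
  by move=> _; rewrite le_max lexx orbT.
have := unif_analytic_expm1q h1 h2.
by under eq_fun do under eq_fun do rewrite mul1r addr0.
Qed.

(** The entire function [(expm1q z - 1) / z]. *)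
Definition expm2q z : C := Cint 0 1 (fun s => s%:C%C * expm1q (s%:C%C * z)).

Lemma real_path_continuous p q : ccontinuous_on p q (fun s : R => s%:C%C).
Proof. by apply: ccontinuous_on_real => s _; exact: cvg_id. Qed.

Lemma expm1q_path_continuous p q z :
  ccontinuous_on p q (fun s : R => expm1q (s%:C%C * z)).
Proof.
apply: (@ccontinuous_on_comp _ p q (fun s : R => s%:C%C * z)).
  apply: ccontinuous_onM; first exact: real_path_continuous.
  exact: ccontinuous_on_cst.
by move=> s _; apply: analytic_ccontinuous; exact: analytic_expm1q.
Qed.

Lemma expm2q_path_continuous p q z :
  ccontinuous_on p q (fun s : R => s%:C%C * expm1q (s%:C%C * z)).
Proof.
by apply: ccontinuous_onM; [exact: real_path_continuous|exact: expm1q_path_continuous].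
Qed.

Lemma mul_expm2q z : z * expm2q z = expm1q z - 1.
Proof.
have cm := ccontinuous_on_measurable (@expm2q_path_continuous 0 1 z).
have cb := ccontinuous_on_bounded (@expm2q_path_continuous 0 1 z).
rewrite /expm2q -(CintZ z cm cb).
rewrite (eq_Cint (g := fun s : R => cexp (s%:C%C * z) + -1)).
  rewrite (CintD (cexp_path_measurable 0 1 z) (cexp_path_bounded 0 1 z)
    (cmeasurable_cst 0 1 (-1)) (cbounded_cst 0 1 (-1))).
  by rewrite Cint_cst01.
by move=> s _; rewrite -mul_expm1q; ring.
Qed.

Lemma unif_analytic_expm2q {I : Type} (S : set I) (b c : I -> C) z (M : R) :
  (forall i, S i -> cmod (b i) <= M) -> (forall i, S i -> cmod (b i * z + c i) <= M) ->
  unif_analytic S (fun i u => expm2q (b i * u + c i)) z.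
Proof.
move=> bM zM.
apply: (@unif_analytic_int _ _ 0 1
  (fun i s u => s%:C%C * expm1q (s%:C%C * (b i * u + c i)))) => //; last first.
  exists 1 => // i _ h _; apply: ccontinuous_on_measurable.
  exact: expm2q_path_continuous.
have scale (s : R) w : 0 <= s <= 1 -> cmod w <= M -> cmod (s%:C%C * w) <= M.
  move=> /andP[s0 s1] wM; apply: le_trans wM; rewrite cmodM cmod_real ger0_norm //.
  by rewrite ler_piMl ?cmod_ge0.
apply: unif_analyticM.
  apply: (@unif_analytic_cst _ _ _ 1) => ix [Si /andP[s0 s1]].
  by rewrite cmod_real ger0_norm.
have -> : (fun (ix : I * R) u => expm1q (ix.2%:C%C * (b ix.1 * u + c ix.1))) =
    (fun (ix : I * R) u => expm1q ((ix.2%:C%C * b ix.1) * u + ix.2%:C%C * c ix.1)).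
  by apply/funext => ix; apply/funext => u; rewrite mulrDr mulrA.
apply: (@unif_analytic_expm1q _ _ _ _ _ M).
  by move=> [i s] /= [Si s01]; apply: scale => //; exact: bM.
move=> [i s] /= [Si s01]; rewrite -mulrA -mulrDr; apply: scale => //; exact: zM.
Qed.

Lemma Im_expm1q_real (x : R) : Im (expm1q x%:C%C) = 0.
Proof. by apply: Im_Cint_eq0 => s _; rewrite -rmorphM cexp_real. Qed.

Lemma Im_expm2q_real (x : R) : Im (expm2q x%:C%C) = 0.
Proof.
apply: Im_Cint_eq0 => s _; rewrite -rmorphM ImM Im_expm1q_real.
by rewrite mulr0 /= mul0r addr0.
Qed.

(** Rotating [expm1q z] by half of its angle makes the integrand
[exp (s x) cos ((s - 1/2) y)] of the real part positive. *)
Lemma expm1q_lower z (th X : R) : `|Im z| <= th -> th < pi -> `|Re z| <= X ->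
  cos (th / 2) * expR (- X) <= cmod (expm1q z).
Proof.
move=> hi th1 hr.
have th0 : 0 <= th by apply: le_trans hi.
pose e : C := cexp (Complex 0 (- (Im z / 2))).
have e1 : cmod e = 1 by rewrite cmod_cexp /= expR0.
have -> : cmod (expm1q z) = cmod (e * expm1q z) by rewrite cmodM e1 mul1r.
apply: le_trans (le_trans (ler_norm _) (cmod_Re _)).
have cm := cexp_path_measurable 0 1 z; have cb := cexp_path_bounded 0 1 z.
rewrite /expm1q -(CintZ e cm cb) /Cint ReC.
have cm' := cmeasurableM (cmeasurable_cst 0 1 e) cm.
have cb' := cboundedM (cbounded_cst 0 1 e) cb.
have -> : cos (th / 2) * expR (- X) =
    \int[@lebesgue_measure R]_(x in `[0, 1]) (cos (th / 2) * expR (- X)).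
  rewrite Rintegral_cst // [X in _ = _ * fine X](lebesgue_measure_itv `[0, 1]).
  by rewrite /= lte_fin ltr01 /= subr0 mulr1.
apply: le_Rintegral => //.
- apply: (@bounded_integrable _ 0 1 (fun=> _) `|cos (th / 2) * expR (- X)|) => //.
- exact: cintegrable_Re cm' cb'.
move=> s /segmentE /andP[s0 s1].
rewrite /e -cexpD /cexp ReC !ReImE !mul0r subr0 addr0 add0r.
have -> : - (Im z / 2) + s * Im z = (s - 1 / 2) * Im z by field.
rewrite mulrC; apply: ler_pM.
- exact: expR_ge0.
- apply: cos_ge0_pihalf; apply/andP; split; lra.
- rewrite ler_expR.
  have : `|s * Re z| <= 1 * X by rewrite normrM ler_pM // ger0_norm.
  by rewrite mul1r ler_norml => /andP[].
rewrite -[leRHS]cos_norm.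
have hn : `|(s - 1 / 2) * Im z| <= th / 2.
  rewrite normrM mulrC; apply: ler_pM => //.
  by rewrite ler_norml; apply/andP; split; lra.
have := @ltr_cos R (th / 2) `|(s - 1 / 2) * Im z|.
rewrite !in_itv /= normr_ge0 => H.
rewrite leNgt H ?ltNge ?hn //; lra.
Qed.

Lemma cos_half_gt0 (th : R) : 0 <= th -> th < pi -> 0 < cos (th / 2).
Proof. by move=> h0 h1; apply: cos_gt0_pihalf; apply/andP; split; lra. Qed.

Lemma expm1q_neq0 z : `|Im z| < pi -> expm1q z != 0.
Proof.
move=> h; rewrite -cmod_gt0; apply: lt_le_trans (expm1q_lower (lexx _) h (lexx _)).
by rewrite mulr_gt0 ?expR_gt0 ?cos_half_gt0.
Qed.

(** [exp_kernel m r w] is [e^(m w) / (e^(r w) - 1)] minus its polar part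
[(1/r) / (e^w - 1)], written so that it is visibly regular at [w = 0]. *)
Definition exp_kernel (m r : R) (w : C) : C :=
  (m%:C%C * (expm1q (m%:C%C * w) * expm1q w) +
     (expm2q w + - r%:C%C * expm2q (r%:C%C * w))) *
  (r%:C%C * (expm1q (r%:C%C * w) * expm1q w))^-1.

Lemma kernel_decomposition (F : fieldType) (m r w A P Q p2 q2 : F) :
  r != 0 -> w != 0 -> P != 0 -> Q != 0 ->
  P = 1 + r * w * p2 -> Q = 1 + w * q2 ->
  (1 + m * w * A) / (r * w * P) =
    (m * (A * Q) + (q2 + - r * p2)) / (r * (P * Q)) + r^-1 / (w * Q).
Proof.
move=> r0 w0 P0 Q0 EP EQ.
have -> : p2 = (P - 1) / (r * w) by rewrite EP; field; rewrite r0 w0.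
have -> : q2 = (Q - 1) / w by rewrite EQ; field; rewrite w0.
by clear EP EQ; field; rewrite r0 w0 P0 Q0.
Qed.

Lemma exp_kernelE (m r : R) w : r != 0 -> w != 0 ->
  expm1q (r%:C%C * w) != 0 -> expm1q w != 0 ->
  cexp (m%:C%C * w) / (cexp (r%:C%C * w) - 1) =
    exp_kernel m r w + r%:C%C^-1 / (cexp w - 1).
Proof.
move=> r0 w0 e1 e2.
have rc : r%:C%C != 0 :> C by rewrite -cmod_gt0 cmod_real normr_gt0.
have Em : cexp (m%:C%C * w) = 1 + m%:C%C * w * expm1q (m%:C%C * w).
  by rewrite mul_expm1q addrC subrK.
have E2 : expm1q w = 1 + w * expm2q w by rewrite mul_expm2q addrC subrK.
have E3 : expm1q (r%:C%C * w) = 1 + r%:C%C * w * expm2q (r%:C%C * w).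
  by rewrite mul_expm2q addrC subrK.
rewrite -!mul_expm1q Em /exp_kernel.
exact (kernel_decomposition m%:C%C (expm1q (m%:C%C * w)) rc w0 e1 e2 E3 E2).
Qed.

(** The denominators are values of [expm1q] at points whose imaginary part is less
than [pi] in absolute value, since [r >= 1]; there they are bounded below,
uniformly in the translation. *)
Lemma unif_analytic_exp_kernel {I : Type} (S : set I) (m r : R) (v : I -> R) z (M : R) :
  1 <= r -> (forall i, S i -> `|v i| <= M) -> `|Im z| < pi / r ->
  unif_analytic S (fun i u => exp_kernel m r (u - (v i)%:C%C)) z.
Proof.
move=> r1 vM hz; have r0 : 0 < r by lra.
pose B := (1 + `|m| + r) * (1 + cmod z + `|M|).
have z0 := cmod_ge0 z; have M0 := normr_ge0 M; have m0 := normr_ge0 m.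
have bd (k : R) : `|k| <= 1 + `|m| + r ->
    (forall i, S i -> cmod (k%:C%C : C) <= B) /\
    (forall i, S i -> cmod (k%:C%C * z + (k%:C%C * - (v i)%:C%C)) <= B).
  move=> hk; split => i Si; rewrite ?cmod_real.
    by rewrite /B; nra.
  rewrite -mulrDr cmodM cmod_real; apply: ler_pM => //; first exact: cmod_ge0.
  have := cmodD z (- (v i)%:C%C); rewrite cmodN cmod_real.
  by have := vM i Si; have := ler_norm M; lra.
have affine (F : C -> C) (k : R) :
   (fun (i : I) u => F (k%:C%C * (u - (v i)%:C%C))) =
   (fun (i : I) u => F (k%:C%C * u + (k%:C%C * - (v i)%:C%C))).
  by apply/funext => i; apply/funext => u; rewrite mulrDr.
have A1 k : `|k| <= 1 + `|m| + r ->
    unif_analytic S (fun i u => expm1q (k%:C%C * (u - (v i)%:C%C))) z.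
  move=> /bd[h1 h2]; rewrite affine; exact: unif_analytic_expm1q h1 h2.
have A2 k : `|k| <= 1 + `|m| + r ->
    unif_analytic S (fun i u => expm2q (k%:C%C * (u - (v i)%:C%C))) z.
  move=> /bd[h1 h2]; rewrite affine; exact: unif_analytic_expm2q h1 h2.
have one (F : C -> C) : (fun (i : I) u => F (u - (v i)%:C%C)) =
    (fun (i : I) u => F ((1 : R)%:C%C * (u - (v i)%:C%C))).
  by apply/funext => i; apply/funext => u; rewrite mul1r.
have E1 : unif_analytic S (fun i u => expm1q (u - (v i)%:C%C)) z.
  by rewrite one; apply: A1; rewrite normr1; lra.
have E2 : unif_analytic S (fun i u => expm2q (u - (v i)%:C%C)) z.
  by rewrite one; apply: A2; rewrite normr1; lra.
have Er : `|r| <= 1 + `|m| + r by rewrite ger0_norm; lra.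
have Em : `|m| <= 1 + `|m| + r by lra.
have cst (k : C) : unif_analytic S (fun (_ : I) _ => k) z.
  exact: (@unif_analytic_cst _ _ _ (cmod k)).
have lower (k X : R) : 0 < k -> k <= r -> exists2 c : R, 0 < c &
   forall i, S i -> c <= cmod (expm1q (k%:C%C * (z - (v i)%:C%C))).
  move=> k0 kr; pose th := k * `|Im z|.
  have hth : th < pi.
    apply: le_lt_trans (_ : r * `|Im z| < pi); first by apply: ler_wpM2r.
    by rewrite mulrC -ltr_pdivlMr.
  have th0 : 0 <= th by rewrite mulr_ge0 // ltW.
  exists (cos (th / 2) * expR (- (k * (cmod z + `|M|)))).
    by rewrite mulr_gt0 ?expR_gt0 ?cos_half_gt0.
  move=> i Si; apply: expm1q_lower => //.
    rewrite !ReImE oppr0 addr0 mul0r addr0 normrM (gtr0_norm k0) //.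
  rewrite !ReImE mul0r subr0 normrM (gtr0_norm k0) ler_pM2l //.
  have := cmod_Re z; have := vM i Si; have := ler_norm M.
  by have := ler_normB (Re z) (v i); lra.
have [c1 c10 Hc1] := lower 1 0 ltr01 r1.
have [c2 c20 Hc2] := lower r 0 r0 (lexx r).
apply: unif_analyticM.
  apply: unif_analyticD.
    apply: unif_analyticM; first exact: cst.
    by apply: unif_analyticM; [exact: (A1 m)|exact: E1].
  apply: unif_analyticD; first exact: E2.
  by apply: unif_analyticM; [exact: cst|exact: (A2 r)].
apply: (@unif_analyticV _ _ _ _ (r * (c2 * c1))).
- by rewrite !mulr_gt0.
- move=> i Si; rewrite cmodM cmod_real gtr0_norm // ler_pM2l // cmodM.
  apply: ler_pM; [exact: ltW|exact: ltW|exact: Hc2|].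
  by have := Hc1 i Si; rewrite mul1r.
apply: unif_analyticM; first exact: cst.
by apply: unif_analyticM; [exact: (A1 r)|exact: E1].
Qed.

Lemma Im_exp_kernel_real (m r x : R) : Im (exp_kernel m r x%:C%C) = 0.
Proof.
have prodI z w : Im z = 0 -> Im w = 0 -> Im (z * w) = 0.
  by move=> hz hw; rewrite ImM hz hw mulr0 mul0r addr0.
have sumI z w : Im z = 0 -> Im w = 0 -> Im (z + w) = 0.
  by move=> hz hw; rewrite ImD hz hw addr0.
have invI z : Im z = 0 -> Im z^-1 = 0.
  by case: z => p q /= ->; rewrite mul0r oppr0.
rewrite /exp_kernel -!rmorphM; apply: (prodI _ _).
  apply: (sumI _ _); first by apply: (prodI _ _) => //; apply: (prodI _ _); exact: Im_expm1q_real.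
  apply: (sumI _ _); first exact: Im_expm2q_real.
  by rewrite -rmorphN; apply: (prodI _ _) => //; exact: Im_expm2q_real.
by apply: (invI _); apply: (prodI _ _) => //; apply: (prodI _ _); exact: Im_expm1q_real.
Qed.

End Quotients.

(** * The Cauchy transform of the semicircle *)

Section Resolvent.
Context {R : realType}.
Local Notation C := R[i].

Lemma unif_expansion_cderivative {I : Type} (S : set I) (f : I -> C -> C) z f1 f2 i :
  unif_expansion S f z f1 f2 -> S i -> cderivative (f i) z (f1 i).
Proof.
move=> [M [d [M1 d0 H]]] Si; have [_ _ a2 ar] := H i Si => e e0.
have D0 : 0 < 2 * M by lra.
exists (Num.min (Num.min 1 d) (e / (2 * M))).
  by rewrite !lt_min ltr01 d0 divr_gt0.
move=> v; rewrite !lt_min ltr_pdivlMr // => /andP[/andP[v1 vd] ve].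
have x0 := cmod_ge0 (v - z).
have := ar _ vd; rewrite [z + _]addrC subrK => h.
have -> : f i v - f i z - f1 i * (v - z) =
  (f i v - (f i z + f1 i * (v - z) + f2 i * (v - z) ^+ 2)) + f2 i * (v - z) ^+ 2.
  by ring.
have h2 : cmod (f2 i * (v - z) ^+ 2) <= M * cmod (v - z) ^+ 2.
  by apply: cmod_mul_le => //; rewrite cmodX.
apply: le_trans (cmod_add_le h h2) _; move: ve x0 v1.
set x := cmod (v - z) => ve x0 v1.
have -> : M * x ^+ 3 + M * x ^+ 2 = (M * x + M) * x * x by ring.
apply: ler_wpM2r => //.
have : M * x * x <= M * x by rewrite ler_piMr ?mulr_ge0 //; lra.
nra.
Qed.

Lemma unif_expansion_resolvent {I : Type} (S : set I) (w v : I -> C) z (M d : R) :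
  0 < d -> (forall i, S i -> cmod (w i) <= M) -> (forall i, S i -> cmod (v i) <= M) ->
  (forall i, S i -> d <= cmod (z - v i)) ->
  exists f2, unif_expansion S (fun i u => w i * (u - v i)^-1) z
    (fun i => - (w i / (z - v i) ^+ 2)) f2.
Proof.
move=> d0 wM vM zv.
have vN i : S i -> cmod (- v i) <= M by rewrite cmodN; exact: vM.
have := unif_expansionM (unif_expansion_cst z wM)
  (unif_expansionV d0 zv (unif_expansionD (unif_expansion_id S z)
    (unif_expansion_cst z vN))).
set f1 := (X in unif_expansion _ _ _ X _); set f2 := (X in unif_expansion _ _ _ _ X).
have -> : f1 = (fun i => - (w i / (z - v i) ^+ 2)).
  by apply/funext => i; rewrite /f1 mul0r add0r addr0 !mulNr mulrN mul1r.
by move=> h; exists f2.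
Qed.

Lemma is_derive_eps (h : R -> R) t a : (forall e : R, 0 < e ->
    exists2 d : R, 0 < d & forall s, `|s - t| < d ->
      `|h s - h t - a * (s - t)| <= e * `|s - t|) ->
  is_derive t 1 h a.
Proof.
move=> H.
have lim : (fun k : R => k^-1 *: ((h \o shift t) (k *: (1 : R)) - h t)) @ 0^' --> a.
  apply/cvgrPdist_lt => e e0; have e2 : 0 < e / 2 by rewrite divr_gt0.
  have [d d0 Hd] := H _ e2; apply/nbhs_ballP; exists d => //= k.
  rewrite /ball /= sub0r normrN => kd k0.
  have := Hd (k + t); rewrite addrK => /(_ kd) hk.
  rewrite /shift /= -[k *: 1]/(k * 1) mulr1 -[_ *: _]/(_ * _).
  have kp : 0 < `|k| by rewrite normr_gt0.
  have -> : a - k^-1 * (h (k + t) - h t) = - (k^-1 * (h (k + t) - h t - a * k)).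
    by field.
  rewrite normrN normrM normfV mulrC ltr_pdivrMr //.
  by apply: le_lt_trans hk _; rewrite ltr_pM2r //; lra.
by split; [apply/cvg_ex; exists a|apply/cvg_lim].
Qed.

Lemma cderivative_Re (g : C -> C) (x : R) a : cderivative g x%:C%C a ->
  is_derive x 1 (fun y : R => Re (g y%:C%C)) (Re a).
Proof.
move=> H; apply: is_derive_eps => e /H[d d0 Hd]; exists d => // s sx.
have := Hd s%:C%C; rewrite -rmorphB cmod_real => /(_ sx); apply: le_trans.
apply: le_trans (cmod_Re _); rewrite !ReImE mulr0 subr0 //.
Qed.

Lemma cderivative_Im (g : C -> C) (x : R) a : cderivative g x%:C%C a ->
  is_derive x 1 (fun y : R => Im (g y%:C%C)) (Im a).
Proof.
move=> H; apply: is_derive_eps => e /H[d d0 Hd]; exists d => // s sx.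
have := Hd s%:C%C; rewrite -rmorphB cmod_real => /(_ sx); apply: le_trans.
apply: le_trans (cmod_Im _); rewrite !ReImE mulr0 add0r //.
Qed.

(** A function with vanishing derivative in the upper half-plane is constant on
vertical rays; these are parametrised by [y = e^t]. *)
Lemma cderivative0_vertical (E : C -> C) (x y1 y2 : R) : 0 < y1 -> 0 < y2 ->
  (forall z, 0 < Im z -> cderivative E z 0) ->
  E (Complex x y1) = E (Complex x y2).
Proof.
move=> y10 y20 HE; pose gam (t : R) : C := Complex x (expR t).
have key (t : R) (e : R) : 0 < e -> exists2 d : R, 0 < d &
    forall s : R, `|s - t| < d -> cmod (E (gam s) - E (gam t)) <= e * `|s - t|.
  move=> e0; have [K [d [K0 d0 HK]]] := analytic_lipschitz (analytic_cexp t%:C%C).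
  have e1 : 0 < e / (K + 1) by rewrite divr_gt0 //; lra.
  have gt : 0 < Im (gam t) by exact: expR_gt0.
  have [d' d'0 H'] := HE _ gt _ e1.
  have D0 : 0 < d' / (K + 1) by rewrite divr_gt0 //; lra.
  exists (Num.min d (d' / (K + 1))); first by rewrite lt_min d0.
  move=> s; rewrite lt_min ltr_pdivlMr; last lra.
  move=> /andP[sd sd'].
  have gl : cmod (gam s - gam t) <= K * `|s - t|.
    have := HK s%:C%C; rewrite -rmorphB cmod_real => /(_ sd).
    rewrite !cexp_real -rmorphB cmod_real; apply: le_trans.
    apply: le_trans (cmod_le _) _.
    by rewrite /gam !ReImE subrr normr0 add0r.
  have st := normr_ge0 (s - t).
  have := H' (gam s); rewrite mul0r subr0 => h.
  apply: le_trans (h _) _; first lra.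
  have -> : e * `|s - t| = e / (K + 1) * ((K + 1) * `|s - t|) by field; lra.
  apply: ler_wpM2l; first exact: ltW.
  by apply: (le_trans gl); lra.
have cst (P : C -> R) : (forall z, `|P z| <= cmod z) ->
    (forall z w, P (z - w) = P z - P w) ->
    P (E (Complex x y1)) = P (E (Complex x y2)).
  move=> Pn PB.
  have := @is_derive_0_is_cst R (fun t => P (E (gam t))) (ln y1) (ln y2).
  rewrite /gam !lnK ?posrE //; apply => t; apply: is_derive_eps => e e0.
  have [d d0 Hd] := key t e e0; exists d => // s /Hd.
  by rewrite mul0r subr0 -PB; apply: le_trans; exact: Pn.
apply: complex_eqP.
  by apply: cst; [exact: cmod_Re|move=> z w; rewrite ReD ReN].
by apply: cst; [exact: cmod_Im|move=> z w; rewrite ImD ImN].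
Qed.

End Resolvent.

Section PrincipalRoot.
Context {R : realType}.
Local Notation C := R[i].

Definition psqrt (q : C) : C := let x := sqrtc q in if 0 < Re x then x else - x.

Lemma sqr_psqrt q : psqrt q ^+ 2 = q.
Proof. by rewrite /psqrt; case: ifP => _; rewrite ?sqrrN sqr_sqrtc. Qed.

Lemma Re_psqrt_gt0 q : Im q != 0 \/ 0 < Re q -> 0 < Re (psqrt q).
Proof.
move=> hq; rewrite /psqrt; case: ifPn => // ; rewrite -leNgt => h.
rewrite ReN oppr_gt0 lt_neqAle h andbT; apply/eqP => R0.
have : sqrtc q ^+ 2 = q by exact: sqr_sqrtc.
case: hq => [/eqP hi|hr] e; rewrite -e expr2 in hi || rewrite -e expr2 in hr.
  by apply: hi; rewrite ImM R0 mul0r mulr0 addr0.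
by move: hr; rewrite ReM R0 mul0r sub0r oppr_gt0 -expr2 ltNge sqr_ge0.
Qed.

(** A square root is determined by the sign of its real part. *)
Lemma root_unique (X Y : C) : X ^+ 2 = Y ^+ 2 -> 0 < Re X -> 0 < Re Y -> X = Y.
Proof.
move=> /eqP; rewrite eqf_sqr => /orP[/eqP//|/eqP ->].
by rewrite ReN oppr_gt0 => h1 h2; have := lt_trans h1 h2; rewrite ltxx.
Qed.

Lemma sqr_Re_root (X : C) : Re X ^+ 2 = (cmod (X ^+ 2) + Re (X ^+ 2)) / 2.
Proof.
by rewrite cmodX cmod_sqr [X ^+ 2]expr2 ReM !expr2; field.
Qed.

(** Two roots with positive real part satisfy [|X + Y| >= Re Y], so that
continuity of the root follows from [X^2 - Y^2 = (X - Y) (X + Y)]. *)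
Lemma root_lipschitz (X Y : C) : 0 <= Re X -> 0 < Re Y ->
  cmod (X - Y) <= cmod (X ^+ 2 - Y ^+ 2) / Re Y.
Proof.
move=> hX hY; rewrite ler_pdivlMr // subr_sqr cmodM.
apply: ler_wpM2l; first exact: cmod_ge0.
by apply: le_trans (le_trans (ler_norm _) (cmod_Re (X + Y))); rewrite ReD; lra.
Qed.

(** The expansion of a root is found by identification; it is compared with the
root itself through the Lipschitz bound. *)
Lemma analytic_root (X q : C -> C) z (d : R) : 0 < d ->
  (forall v, cmod (v - z) < d -> X v ^+ 2 = q v) ->
  (forall v, cmod (v - z) < d -> 0 < Re (X v)) ->
  analytic_at q z -> analytic_at X z.
Proof.
move=> d0 Xq Xpos qA.
have zz : cmod (z - z) < d by rewrite subrr cmod0.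
have X0 := Xpos z zz; have Xz0 : X z != 0.
  by apply/eqP => h; move: X0; rewrite h ltxx.
have [q1 [q2 [M [e [M0 e0 Hq]]]]] := analytic_expansion qA.
have [K [e' [K0 e'0 HK]]] := analytic_lipschitz qA.
pose a := q1 / (2 * X z); pose b := (q2 - a ^+ 2) / (2 * X z).
pose L := K / Re (X z).
pose A := cmod a; pose B := cmod b.
have A0 : 0 <= A by exact: cmod_ge0.
have B0 : 0 <= B by exact: cmod_ge0.
have L0 : 0 <= L by rewrite divr_ge0 // ltW.
pose M' := (M + 2 * A * B + B ^+ 2) / Re (X z).
have AB : 0 <= 2 * A * B by rewrite !mulr_ge0.
have B2 := sqr_ge0 B.
have M'0 : 0 <= M' by rewrite divr_ge0 ?(ltW X0) //; lra.
pose MM := 1 + cmod (X z) + A + B + 2 * M'.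
have Xc := cmod_ge0 (X z).
pose dd := Num.min (Num.min 1 (Num.min d e)) (Re (X z) / (2 * (A + B + 1))).
have D2 : 0 < 2 * (A + B + 1) by lra.
exists (fun=> a), (fun=> b), MM, dd; split.
- rewrite /MM; lra.
- by rewrite !lt_min ltr01 d0 e0 divr_gt0.
move=> _ _; split; try (rewrite /MM -/A -/B; move: A0 B0 Xc M'0; clear; lra).
move=> h; rewrite !lt_min ltr_pdivlMr // => /andP[/andP[h1 /andP[hd he]] hx].
have hn := cmod_ge0 h.
have zh : cmod (z + h - z) < d by rewrite addrAC subrr add0r.
(* the square of the candidate expansion agrees with that of [q] up to [h^3] *)
pose T := X z + a * h + b * h ^+ 2.
have T2 : T ^+ 2 = q z + q1 * h + q2 * h ^+ 2 + h ^+ 3 * (2 * (a * b) + h * b ^+ 2).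
  rewrite -(Xq z zz) /T /b /a; field; exact: Xz0.
have two : cmod (2 : C) = 2 by rewrite -(rmorph_nat (real_complex R)) cmod_real ger0_norm.
have qT : cmod (q (z + h) - T ^+ 2) <= (M + 2 * A * B + B ^+ 2) * cmod h ^+ 3.
  have -> : q (z + h) - T ^+ 2 = (q (z + h) - (q z + q1 * h + q2 * h ^+ 2)) -
     h ^+ 3 * (2 * (a * b) + h * b ^+ 2) by rewrite T2; ring.
  have c1 : cmod (2 * (a * b)) <= 2 * A * B by rewrite cmodM two [cmod (a * b)]cmodM mulrA.
  have c2 : cmod (h * b ^+ 2) <= B ^+ 2.
    rewrite cmodM cmodX -/B -[leRHS]mul1r; apply: ler_wpM2r => //; exact: ltW.
  have h3 : cmod (h ^+ 3) <= cmod h ^+ 3 by rewrite cmodX.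
  have c3 := cmod_mul_le h3 (cmod_add_le c1 c2); rewrite -cmodN in c3.
  apply: le_trans (cmod_add_le (Hq h he) c3) _.
  by rewrite le_eqVlt; apply/orP; left; apply/eqP; ring.
have TX : Re (X z) / 2 <= Re T.
  have RT : Re T = Re (X z) + Re (a * h + b * h ^+ 2) by rewrite /T -addrA ReD.
  rewrite RT; have := cmod_Re (a * h + b * h ^+ 2).
  have c1 : cmod (a * h + b * h ^+ 2) <= (A + B) * cmod h.
    rewrite mulrDl; apply: cmod_add_le; rewrite cmodM // cmodX.
    by apply: ler_wpM2l => //; rewrite expr2 ler_piMl // ltW.
  have := ler_norm (- Re (a * h + b * h ^+ 2)); rewrite normrN; nra.
have T0 : 0 < Re T by exact: lt_le_trans (divr_gt0 X0 (ltr0Sn _ 1)) TX.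
rewrite -/T.
apply: le_trans (root_lipschitz (ltW (Xpos _ zh)) T0) _.
rewrite Xq // ler_pdivrMr //; apply: (le_trans qT).
have Mq : (M + 2 * A * B + B ^+ 2) = M' * Re (X z) by rewrite /M' divfK // gt_eqF.
rewrite Mq.
have h3 : 0 <= cmod h ^+ 3 by rewrite exprn_ge0.
have : M' * Re (X z) <= MM * Re T.
  rewrite (_ : M' * Re (X z) = 2 * M' * (Re (X z) / 2)); last by field.
  apply: ler_pM => //; [exact: mulr_ge0|by rewrite divr_ge0 // ltW|].
  by rewrite /MM; move: A0 B0 Xc; clear; lra.
by move=> hh; rewrite [leRHS]mulrAC; apply: ler_wpM2r.
Qed.

End PrincipalRoot.

Section WeightedTransform.
Context {R : realType}.
Local Notation C := R[i].

Lemma resolvent_path p q (v : R -> C) z : ccontinuous_on p q v ->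
  (forall x, p <= x <= q -> z - v x != 0) ->
  ccontinuous_on p q (fun x => (z - v x)^-1).
Proof.
move=> vc hz; apply: (@ccontinuous_on_comp _ p q v (fun y => (z - y)^-1)) => //.
move=> x xpq; apply: analytic_ccontinuous; apply: analyticV; first exact: hz.
by apply: analyticB; [exact: analytic_cst|exact: analytic_id].
Qed.

Lemma weighted_transform_expansion p q (w v : R -> C) z (d : R) : p <= q -> 0 < d ->
  ccontinuous_on p q w -> ccontinuous_on p q v ->
  (forall x, p <= x <= q -> d <= cmod (z - v x)) ->
  exists s2, unif_expansion [set: unit]
    (fun _ u => Cint p q (fun x => w x * (u - v x)^-1)) z
    (fun=> Cint p q (fun x => - (w x / (z - v x) ^+ 2))) s2.
Proof.
move=> pq d0 wc vc zv.
have [M1 wM] := ccontinuous_on_bounded wc; have [M2 vM] := ccontinuous_on_bounded vc.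
have wM' (ix : unit * R) : [set: unit] ix.1 /\ p <= ix.2 <= q ->
    cmod (w ix.2) <= Num.max M1 M2.
  by move=> [_ /wM h]; rewrite le_max h.
have vM' (ix : unit * R) : [set: unit] ix.1 /\ p <= ix.2 <= q ->
    cmod (v ix.2) <= Num.max M1 M2.
  by move=> [_ /vM h]; rewrite le_max h orbT.
have zv' (ix : unit * R) : [set: unit] ix.1 /\ p <= ix.2 <= q ->
    d <= cmod (z - v ix.2) by move=> [_ /zv].
have [f2 H] := unif_expansion_resolvent
  (S := [set ix | [set: unit] ix.1 /\ p <= ix.2 <= q]) d0 wM' vM' zv'.
eexists; apply: (unif_expansion_int (f := fun _ x u => w x * (u - v x)^-1) pq H).
exists d => // _ _ h hd; apply: ccontinuous_on_measurable.
apply: ccontinuous_onM => //; apply: resolvent_path => // x xpq.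
rewrite -cmod_gt0; have := zv x xpq; have := cmodD (z + h - v x) (- h).
rewrite cmodN (_ : z + h - v x + - h = z - v x); last by ring.
by lra.
Qed.

End WeightedTransform.

Section Semicircle.
Context {R : realType} (a b : R) (ab : a < b).
Local Notation C := R[i].

Definition semicircle (x : R) : R := Num.sqrt ((b - x) * (x - a)).

Definition semi_quad (z : C) : C := (b%:C%C - z) * (z - a%:C%C).

Definition semi_transform (z : C) : C :=
  Cint a b (fun x => (semicircle x)%:C%C * (z - x%:C%C)^-1).

Let c : R := (a + b) / 2.

Lemma semicircle_sqr x : a <= x <= b -> semicircle x ^+ 2 = (b - x) * (x - a).
Proof. by move=> /andP[h1 h2]; rewrite sqr_sqrtr // mulr_ge0 // subr_ge0. Qed.

Lemma semicircle_ge0 x : 0 <= semicircle x.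
Proof. exact: sqrtr_ge0. Qed.

Lemma semicircle_le x : a <= x <= b -> semicircle x <= b - a.
Proof.
move=> xab; rewrite -(ler_pXn2r (_ : 0 < 2)%N) ?nnegrE ?semicircle_ge0 //; last lra.
rewrite semicircle_sqr // expr2; case/andP: xab => h1 h2.
by apply: ler_pM; lra.
Qed.

Lemma semicircle_continuous x : {for x, continuous semicircle}.
Proof.
apply: (@continuous_comp _ _ _ (fun x => (b - x) * (x - a))); last exact: sqrt_continuous.
apply: continuousM.
  by apply: continuousB; [exact: cst_continuous|exact: cvg_id].
by apply: continuousB; [exact: cvg_id|exact: cst_continuous].
Qed.

Lemma semicircle_path : ccontinuous_on a b (fun x => (semicircle x)%:C%C).
Proof. by apply: ccontinuous_on_real => x _; exact: semicircle_continuous. Qed.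

Lemma Im_dist (z : C) (x : R) : `|Im z| <= cmod (z - x%:C%C).
Proof. by have := cmod_Im (z - x%:C%C); rewrite !ReImE subr0. Qed.

Lemma resolvent_neq0 (z : C) (x : R) : Im z != 0 -> z - x%:C%C != 0.
Proof.
move=> hz; rewrite -cmod_gt0; apply: lt_le_trans (Im_dist z x).
by rewrite normr_gt0.
Qed.

Lemma real_resolvent_path (z : C) p q : Im z != 0 ->
  ccontinuous_on p q (fun x => (z - x%:C%C)^-1).
Proof.
move=> hz; apply: (@resolvent_path _ p q (fun s => s%:C%C)).
  exact: real_path_continuous.
by move=> x _; exact: resolvent_neq0.
Qed.

Lemma semi_integrand_path (z : C) n : Im z != 0 ->
  ccontinuous_on a b (fun x => (semicircle x)%:C%C * (z - x%:C%C)^-1 ^+ n).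
Proof.
move=> hz; apply: ccontinuous_onM; first exact: semicircle_path.
elim: n => [|n IH]; first exact: ccontinuous_on_cst.
rewrite (_ : (fun x => _) = (fun x => (z - x%:C%C)^-1 * (z - x%:C%C)^-1 ^+ n)).
  by apply: ccontinuous_onM => //; exact: real_resolvent_path.
by apply/funext => x; rewrite exprS.
Qed.

Definition semi_mass : C := Cint a b (fun x => (semicircle x)%:C%C).
Definition semi_transform2 (z : C) : C :=
  Cint a b (fun x => (semicircle x)%:C%C * (z - x%:C%C)^-1 ^+ 2).

Lemma semi_transform_expansion z : Im z != 0 -> exists s2,
  unif_expansion [set: unit] (fun=> semi_transform) z
    (fun=> - semi_transform2 z) s2.
Proof.
move=> hz; have h0 : 0 < `|Im z| by rewrite normr_gt0.
have [s2 H] := weighted_transform_expansion (ltW ab) h0 semicircle_path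
  (@real_path_continuous R a b) (fun x _ => Im_dist z x).
exists s2; move: H; congr (unif_expansion _ _ _ _ _); apply/funext => _.
have cm := ccontinuous_on_measurable (semi_integrand_path 2 hz).
have cb := ccontinuous_on_bounded (semi_integrand_path 2 hz).
have := CintZ (-1) cm cb; rewrite mulN1r => <-; apply: eq_Cint => x _.
by rewrite mulN1r exprVn.
Qed.

(** Integrating the derivative of [s^3 / (z - x)], where [s] is the semicircle
density, gives a first order linear differential equation for the transform. *)
Lemma semi_transform_ode z : Im z != 0 ->
  semi_quad z * semi_transform2 z = (z - c%:C%C) * semi_transform z - 2 * semi_mass.
Proof.
move=> hz.
pose F (x : R) : C := (semicircle x ^+ 3)%:C%C * (z - x%:C%C)^-1.
pose f (x : R) : C := semi_quad z * ((semicircle x)%:C%C * (z - x%:C%C)^-1 ^+ 2) +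
  (- (z - c%:C%C) * ((semicircle x)%:C%C * (z - x%:C%C)^-1 ^+ 1) +
   2 * ((semicircle x)%:C%C * (z - x%:C%C)^-1 ^+ 0)).
have cp n := semi_integrand_path n hz.
have cs n (k : C) : ccontinuous_on a b
    (fun x => k * ((semicircle x)%:C%C * (z - x%:C%C)^-1 ^+ n)).
  by apply: ccontinuous_onM; [exact: ccontinuous_on_cst|exact: cp].
have fc : ccontinuous_on a b f.
  by apply: ccontinuous_onD => //; apply: ccontinuous_onD.
have Fc : ccontinuous_on a b F.
  apply: ccontinuous_onM; last first.
    exact: real_resolvent_path.
  apply: ccontinuous_on_real => x _.
  apply: (@continuous_comp _ _ _ semicircle (fun y => y ^+ 3)); first exact: semicircle_continuous.
  exact: exprn_continuous.
have dF x : a < x < b -> is_derive x 1 (fun y => Re (F y)) (Re (f x)) /\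
    is_derive x 1 (fun y => Im (F y)) (Im (f x)).
  move=> /andP[ax xb].
  have xab : a <= x <= b by rewrite !ltW.
  have q0 : 0 < (b - x) * (x - a) by rewrite mulr_gt0 // subr_gt0.
  have s0 : 0 < semicircle x by rewrite sqrtr_gt0.
  have ds : is_derive x 1 semicircle ((c - x) / semicircle x).
    have dq : is_derive x 1 (fun y : R => (b - y) * (y - a)) (2 * (c - x)).
      by apply: is_derive_eq; rewrite /GRing.scale /= /c; field.
    have := @is_derive1_comp _ Num.sqrt (fun y : R => (b - y) * (y - a)) x _ _
      (is_derive1_sqrt q0) dq.
    rewrite -/(semicircle x) => h; apply: (is_derive_eq h).
    by field; rewrite gt_eqF.
  have ds3 : is_derive x 1 (fun y => semicircle y ^+ 3) (3 * semicircle x * (c - x)).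
    by apply: is_derive_eq; rewrite /GRing.scale /=; field; rewrite gt_eqF.
  have zx : z - x%:C%C != 0 by exact: resolvent_neq0.
  have dg : cderivative (fun v => (z - v)^-1) x%:C%C ((z - x%:C%C)^-1 ^+ 2).
    have zc : forall i : unit, [set: unit] i -> cmod z <= cmod z by [].
    have nc : forall i : unit, [set: unit] i -> cmod (-1 : C) <= 1.
      by move=> _ _; rewrite cmodN cmod1.
    have h0 : 0 < cmod (z + -1 * x%:C%C) by rewrite mulN1r cmod_gt0.
    have := unif_expansion_cderivative (unif_expansionV h0 _
      (unif_expansionD (unif_expansion_cst x%:C%C zc)
      (unif_expansionM (unif_expansion_cst x%:C%C nc)
        (unif_expansion_id [set: unit] x%:C%C)))) (I : [set: unit] tt).
    move=> /(_ (fun _ _ => lexx _)) /=.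
    have -> : (fun u : C => (z + -1 * u)^-1) = (fun v => (z - v)^-1).
      by apply/funext => u; rewrite mulN1r.
    by rewrite !(mul0r, add0r, mulN1r, mulr1, opprK, mul1r) exprVn.
  have hR := cderivative_Re dg; have hI := cderivative_Im dg.
  set g1 := (z - x%:C%C)^-1 in hR hI *.
  have sE : semicircle x ^+ 2 = (b - x) * (x - a) by exact: semicircle_sqr.
  have fE : f x = (3 * semicircle x * (c - x))%:C%C * g1 +
      (semicircle x ^+ 3)%:C%C * g1 ^+ 2.
    rewrite /f -/g1.
    have -> : semicircle x ^+ 3 = semicircle x * ((b - x) * (x - a)).
      by rewrite exprS sE.
    rewrite /semi_quad /c expr1 expr0 !(rmorphM, rmorphB, rmorphD, fmorphV, rmorph_nat).
    have -> : z = x%:C%C + g1^-1 by rewrite /g1 invrK addrC subrK.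
    have g10 : g1 != 0 by rewrite invr_neq0.
    by field; rewrite g10.
  split.
    have -> : (fun y => Re (F y)) =
       (fun y => semicircle y ^+ 3) * (fun y : R => Re ((z - y%:C%C)^-1)).
      by apply/funext => y; rewrite /F ReM Im_real mul0r subr0.
    rewrite fE; apply: is_derive_eq.
    rewrite /GRing.scale /= -/g1 [Re (_ + _)]ReD !ReM !Re_real !Im_real !mul0r !subr0.
    by ring.
  have -> : (fun y => Im (F y)) =
     (fun y => semicircle y ^+ 3) * (fun y : R => Im ((z - y%:C%C)^-1)).
    by apply/funext => y; rewrite /F ImM Im_real mul0r addr0.
  rewrite fE; apply: is_derive_eq.
  rewrite /GRing.scale /= -/g1 [Im (_ + _)]ImD !ImM !Re_real !Im_real !mul0r !addr0.
  by ring.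
have := Cint_FTC ab fc Fc dF.
have -> : F b - F a = 0.
  rewrite /F /semicircle !subrr mulr0 mul0r sqrtr0 expr0n /=.
  by rewrite (_ : (0 : R)%:C%C = 0) // !mul0r subrr.
have mm n k := ccontinuous_on_measurable (cs n k).
have bb n k := ccontinuous_on_bounded (cs n k).
have m n := ccontinuous_on_measurable (cp n).
have bd n := ccontinuous_on_bounded (cp n).
rewrite (CintD (mm 2 _) (bb 2 _) (cmeasurableD (mm 1 _) (mm 0 _))
  (cboundedD (bb 1 _) (bb 0 _))) (CintD (mm 1 _) (bb 1 _) (mm 0 _) (bb 0 _)).
rewrite (CintZ _ (m 2) (bd 2)) (CintZ _ (m 1) (bd 1)) (CintZ _ (m 0) (bd 0)).
rewrite -/(semi_transform2 z).
have -> : Cint a b (fun x => (semicircle x)%:C%C * (z - x%:C%C)^-1 ^+ 1) =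
  semi_transform z by apply: eq_Cint => x _; rewrite expr1.
have -> : Cint a b (fun x => (semicircle x)%:C%C * (z - x%:C%C)^-1 ^+ 0) =
  semi_mass by apply: eq_Cint => x _; rewrite expr0 mulr1.
move=> h; apply/eqP; rewrite -subr_eq0 -h; apply/eqP; ring.
Qed.

End Semicircle.

Section SemicircleFormula.
Context {R : realType} (a b : R) (ab : a < b).
Local Notation C := R[i].
Local Notation c := ((a + b) / 2).
Local Notation semi_transform := (semi_transform a b).
Local Notation semi_transform2 := (semi_transform2 a b).
Local Notation semi_quad := (semi_quad a b).

Definition semi_area : R := \int[@lebesgue_measure R]_(x in `[a, b]) semicircle a b x.

Lemma semi_massE : semi_mass a b = semi_area%:C%C.
Proof.
apply: complex_eqP; rewrite // Im_real.
by apply: Im_Cint_eq0.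
Qed.

(** The mass is positive because the density dominates a positive multiple of
the polynomial [(b - x) (x - a)]. *)
Lemma semi_area_gt0 : 0 < semi_area.
Proof.
pose q (x : R) : R := (b - x) * (x - a).
pose F (x : R) : R := - (x ^+ 3) / 3 + c * x ^+ 2 - a * b * x.
have qc : ccontinuous_on a b (fun x => (q x)%:C%C).
  apply: ccontinuous_on_real => x _; apply: continuousM.
    by apply: continuousB; [exact: cst_continuous|exact: cvg_id].
  by apply: continuousB; [exact: cvg_id|exact: cst_continuous].
have dF (x : R) : is_derive x 1 F (q x).
  by apply: is_derive_eq; rewrite /GRing.scale /= /q; field.
have Fc : ccontinuous_on a b (fun x => (F x)%:C%C).
  apply: ccontinuous_on_real => x _; apply: differentiable_continuous.
  by apply/derivable1_diffP; case: (dF x).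
have dF' x : a < x < b -> is_derive x 1 (fun y => Re (F y)%:C%C) (Re (q x)%:C%C) /\
   is_derive x 1 (fun y => Im (F y)%:C%C) (Im (q x)%:C%C).
  by move=> _; split; [exact: dF|exact: is_derive_cst].
have := Cint_FTC ab qc Fc dF' => /(congr1 (@complex.Re R)).
rewrite -rmorphB Re_real /Cint ReC => qint.
have ba : 0 < b - a by rewrite subr_gt0.
have Fba : F b - F a = (b - a) ^+ 3 / 6 by rewrite /F; field.
have le : (b - a)^-1 * \int[@lebesgue_measure R]_(x in `[a, b]) q x <= semi_area.
  have iq := cintegrable_Re (ccontinuous_on_measurable qc) (ccontinuous_on_bounded qc).
  have isc := cintegrable_Re (ccontinuous_on_measurable (@semicircle_path R a b))
    (ccontinuous_on_bounded (@semicircle_path R a b)).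
  have iq' := cintegrable_Re (cmeasurableM (cmeasurable_cst a b (b - a)^-1%:C%C)
     (ccontinuous_on_measurable qc)) (cboundedM (cbounded_cst a b (b - a)^-1%:C%C)
     (ccontinuous_on_bounded qc)).
  have -> : (b - a)^-1 * \int[@lebesgue_measure R]_(x in `[a, b]) q x =
     \int[@lebesgue_measure R]_(x in `[a, b]) Re ((b - a)^-1%:C%C * (q x)%:C%C).
    rewrite -RintegralZl //; apply: eq_Rintegral => x _.
    by rewrite ReM !Re_real Im_real mul0r subr0.
  apply: le_Rintegral => // x /segmentE xab.
  rewrite ReM !Re_real Im_real mul0r subr0 /q -semicircle_sqr // expr2 mulrA.
  rewrite ler_piMl ?semicircle_ge0 // mulrC ler_pdivrMr // mul1r.
  exact: semicircle_le.
have qE : \int[@lebesgue_measure R]_(x in `[a, b]) q x = (b - a) ^+ 3 / 6.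
  by rewrite -Fba; exact: qint.
apply: lt_le_trans le; rewrite qE.
by rewrite mulr_gt0 ?invr_gt0 // divr_gt0 // exprn_gt0.
Qed.

Definition semi_const : R := 8 * semi_area / (b - a) ^+ 2.

Lemma semi_const_gt0 : 0 < semi_const.
Proof.
by rewrite divr_gt0 ?exprn_gt0 ?subr_gt0 // mulr_gt0 // semi_area_gt0.
Qed.

Local Notation K := semi_const.

(** Removing the affine part makes the differential equation homogeneous. *)
Definition semi_dev (z : C) : C := semi_transform z - K%:C%C * (z - c%:C%C).

Lemma semi_quad_neq0 z : Im z != 0 -> semi_quad z != 0.
Proof.
move=> hz; rewrite /semi_quad mulf_neq0 //; last exact: resolvent_neq0.
by rewrite -opprB oppr_eq0; exact: resolvent_neq0.
Qed.

Lemma semi_quadE (z : C) :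
  semi_quad z = (((b - a) / 2) ^+ 2)%:C%C - (z - c%:C%C) ^+ 2.
Proof.
rewrite /semi_quad !(rmorphXn, rmorphM, rmorphB, rmorphD, fmorphV, rmorph_nat) /=.
by field.
Qed.

Lemma semi_dev_ode z : Im z != 0 ->
  semi_quad z * (- semi_transform2 z - K%:C%C) = - (z - c%:C%C) * semi_dev z.
Proof.
move=> hz; have := semi_transform_ode ab hz; rewrite semi_massE => ode.
have KR : (K%:C%C : C) * (((b - a) / 2) ^+ 2)%:C%C = 2 * semi_area%:C%C.
  rewrite -rmorphM -[2 in RHS](rmorph_nat (real_complex R)) -rmorphM; congr (_%:C%C).
  by rewrite /K; field; rewrite subr_eq0 gt_eqF.
rewrite mulrBr mulrN ode /semi_dev semi_quadE.
apply/eqP; rewrite -subr_eq0; apply/eqP.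
transitivity (2 * semi_area%:C%C - K%:C%C * (((b - a) / 2) ^+ 2)%:C%C : C); last first.
  by rewrite KR subrr.
by ring.
Qed.

(** The ratio below is a constant of motion of the differential equation. *)
Lemma semi_ratio_derivative z : Im z != 0 ->
  cderivative (fun u => semi_dev u * semi_dev u * (semi_quad u)^-1) z 0.
Proof.
move=> hz; have [s2 HS] := semi_transform_expansion ab hz.
have cst (k : C) : forall i : unit, [set: unit] i -> cmod k <= cmod k by [].
have HI := unif_expansion_id [set: unit] z.
have HD := unif_expansionD HS (unif_expansionM
  (unif_expansion_cst z (cst (- K%:C%C))) (unif_expansionD HI
  (unif_expansion_cst z (cst (- c%:C%C))))).
have HQ := unif_expansionM (unif_expansionD (unif_expansion_cst z (cst b%:C%C))
  (unif_expansionM (unif_expansion_cst z (cst (-1))) HI))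
  (unif_expansionD HI (unif_expansion_cst z (cst (- a%:C%C)))).
have q0 : 0 < cmod ((b%:C%C + -1 * z) * (z + - a%:C%C)).
  by rewrite mulN1r cmod_gt0; exact: semi_quad_neq0.
have HV := unif_expansionV q0 (fun _ _ => lexx _) HQ.
have := unif_expansion_cderivative (unif_expansionM (unif_expansionM HD HD) HV)
  (I : [set: unit] tt).
rewrite /=.
have -> : (fun u : C => (semi_transform u + - K%:C%C * (u + - c%:C%C)) *
    (semi_transform u + - K%:C%C * (u + - c%:C%C)) *
    ((b%:C%C + -1 * u) * (u + - a%:C%C))^-1) =
   (fun u => semi_dev u * semi_dev u * (semi_quad u)^-1).
  by apply/funext => u; rewrite mulN1r mulNr.
move: (semi_dev_ode hz) (semi_quad_neq0 hz) => ode qn0.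
set f1 := (X in cderivative _ _ X); suff -> : f1 = 0 by [].
rewrite /f1.
have D1 : - semi_transform2 z + (0 * (z - c%:C%C) + - K%:C%C * (1 + 0)) =
    - (z - c%:C%C) * semi_dev z / semi_quad z.
  by rewrite -ode [RHS]mulrC mulKf // mul0r add0r addr0 mulr1.
have DE : semi_transform z + - K%:C%C * (z - c%:C%C) = semi_dev z by rewrite mulNr.
have QE : (b%:C%C + -1 * z) * (z - a%:C%C) = semi_quad z by rewrite mulN1r.
have Q1 : (0 + (0 * z + -1 * 1)) * (z - a%:C%C) + (b%:C%C + -1 * z) * (1 + 0) =
    - 2 * (z - c%:C%C).
  by rewrite !(rmorphM, rmorphD, fmorphV, rmorph_nat) /=; field.
rewrite D1 DE QE Q1.
move: (z - c%:C%C) (semi_dev z) (semi_quad z) qn0 => e D q qn0.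
by field.
Qed.

Lemma semi_transform_bound z : 0 < Im z ->
  cmod (semi_transform z) <= 2 * (b - a) ^+ 2 / Im z.
Proof.
move=> hz; have hz0 : Im z != 0 by rewrite gt_eqF.
have cp := @semi_integrand_path R a b z 1 hz0.
have -> : 2 * (b - a) ^+ 2 / Im z = 2 * (b - a) * ((b - a) * (Im z)^-1) by ring.
apply: Cint_norm; first exact: ltW.
  apply: eq_cmeasurable (ccontinuous_on_measurable cp) => x _.
  by rewrite expr1.
move=> x xab; apply: cmod_mul_le.
  by rewrite cmod_real ger0_norm ?semicircle_ge0 //; exact: semicircle_le.
rewrite cmodV lef_pV2 ?posrE // ?cmod_gt0 ?resolvent_neq0 //.
by apply: le_trans (Im_dist z x); exact: ler_norm.
Qed.

(** The constant of motion is evaluated by letting the imaginary part of [z]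
tend to infinity, where the transform vanishes. *)
Lemma semi_dev_sqr z : 0 < Im z ->
  semi_dev z ^+ 2 = - (K%:C%C ^+ 2) * semi_quad z.
Proof.
move=> hz.
pose E u := semi_dev u * semi_dev u * (semi_quad u)^-1.
suff EK : E z = - (K%:C%C ^+ 2).
  have qn0 := semi_quad_neq0 (lt0r_neq0 hz).
  by rewrite -EK /E mulfVK // expr2.
have cstE y : 0 < y -> E z = E (Complex (Re z) y).
  move=> y0; have -> : z = Complex (Re z) (Im z) by case: (z).
  rewrite ReC; apply: cderivative0_vertical => // u hu.
  by apply: semi_ratio_derivative; rewrite gt_eqF.
apply/eqP; rewrite -subr_eq0 opprK -cmod_eq0; apply/eqP/le_anti.
rewrite cmod_ge0 andbT; apply/ler_addgt0Pr => e e0; rewrite add0r.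
pose rho := (b - a) / 2; pose m := `|Re z - c|.
have m0 : 0 <= m by exact: normr_ge0.
have K0 := semi_const_gt0.
have rho0 : 0 < rho by rewrite divr_gt0 // subr_gt0.
pose A := 2 * (b - a) ^+ 2.
have A0 : 0 < A by rewrite mulr_gt0 // exprn_gt0 // subr_gt0.
pose B := A ^+ 2 + 2 * K * A * (m + 1) + K ^+ 2 * rho ^+ 2.
have A2 := sqr_ge0 A.
have t2 : 0 <= 2 * K * A * (m + 1).
  by apply: mulr_ge0; [apply: mulr_ge0; [lra|exact: ltW]|lra].
have t3 : 0 <= K ^+ 2 * rho ^+ 2 by rewrite mulr_ge0 ?sqr_ge0.
have B0 : 0 <= B by rewrite /B; lra.
pose y := 1 + rho ^+ 2 + B / e.
have Be : 0 <= B / e by rewrite divr_ge0 // ltW.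
have r2 := sqr_ge0 rho.
have y1 : 1 <= y by rewrite /y; lra.
have y0 : 0 < y by lra.
rewrite (cstE y y0); set w := Complex (Re z) y.
have wI : 0 < Im w by [].
have qn0 := semi_quad_neq0 (lt0r_neq0 wI).
set S := semi_transform w; set n := w - c%:C%C.
have hS : cmod S <= A / y by exact: semi_transform_bound.
have hn : cmod n <= m + y.
  apply: le_trans (cmod_le _) _; rewrite /n !ReImE subr0.
  by rewrite (gtr0_norm y0).
have hn2 : y <= cmod n.
  by apply: le_trans (cmod_Im _); rewrite /n !ReImE subr0 ler_norm.
have qE : semi_quad w = (rho ^+ 2)%:C%C - n ^+ 2 by exact: semi_quadE.
have -> : E w + K%:C%C ^+ 2 = (S ^+ 2 - 2%:R%:C%C * K%:C%C * (S * n) +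
    (K ^+ 2)%:C%C * (rho ^+ 2)%:C%C) / semi_quad w.
  have DE : semi_dev w = S - K%:C%C * n by [].
  rewrite /E DE; move: qn0; rewrite qE => qn0.
  rewrite [(K ^+ 2)%:C%C]rmorphXn [_%:R%:C%C]rmorph_nat /=.
  by move: (rho ^+ 2)%:C%C qn0 (K%:C%C) => rr qn0 k; field.
rewrite cmodM cmodV ler_pdivrMr ?cmod_gt0 //.
have hq : y ^+ 2 - rho ^+ 2 <= cmod (semi_quad w).
  have := cmod_lerB (n ^+ 2) (rho ^+ 2)%:C%C; rewrite cmodB -qE cmodX cmod_real.
  rewrite (ger0_norm r2); have : y ^+ 2 <= cmod n ^+ 2.
    by rewrite lerXn2r ?nnegrE ?cmod_ge0 ?(ltW y0).
  lra.
have yV : 0 < y^-1 by rewrite invr_gt0.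
have yV1 : y^-1 <= 1 by rewrite invf_le1.
have Ay : A / y <= A by rewrite ler_pdivrMr // ler_peMr // ltW.
have hSn : cmod (S * n) <= A * (m + 1).
  apply: le_trans (cmod_mul_le hS hn) _.
  rewrite -mulrA; apply: ler_wpM2l; first exact: ltW.
  rewrite mulrDr mulVf ?gt_eqF //; have : y^-1 * m <= 1 * m by apply: ler_wpM2r.
  lra.
have h1 : cmod (S ^+ 2) <= A ^+ 2.
  by rewrite cmodX lerXn2r ?nnegrE ?cmod_ge0 ?(ltW A0) // (le_trans hS).
have h2 : cmod (- (2%:R%:C%C * K%:C%C * (S * n))) <= 2 * K * (A * (m + 1)).
  rewrite cmodN; apply: cmod_mul_le => //; apply: cmod_mul_le.
    by rewrite cmod_real ger0_norm.
  by rewrite cmod_real gtr0_norm.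
have h3 : cmod ((K ^+ 2)%:C%C * (rho ^+ 2)%:C%C) <= K ^+ 2 * rho ^+ 2.
  by apply: cmod_mul_le; rewrite cmod_real ger0_norm ?sqr_ge0.
apply: le_trans (cmod_add_le (cmod_add_le h1 h2) h3) _.
apply: le_trans (_ : e * (y ^+ 2 - rho ^+ 2) <= _); last by rewrite ler_pM2l.
have yy : y <= y ^+ 2 by rewrite expr2 ler_peMr // ltW.
apply: le_trans (_ : e * (B / e) <= _).
  by rewrite [leRHS]mulrC divfK ?gt_eqF // /B; lra.
rewrite ler_pM2l //; rewrite /y in yy *; lra.
Qed.

Lemma semi_quad_slit (z : C) : Im z != 0 -> Im (semi_quad z) != 0 \/ 0 < Re (semi_quad z).
Proof.
move=> hz; have [h|h] := eqVneq (a + b - 2 * Re z) 0; last first.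
  left; have -> : Im (semi_quad z) = Im z * (a + b - 2 * Re z).
    by rewrite /semi_quad !ReImE; ring.
  by rewrite mulf_neq0.
right; have -> : Re (semi_quad z) = ((b - a) / 2) ^+ 2 + Im z ^+ 2 -
    (a + b - 2 * Re z) ^+ 2 / 4 by rewrite /semi_quad !ReImE; field.
rewrite h expr0n /= mul0r subr0 ltr_wpDl ?sqr_ge0 //.
by rewrite lt_neqAle eq_sym sqrf_eq0 hz sqr_ge0.
Qed.

Definition semi_root (z : C) : C := psqrt (semi_quad z).

Lemma Im_semi_transform z : 0 < Im z -> Im (semi_transform z) <= 0.
Proof.
move=> hz; rewrite /semi_transform ImC -oppr_ge0.
have hz0 : Im z != 0 by rewrite gt_eqF.
have cp : ccontinuous_on a b (fun x => (semicircle a b x)%:C%C * (z - x%:C%C)^-1).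
  by apply: ccontinuous_onM; [exact: semicircle_path|exact: real_resolvent_path].
have ii := cintegrable_Im (ccontinuous_on_measurable cp) (ccontinuous_on_bounded cp).
rewrite -mulN1r -RintegralZl //; apply: Rintegral_ge0 => x _.
rewrite mulN1r ImM Re_real Im_real mul0r addr0 -mulrN mulr_ge0 ?semicircle_ge0 //.
case: z hz {hz0 cp ii} => u v /= hv; rewrite subr0 opprK.
by rewrite divr_ge0 ?(ltW hv) // addr_ge0 ?sqr_ge0.
Qed.

(** The square is known from the constant of motion. The sign is the one for
which the imaginary part of the transform is not positive. *)
Lemma semi_transform_upper z : 0 < Im z ->
  semi_transform z = K%:C%C * (z - c%:C%C) - Complex 0 1 * K%:C%C * semi_root z.
Proof.
move=> hz; have hs := semi_quad_slit (lt0r_neq0 hz).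
have Rpos := Re_psqrt_gt0 hs; have K0 := semi_const_gt0.
have i2 : (Complex 0 1 : C) ^+ 2 = -1 by rewrite sqr_i.
have : semi_dev z ^+ 2 = (Complex 0 1 * K%:C%C * semi_root z) ^+ 2.
  by rewrite semi_dev_sqr // !exprMn i2 sqr_psqrt; ring.
move=> /eqP; rewrite eqf_sqr => /orP[/eqP h|/eqP h].
  have : Im (semi_dev z) < 0.
    rewrite /semi_dev !ReImE !mul0r addr0 subr0 ltrBlDr add0r.
    by apply: le_lt_trans (Im_semi_transform hz) _; rewrite mulr_gt0.
  move=> hD; exfalso; move: hD; have := mulr_gt0 K0 Rpos; rewrite -/(semi_root z) h !ReImE => h1 h2.
  by move: h1 h2; rewrite !(mul0r, mul1r, subr0, sub0r, addr0, add0r, mulr0); lra.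
have -> : semi_transform z = semi_dev z + K%:C%C * (z - c%:C%C).
  by rewrite /semi_dev subrK.
by rewrite h addrC.
Qed.

Lemma semi_transform_conj z : Im z != 0 ->
  semi_transform (z^*)%C = ((semi_transform z)^*)%C.
Proof.
move=> hz.
have cp : ccontinuous_on a b (fun x => (semicircle a b x)%:C%C * (z - x%:C%C)^-1).
  by apply: ccontinuous_onM; [exact: semicircle_path|exact: real_resolvent_path].
rewrite conjc_Cint; [|exact: ccontinuous_on_measurable|exact: ccontinuous_on_bounded].
apply: eq_Cint => x _.
case: (z) => u v; apply: complex_eqP; rewrite /= !subr0 sqrrN; ring.
Qed.

(** The root is invariant under conjugation, whereas [i] changes sign: through
the cut the transform continues with the opposite sign of the root. *)
Lemma semi_transform_lower z : Im z < 0 ->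
  semi_transform z = K%:C%C * (z - c%:C%C) + Complex 0 1 * K%:C%C * semi_root z.
Proof.
move=> hz; have hz0 : Im z != 0 by rewrite lt_eqF.
have hJ : 0 < Im (z^*)%C by case: z hz {hz0} => u v /=; rewrite oppr_gt0.
have := semi_transform_conj hz0; rewrite semi_transform_upper //.
move=> /(congr1 conjc); rewrite conjcK => <-.
have qJ : semi_quad (z^*)%C = ((semi_quad z)^*)%C.
  by case: (z) => u v; apply: complex_eqP; rewrite /semi_quad /=; ring.
have sqJ (w : C) : ((w^*)%C) ^+ 2 = ((w ^+ 2)^*)%C.
  by case: w => u v; apply: complex_eqP; rewrite !expr2 /=; ring.
have -> : semi_root (z^*)%C = ((semi_root z)^*)%C.
  apply: root_unique.
  - by rewrite sqJ !sqr_psqrt qJ.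
  - by apply: Re_psqrt_gt0; apply: semi_quad_slit; rewrite gt_eqF.
  - have := Re_psqrt_gt0 (semi_quad_slit hz0); rewrite /semi_root.
    by case: (psqrt _).
case: (semi_root z) => u v; case: (z) => p q.
by apply: complex_eqP; rewrite /=; ring.
Qed.

End SemicircleFormula.

(** * Angles and logarithms *)

Section Angles.
Context {R : realType}.
Local Notation C := R[i].
Implicit Types (z : C) (y : R).

Lemma polar_right z : 0 < Re z -> exists w : R,
  [/\ - (pi / 2) < w < pi / 2, Re z = cmod z * cos w & Im z = cmod z * sin w].
Proof.
move=> h; have N0 : 0 < cmod z.
  by apply: lt_le_trans (cmod_Re z); rewrite normr_gt0 gt_eqF.
have qE : (Re z / cmod z) ^+ 2 + (Im z / cmod z) ^+ 2 = 1.
  by rewrite !exprMn -mulrDl -cmod_sqr exprVn divff // expf_neq0 // gt_eqF.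
have p0 : 0 < Re z / cmod z by rewrite divr_gt0.
have q1 : -1 < Im z / cmod z < 1.
  rewrite -ltr_norml ltNge; apply/negP => h1.
  have h2 : 1 <= (Im z / cmod z) ^+ 2.
    by rewrite -[leRHS]ger0_norm ?sqr_ge0 // normrX exprn_ege1.
  by have h3 : 0 < (Re z / cmod z) ^+ 2; [rewrite exprn_gt0|lra].
have q2 : -1 <= Im z / cmod z <= 1 by case/andP: q1 => ? ?; rewrite !ltW.
exists (asin (Im z / cmod z)); split.
- by case/andP: q1 => q3 q4; rewrite asin_gtNpi2 ?asin_ltpi2 ?q3 ?q4 ?ltW.
- rewrite cos_asin // -qE addrK sqrtr_sqr gtr0_norm // mulrC divfK //.
  by rewrite gt_eqF.
- by rewrite asinK // mulrC divfK // gt_eqF.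
Qed.

Lemma cos_le0 y : pi / 2 <= y <= pi + pi / 2 -> cos y <= 0.
Proof.
move=> /andP[h1 h2]; rewrite -[y](subrK pi) cosDpi oppr_le0.
by apply: cos_ge0_pihalf; apply/andP; split; lra.
Qed.

Lemma sin_le y : 0 <= y -> sin y <= y.
Proof.
move=> y0.
have [c _ E] := @MVT_segment R sin cos 0 y y0
  (fun x _ => is_derive_sin x) (@continuous_subspaceT _ _ _ _ (@continuous_sin R)).
move: E; rewrite sin0 !subr0 => ->.
by rewrite ler_piMl // cos_le1.
Qed.

(** Beyond [pi / 2] the cosine is not positive, and before [pi / 2] it is the sine
of the remaining angle. *)
Lemma cos_le_gap y g : 0 <= g -> pi / 2 - g <= y <= pi + pi / 2 -> cos y <= g.
Proof.
move=> g0 /andP[h1 h2]; have [h|h] := leP (pi / 2) y.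
  by apply: le_trans g0; apply: cos_le0; rewrite h.
rewrite -[y]opprK cosN (_ : - y = pi / 2 - y - pi / 2); last by ring.
by rewrite cosBpihalf; apply: le_trans (sin_le _) _; lra.
Qed.

End Angles.

Section NearOne.
Context {R : realType}.
Local Notation C := R[i].
Implicit Types (w : C) (y : R).

Lemma cos_mul_le_sin y : 0 <= y -> y <= pi / 2 -> y * cos y <= sin y.
Proof.
move=> y0 y1.
have [c hc E] := @MVT_segment R sin cos 0 y y0
  (fun x _ => is_derive_sin x) (@continuous_subspaceT _ _ _ _ (@continuous_sin R)).
move: hc; rewrite in_itv /= => /andP[c0 cy].
move: E; rewrite sin0 !subr0 => ->; rewrite mulrC ler_wpM2r //.
have [->//|ne] := eqVneq c y.
apply: ltW; rewrite ltr_cos ?in_itv /=; first by rewrite lt_neqAle ne.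
  by apply/andP; split=> //; have := pi_ge0 R; lra.
by apply/andP; split=> //; have := pi_ge0 R; lra.
Qed.

(** On a strip of width [2 pi] around it, [1] is only approached by the
exponential near the origin. *)
Lemma cexp_near1 w : - (pi / 2) <= Im w <= pi + pi / 2 -> cmod (cexp w - 1) <= 2^-1 ->
  cmod w <= 8 * cmod (cexp w - 1).
Proof.
move=> /andP[y1 y2]; set h := cmod _ => h1.
have h0 : 0 <= h by exact: cmod_ge0.
have hR : `|expR (Re w) * cos (Im w) - 1| <= h.
  by have := cmod_Re (cexp w - 1); rewrite ReD ReN.
have hI : `|expR (Re w) * sin (Im w)| <= h.
  by have := cmod_Im (cexp w - 1); rewrite ImD ImN subr0.
have hM : `|expR (Re w) - 1| <= h.
  rewrite -cmod_cexp ler_norml; apply/andP; split.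
    by have := cmod_lerB 1 (cexp w); rewrite cmodB cmod1 -/h; lra.
  by have := cmod_lerB (cexp w) 1; rewrite cmod1.
have e0 := expR_gt0 (Re w).
have x1 : `|Re w| <= 2 * h.
  move: hM; rewrite !ler_norml => /andP[g1 g2]; apply/andP; split; last first.
    by have := expR_ge1Dx (Re w); lra.
  have : (1 - h) * expR (- Re w) <= 1.
    by rewrite expRN ler_pdivrMr // mul1r; lra.
  have := expR_ge1Dx (- Re w) => g3 g4.
  have : (1 - h) * (1 - Re w) <= 1 by apply: le_trans g4; rewrite ler_wpM2l //; lra.
  by nra.
have c1 : 3^-1 <= cos (Im w).
  move: hR hM; rewrite !ler_norml => /andP[g1 g2] /andP[g3 g4].
  have : 2^-1 <= expR (Re w) * cos (Im w) by lra.
  have [c0|c0] := leP (cos (Im w)) 0.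
    by have := mulr_ge0_le0 (ltW e0) c0; lra.
  have : expR (Re w) * cos (Im w) <= 3 / 2 * cos (Im w) by rewrite ler_pM2r //; lra.
  by lra.
have y3 : Im w <= pi / 2.
  rewrite leNgt; apply/negP => g.
  have : cos (Im w) <= 0 by apply: cos_le0; rewrite ltW.
  by lra.
have s1 : `|sin (Im w)| <= 2 * h.
  move: hI; rewrite normrM gtr0_norm //.
  have : 2^-1 * `|sin (Im w)| <= expR (Re w) * `|sin (Im w)|.
    by rewrite ler_wpM2r //; move: hM; rewrite ler_norml => /andP[g1 g2]; lra.
  by lra.
have y4 : `|Im w| <= 6 * h.
  have P (y : R) : 0 <= y -> y <= pi / 2 -> 3^-1 <= cos y -> y <= 3 * `|sin y|.
    move=> g1 g2 g3; have := cos_mul_le_sin g1 g2; have := ler_norm (sin y).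
    have : y * 3^-1 <= y * cos y by rewrite ler_wpM2l.
    by lra.
  have [g|g] := leP 0 (Im w).
    by rewrite ger0_norm //; have := P _ g y3 c1; lra.
  rewrite ltr0_norm //; have : - Im w <= 3 * `|sin (- Im w)|.
    by apply: P; rewrite ?cosN //; lra.
  by rewrite sinN normrN; lra.
by have := cmod_le w; lra.
Qed.

(** If [eps] is small, a function [- k e^(- m v) (1 + eps v)] takes its value at
[u0] nowhere else within a period of the exponential and is not critical there:
by the Schwarz lemma [eps] varies less than the exponential. *)
Lemma perturbed_exponential_simple (g eps : C -> C) (k u0 : C) (m : R) :
  1 <= m -> k != 0 ->
  (forall v, g v = - (k * cexp (- m%:C%C * v) * (1 + eps v))) ->
  (forall v, cmod (v - u0) <= m^-1 / 2 ->
     analytic_at eps v /\ cmod (eps v) <= 128^-1) ->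
  (forall v, cmod (eps v) <= 128^-1 ->
     - (pi / 2) <= Im (- m%:C%C * (v - u0)) <= pi + pi / 2 ->
     g v = g u0 -> v = u0) /\
  exists c d : R, [/\ 0 < c, 0 < d & forall v, cmod (v - u0) < d ->
    c * cmod (v - u0) <= cmod (g v - g u0)].
Proof.
move=> m1 kn gE disc; have m0 : 0 < m by exact: lt_le_trans m1.
have rho0 : 0 < m^-1 / 2 by rewrite divr_gt0 // invr_gt0.
have c0 : cmod (u0 - u0) <= m^-1 / 2 by rewrite subrr cmod0 ltW.
have e0 := (disc _ c0).2.
have variation v : cmod (v - u0) <= m^-1 / 2 ->
    cmod (eps v - eps u0) <= m / 32 * cmod (v - u0).
  move=> h; have M0 : 0 < 64^-1 :> R by rewrite invr_gt0.
  have := schwarz (f := eps) (z0 := u0) rho0 M0 (fun v h => (disc v h).1) _ h.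
  have H : forall v, cmod (v - u0) <= m^-1 / 2 -> cmod (eps v - eps u0) <= 64^-1.
    move=> v' /disc[_ h']; have := cmodD (eps v') (- eps u0).
    by rewrite cmodN; move: e0 h'; lra.
  move=> /(_ H); set p := cmod (eps v - _); set q := cmod (v - u0) => hpq.
  have m2 : 0 <= 2 * m by rewrite mulr_ge0 // ltW.
  have := ler_wpM2l m2 hpq.
  by rewrite (_ : 2 * m * (m^-1 / 2 * p) = p); [lra|field; rewrite gt_eqF].
have factor (E e : C) : cmod e <= 128^-1 -> cmod E / 2 <= cmod (E * (1 + e)).
  move=> he; rewrite cmodM; apply: ler_wpM2l; first exact: cmod_ge0.
  by have := cmod_lerB 1 (- e); rewrite cmod1 cmodN opprK; lra.
have diff v : g v - g u0 = - (k * cexp (- m%:C%C * u0) *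
   ((cexp (- m%:C%C * (v - u0)) - 1) * (1 + eps v) + (eps v - eps u0))).
  rewrite !gE.
  have -> : cexp (- m%:C%C * v) = cexp (- m%:C%C * u0) * cexp (- m%:C%C * (v - u0)).
    by rewrite -cexpD; congr cexp; ring.
  ring.
have cw v : cmod (- m%:C%C * (v - u0)) = m * cmod (v - u0).
  by rewrite cmodM cmodN cmod_real gtr0_norm.
have pi1 : 1 <= pi / 2 :> R := pihalf_ge1 R.
have low v : cmod (v - u0) <= m^-1 / 2 -> cmod (cexp (- m%:C%C * (v - u0)) - 1) <= 2^-1 ->
    m / 32 * cmod (v - u0) <= cmod ((cexp (- m%:C%C * (v - u0)) - 1) *
      (1 + eps v) + (eps v - eps u0)).
  move=> h1 h2.
  have hw : `|Im (- m%:C%C * (v - u0))| <= 2^-1.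
    by apply: le_trans (cmod_Im _) _; rewrite cw -ler_pdivlMl.
  rewrite ler_norml in hw; case/andP: hw => hw1 hw2.
  have h3 : cmod (- m%:C%C * (v - u0)) <= 8 * cmod (cexp (- m%:C%C * (v - u0)) - 1).
    by apply: cexp_near1 => //; apply/andP; split; lra.
  rewrite cw in h3; have h4 := variation v h1.
  have := factor (cexp (- m%:C%C * (v - u0)) - 1) (eps v) (disc v h1).2.
  move: h3 h4; move: (cexp _ - 1) => E h3 h4 h5.
  have := cmod_lerB (E * (1 + eps v)) (- (eps v - eps u0)).
  by rewrite cmodN opprK; lra.
split.
  move=> v ev im vE; have d0 := diff v; rewrite vE subrr in d0.
  have dz : (cexp (- m%:C%C * (v - u0)) - 1) * (1 + eps v) + (eps v - eps u0) = 0.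
    apply/eqP; move/esym/eqP: d0.
    by rewrite oppr_eq0 !mulf_eq0 (negPf (cexp_neq0 _)) (negPf kn).
  have E1 : cmod (cexp (- m%:C%C * (v - u0)) - 1) <= 32^-1.
    have := factor (cexp (- m%:C%C * (v - u0)) - 1) (eps v) ev.
    have /eqP := dz; rewrite addr_eq0 => /eqP ->; rewrite cmodN.
    by have := cmodD (eps v) (- eps u0); rewrite cmodN; lra.
  have near : cmod (- m%:C%C * (v - u0)) <= 8 * cmod (cexp (- m%:C%C * (v - u0)) - 1).
    by apply: cexp_near1 => //; lra.
  rewrite cw in near.
  have close : cmod (v - u0) <= m^-1 / 2 by rewrite ler_pdivlMl //; lra.
  have := low v close; rewrite dz cmod0 => /(_ _) h.
  have : m / 32 * cmod (v - u0) <= 0 by apply: h; lra.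
  rewrite pmulr_rle0; last by rewrite divr_gt0.
  move=> h'; apply/eqP; rewrite -subr_eq0 -cmod_eq0; apply/eqP/le_anti.
  by rewrite h' cmod_ge0.
have e10 : 0 < 2 * (2 * expR (1 : R)) by rewrite !mulr_gt0 // expR_gt0.
have k0 : 0 < cmod (k * cexp (- m%:C%C * u0)).
  by rewrite cmod_gt0 mulf_neq0 // cexp_neq0.
exists (cmod (k * cexp (- m%:C%C * u0)) * (m / 32)).
exists (Num.min (m^-1 / 2) (m^-1 / (2 * (2 * expR 1)))); split.
- by apply: mulr_gt0 => //; exact: divr_gt0.
- by rewrite lt_min rho0 /=; apply: divr_gt0 => //; rewrite invr_gt0.
move=> v; rewrite lt_min => /andP[h1 h2].
rewrite diff cmodN [leRHS]cmodM -[leLHS]mulrA; apply: ler_wpM2l; first exact: ltW.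
apply: low; first exact: ltW.
have h3 : m * cmod (v - u0) < 2^-1 by rewrite -ltr_pdivlMl // mulrC.
have := @cexp_taylor0 R (- m%:C%C * (v - u0)); rewrite cw => /(_ _) h.
apply: le_trans (h _) _; first lra.
rewrite ltr_pdivlMr // in h2.
have := ler_wpM2l (ltW m0) (ltW h2); rewrite divff ?gt_eqF //; lra.
Qed.

End NearOne.

(** At each point of the plane the imaginary part of [g] is locally bounded
below: by continuity inside [T], by properness outside. *)
Lemma lower_proper_bounded_disc {R : realType} (c : R) (T : set R[i]) g (L : R) :
  lower_proper c T g -> exists B : R, forall u, T u -> cmod u <= L -> - B < Im (g u).
Proof.
move=> LP; apply: contrapT => N.
have [||u _ H] := ccompact_cluster (Q := fun e u => T u /\ e * Im (g u) <= - 1)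
    (@closed_disc_compact R 0 L).
- move=> e e0; apply: contrapT => N2; apply: N; exists e^-1 => u Tu uL.
  rewrite ltNge; apply/negP => h; apply: N2; exists u; first by rewrite /= subr0.
  split=> //; have := ler_wpM2l (ltW e0) h; rewrite mulrN divff ?gt_eqF //.
- move=> e e' u e0 ee [Tu h]; split=> //.
  have i0 : Im (g u) <= 0 by rewrite -(pmulr_rle0 _ e0); lra.
  by apply: le_trans h; rewrite ler_wnM2r.
have [d [B [d0 B0 HB]]] : exists d B : R, [/\ 0 < d, 0 < B &
    forall v, cmod (v - u) < d -> T v -> - B < Im (g v)].
  have [Tu|Tu] := pselect (T u).
    have [d d0 Hd] := analytic_ccontinuous (lp_an LP Tu) (ltr01 : 0 < 1 :> R).
    exists d, (`|Im (g u)| + 1); split=> //.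
    move=> v /Hd h _; have := cmod_Im (g v - g u); rewrite ImD ImN.
    have := ler_norm (- (Im (g v) - Im (g u))); have := ler_norm (- Im (g u)).
    by rewrite !normrN; lra.
  have [d d0 Hd] := lp_bdry LP Tu (ltr01 : 0 < 1 :> R).
  by exists d, 1; split=> // v h Tv; exact: Hd.
have iB : 0 < B^-1 by rewrite invr_gt0.
have [v vd [_ [Tv hv]]] := H B^-1 d iB d0.
have := HB v vd Tv; have := ler_wpM2l (ltW B0) hv.
rewrite mulrA divff ?gt_eqF // mul1r; lra.
Qed.

Lemma upper_log {R : realType} (r : R) (z : R[i]) : 0 < r -> 0 < Im z ->
  exists2 u, 0 < Im u < pi / r & cexp (r%:C%C * u) = z.
Proof.
move=> r0 z0; have N0 : 0 < cmod z.
  by apply: lt_le_trans (cmod_Im z); rewrite normr_gt0 gt_eqF.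
have qE : (Re z / cmod z) ^+ 2 + (Im z / cmod z) ^+ 2 = 1.
  by rewrite !exprMn -mulrDl -cmod_sqr exprVn divff // expf_neq0 // gt_eqF.
have p0 : 0 < Im z / cmod z by rewrite divr_gt0.
have q1 : -1 < Re z / cmod z < 1.
  rewrite -ltr_norml ltNge; apply/negP => h1.
  have h2 : 1 <= (Re z / cmod z) ^+ 2.
    by rewrite -[leRHS]ger0_norm ?sqr_ge0 // normrX exprn_ege1.
  by have h3 : 0 < (Im z / cmod z) ^+ 2; [rewrite exprn_gt0|lra].
have [q3 q4] := andP q1.
pose th := acos (Re z / cmod z).
have rc : r%:C%C != 0 :> R[i] by rewrite -cmod_gt0 cmod_real gtr0_norm.
exists (Complex (ln (cmod z) / r) (th / r)).
  rewrite ImC divr_gt0 //= ?ltr_pM2r ?invr_gt0 //.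
    by rewrite /th acos_ltpi // q3 ltW.
  by rewrite /th acos_gt0 // q4 ltW.
have -> : r%:C%C * Complex (ln (cmod z) / r) (th / r) = Complex (ln (cmod z)) th.
  by apply: complex_eqP; rewrite !ReImE; field; rewrite gt_eqF.
rewrite /cexp ReC ImC lnK ?posrE //; apply: complex_eqP; rewrite ?ReC ?ImC.
  by rewrite /th acosK ?in_itv /= ?ltW // mulrC divfK // gt_eqF.
rewrite /th sin_acos ?ltW // -qE [X in Num.sqrt X]addrAC subrr add0r sqrtr_sqr gtr0_norm //.
by rewrite mulrC divfK // gt_eqF.
Qed.

(** * The continued Cauchy transform of a power *)

Section Continuation.
Context {R : realType} (a b r t : R) (n : nat) (l alpha : 'I_n -> R).
Context (a0 : 0 < a) (ab : a < b) (r1 : 1 <= r) (t0 : 0 <= t)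
  (lt : forall k, t <= l k <= t + 1) (alpha0 : forall k, 0 < alpha k).
Local Notation C := R[i].

Definition density (x : R) : R :=
  semicircle a b x / x * \sum_(k < n) alpha k / x `^ l k.

Definition transform (z : C) : C :=
  Cint a b (fun x => (density x)%:C%C * (z - (x `^ r)%:C%C)^-1).

(** With [z = e^(r u)] the term of exponent [l k] of the density contributes the
factor [e^(- (l k + r) u)] to the transform. *)
Definition expo (k : 'I_n) : R := l k + r.

(** This angle [phi] satisfies [(m - 1) phi <= pi <= m phi] for all the exponents
[m], because the [l k] lie in an interval of length one. *)
Definition opening : R := pi / (t + r).

(** In the logarithmic coordinate [u], with [z = e^(r u)], this is the region
reached through the cut: the whole upper half-plane, the open cut, and below it
the sector of opening [r * opening]. *)
Definition log_domain : set C := [set u | - opening < Im u < pi / r /\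
  (Im u = 0 -> ln a < Re u < ln b)].

Definition exp_sum (u : C) : C :=
  \sum_(k < n) (alpha k)%:C%C * cexp (- (expo k)%:C%C * u).

(** What remains of the transform in the logarithmic coordinate when the polar
part of the kernel is removed. *)
Definition regular_part (k : 'I_n) (u : C) : C :=
  Cint a b (fun x => (semicircle a b x / x)%:C%C *
    exp_kernel (expo k) r (u - (ln x)%:C%C)).

Local Notation K := (semi_const a b).
Local Notation mid := ((a + b) / 2).

Definition real_part (u : C) : C :=
  \sum_(k < n) (alpha k)%:C%C * cexp (- (expo k)%:C%C * u) *
    (regular_part k u + r^-1%:C%C * (K%:C%C * (cexp u - mid%:C%C))).

Definition root_log (u : C) : C := semi_root a b (cexp u).

(** Analytic continuation of the transform through the cut: [real_part] is
analytic in a whole strip, and the branch [root_log] of the square root is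
analytic across the cut. *)
Definition continued (u : C) : C :=
  real_part u - Complex 0 1 * (K / r)%:C%C * root_log u * exp_sum u.

(** What the continuation adds to the transform itself below the cut. *)
Definition excess (u : C) : C :=
  - (Complex 0 1 * (2 * K / r)%:C%C * root_log u * exp_sum u).

Lemma r_gt0 : 0 < r. Proof. by apply: lt_le_trans r1. Qed.

Lemma b_gt0 : 0 < b. Proof. exact: lt_trans ab. Qed.

Lemma tr_gt0 : 0 < t + r. Proof. by have := r_gt0; move: t0; lra. Qed.

Lemma opening_gt0 : 0 < opening.
Proof. by rewrite divr_gt0 ?pi_gt0 // tr_gt0. Qed.

Lemma opening_le : opening <= pi / r.
Proof.
apply: ler_wpM2l; first exact: pi_ge0.
by rewrite lef_pV2 ?posrE ?tr_gt0 ?r_gt0 //; move: t0; lra.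
Qed.

Lemma pir_le : pi / r <= pi.
Proof. by rewrite ler_pdivrMr ?r_gt0 // ler_peMr // pi_ge0. Qed.

Lemma expo_ge1 k : 1 <= expo k.
Proof. by have /andP[h _] := lt k; rewrite /expo; move: t0 r1; lra. Qed.

Lemma expo_opening k : pi <= expo k * opening.
Proof.
rewrite /opening mulrA ler_pdivlMr ?tr_gt0 // mulrC ler_wpM2r ?pi_ge0 //.
by have /andP[h _] := lt k; rewrite /expo; lra.
Qed.

Lemma expo_opening1 k : (expo k - 1) * opening <= pi.
Proof.
rewrite /opening mulrA ler_pdivrMr ?tr_gt0 // mulrC ler_wpM2l ?pi_ge0 //.
by have /andP[_ h] := lt k; rewrite /expo; lra.
Qed.

Lemma density_ge0 x : a <= x <= b -> 0 <= density x.
Proof.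
move=> /andP[ax _]; have x0 : 0 < x by apply: lt_le_trans ax.
rewrite mulr_ge0 // ?divr_ge0 ?semicircle_ge0 ?(ltW x0) //.
by apply: sumr_ge0 => k _; rewrite divr_ge0 ?powR_ge0 // ltW.
Qed.

Lemma ln_path : ccontinuous_on a b (fun x => (ln x)%:C%C).
Proof.
apply: ccontinuous_on_real => x /andP[ax _]; apply: continuous_ln.
exact: lt_le_trans ax.
Qed.

(** Real powers are handled through [x^p = e^(p ln x)]. *)
Lemma cexp_ln x (p : R) : 0 < x -> (x `^ p)%:C%C = cexp (p%:C%C * (ln x)%:C%C).
Proof. by move=> x0; rewrite -rmorphM cexp_real /powR gt_eqF. Qed.

Lemma cexp_ln_path (p : R) : ccontinuous_on a b (fun x => cexp (p%:C%C * (ln x)%:C%C)).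
Proof.
apply: (@ccontinuous_on_comp _ a b (fun x => p%:C%C * (ln x)%:C%C) cexp).
  by apply: ccontinuous_onM; [exact: ccontinuous_on_cst|exact: ln_path].
by move=> x _; apply: analytic_ccontinuous; exact: analytic_cexp.
Qed.

Lemma eq_ccontinuous_on p q (f g : R -> C) :
  (forall x, p <= x <= q -> f x = g x) ->
  ccontinuous_on p q f -> ccontinuous_on p q g.
Proof.
move=> fg fc x xpq e e0; have [d d0 H] := fc x xpq e e0.
by exists d => // y ypq yx; rewrite -!fg //; exact: H.
Qed.

Lemma power_path : ccontinuous_on a b (fun x => (x `^ r)%:C%C).
Proof.
apply: eq_ccontinuous_on (cexp_ln_path r) => x /andP[ax _].
by rewrite cexp_ln //; exact: lt_le_trans ax.
Qed.

Lemma weight_path : ccontinuous_on a b (fun x => (semicircle a b x / x)%:C%C).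
Proof.
apply: (@eq_ccontinuous_on _ _
  (fun x => (semicircle a b x)%:C%C * cexp ((-1 : R)%:C%C * (ln x)%:C%C))).
  move=> x /andP[ax _]; have x0 : 0 < x by exact: lt_le_trans ax.
  by rewrite -cexp_ln // powR_inv1 ?(ltW x0) // -rmorphM.
by apply: ccontinuous_onM; [exact: semicircle_path|exact: cexp_ln_path].
Qed.

Lemma sum_path (F : 'I_n -> R -> C) : (forall k, ccontinuous_on a b (F k)) ->
  ccontinuous_on a b (fun x => \sum_(k < n) F k x).
Proof.
move=> Fc; have : forall s : seq 'I_n, ccontinuous_on a b (fun x => \sum_(k <- s) F k x).
  elim=> [|k s IH].
    by apply: eq_ccontinuous_on (@ccontinuous_on_cst R a b 0) => x _; rewrite big_nil.
  by apply: eq_ccontinuous_on (ccontinuous_onD (Fc k) IH) => x _; rewrite big_cons.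
exact.
Qed.

Lemma density_path : ccontinuous_on a b (fun x => (density x)%:C%C).
Proof.
apply: (@eq_ccontinuous_on _ _ (fun x => (semicircle a b x / x)%:C%C *
   \sum_(k < n) (alpha k)%:C%C * cexp ((- l k)%:C%C * (ln x)%:C%C))).
  move=> x /andP[ax _]; have x0 : 0 < x by exact: lt_le_trans ax.
  rewrite /density [RHS]rmorphM rmorph_sum /=; congr (_ * _); apply: eq_bigr => k _.
  by rewrite -cexp_ln // powRN -rmorphM.
apply: ccontinuous_onM; first exact: weight_path.
apply: sum_path => k.
by apply: ccontinuous_onM; [exact: ccontinuous_on_cst|exact: cexp_ln_path].
Qed.

Lemma transform_analytic z (d : R) : 0 < d ->
  (forall x, a <= x <= b -> d <= cmod (z - (x `^ r)%:C%C)) -> analytic_at transform z.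
Proof.
move=> d0 zd; have [s2 H] := weighted_transform_expansion (ltW ab) d0
  density_path power_path zd.
by do 2 eexists; exact: H.
Qed.

Lemma transform_path z : (forall x, a <= x <= b -> z - (x `^ r)%:C%C != 0) ->
  ccontinuous_on a b (fun x => (density x)%:C%C * (z - (x `^ r)%:C%C)^-1).
Proof.
move=> hz; apply: ccontinuous_onM; first exact: density_path.
by apply: (@resolvent_path _ a b (fun x => (x `^ r)%:C%C)) => //; exact: power_path.
Qed.

Lemma density_bound : exists M : R, 0 < M /\ forall x, a <= x <= b -> density x <= M.
Proof.
have [M HM] := ccontinuous_on_bounded density_path.
exists (`|M| + 1); split; first by rewrite ltr_wpDl.
move=> x xab; have := HM x xab; rewrite cmod_real ger0_norm ?density_ge0 //.
by have := ler_norm M; lra.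
Qed.

Lemma transform_bound : exists2 M : R, 0 < M & forall z (d : R), 0 < d ->
  (forall x, a <= x <= b -> d <= cmod (z - (x `^ r)%:C%C)) ->
  cmod (transform z) <= M / d.
Proof.
have [M [M0 HM]] := density_bound.
exists (2 * (b - a) * M); first by rewrite !mulr_gt0 // subr_gt0.
move=> z d d0 zd; rewrite -mulrA; apply: Cint_norm; first exact: ltW.
  apply: ccontinuous_on_measurable; apply: transform_path => x /zd h.
  by rewrite -cmod_gt0; exact: lt_le_trans h.
move=> x xab; apply: cmod_mul_le.
  by rewrite cmod_real ger0_norm ?density_ge0 // HM.
by rewrite cmodV lef_pV2 ?posrE ?zd //; exact: lt_le_trans (zd x xab).
Qed.

Lemma Im_transform_real (x : R) : Im (transform x%:C%C) = 0.
Proof.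
apply: Im_Cint_eq0 => y _; rewrite -rmorphB -fmorphV -rmorphM.
exact: Im_real.
Qed.

Lemma Im_inv (z : C) : Im z^-1 = - Im z / cmod z ^+ 2.
Proof. by rewrite cmod_sqr; case: z => u v /=; rewrite mulNr. Qed.

Lemma Im_transform_lower z : Im z < 0 -> 0 <= Im (transform z).
Proof.
move=> hz; rewrite /transform ImC; apply: Rintegral_ge0 => x /segmentE xab.
rewrite ImM Re_real Im_real mul0r addr0 mulr_ge0 ?density_ge0 // Im_inv.
rewrite divr_ge0 ?sqr_ge0 // ImD ImN Im_real oppr0 addr0; lra.
Qed.

Lemma log_domain_bounds u : log_domain u -> `|Im u| < pi / r.
Proof.
move=> [/andP[h1 h2] _]; rewrite ltr_norml h2 andbT.
by have := opening_le; lra.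
Qed.

(** The polar part of the kernel turns the integral into the Cauchy transform of
the semicircle at [e^u]. *)
Lemma transform_cut u : `|Im u| < pi / r -> Im u != 0 ->
  transform (cexp (r%:C%C * u)) = \sum_(k < n) (alpha k)%:C%C *
    cexp (- (expo k)%:C%C * u) *
    (regular_part k u + r^-1%:C%C * semi_transform a b (cexp u)).
Proof.
move=> hu hu0; have r0 := r_gt0.
have hp : `|Im u| < pi by apply: lt_le_trans hu pir_le.
have hrp : `|Im (r%:C%C * u)| < pi.
  by rewrite ImM Re_real Im_real mul0r addr0 normrM gtr0_norm // mulrC -ltr_pdivlMr.
have ie : Im (cexp u) != 0.
  rewrite /cexp ImC; apply: mulf_neq0; first by rewrite gt_eqF ?expR_gt0.
  have s0 (y : R) : 0 < y -> y < pi -> sin y != 0.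
    by move=> y0 y1; rewrite gt_eqF // sin_gt0_pi // y0 y1.
  move: hp; rewrite ltr_norml => /andP[h1 h2].
  have := hu0; rewrite neq_lt => /orP[h|h].
    by rewrite -oppr_eq0 -sinN; apply: s0; lra.
  exact: (s0 _ h h2).
have kp k : ccontinuous_on a b (fun x => (semicircle a b x / x)%:C%C *
    exp_kernel (expo k) r (u - (ln x)%:C%C)).
  apply: ccontinuous_onM; first exact: weight_path.
  apply: (@ccontinuous_on_comp _ a b (fun x => (ln x)%:C%C)
    (fun v => exp_kernel (expo k) r (u - v))); first exact: ln_path.
  move=> x xab e e0.
  have vM (i : unit) : [set: unit] i -> `|ln x| <= `|ln x| by [].
  have A := unif_analytic_at (I : [set: unit] tt)
    (unif_analytic_exp_kernel (expo k) (M := `|ln x|) r1 vM hu).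
  have [d d0 H] := analytic_ccontinuous A e0.
  exists d => // v hv.
  have := H (u + (ln x)%:C%C - v).
  rewrite (_ : u + (ln x)%:C%C - v - u = - (v - (ln x)%:C%C)); last by ring.
  rewrite cmodN => /(_ hv).
  by rewrite (_ : u + (ln x)%:C%C - v - (ln x)%:C%C = u - v) //; ring.
have sp : ccontinuous_on a b (fun x => (semicircle a b x)%:C%C * (cexp u - x%:C%C)^-1).
  by apply: ccontinuous_onM; [exact: semicircle_path|exact: real_resolvent_path].
have sumC (s : seq 'I_n) (F : 'I_n -> R -> C) : (forall k, ccontinuous_on a b (F k)) ->
    Cint a b (fun x => \sum_(k <- s) F k x) = \sum_(k <- s) Cint a b (F k) /\
    ccontinuous_on a b (fun x => \sum_(k <- s) F k x).
  move=> Fc; elim: s => [|k s [IH IHc]].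
    split; last first.
      by apply: eq_ccontinuous_on (@ccontinuous_on_cst R a b 0) => x _; rewrite big_nil.
    rewrite big_nil (eq_Cint (g := fun=> 0 * 0)); last by move=> x _; rewrite big_nil mul0r.
    by rewrite (CintZ 0 (cmeasurable_cst a b 0) (cbounded_cst a b 0)) mul0r.
  split; last first.
    by apply: eq_ccontinuous_on (ccontinuous_onD (Fc k) IHc) => x _; rewrite big_cons.
  rewrite big_cons (eq_Cint (g := fun x => F k x + \sum_(k <- s) F k x)); last first.
    by move=> x _; rewrite big_cons.
  by rewrite CintD ?IH //; [exact: ccontinuous_on_measurable|exact: ccontinuous_on_bounded
    |exact: ccontinuous_on_measurable|exact: ccontinuous_on_bounded].
pose G k x := (alpha k)%:C%C * cexp (- (expo k)%:C%C * u) *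
  ((semicircle a b x / x)%:C%C * exp_kernel (expo k) r (u - (ln x)%:C%C) +
   r^-1%:C%C * ((semicircle a b x)%:C%C * (cexp u - x%:C%C)^-1)).
have Gc k : ccontinuous_on a b (G k).
  apply: ccontinuous_onM; first exact: ccontinuous_on_cst.
  apply: ccontinuous_onD => //; apply: ccontinuous_onM => //.
  exact: ccontinuous_on_cst.
rewrite /transform (eq_Cint (g := fun x => \sum_(k < n) G k x)); last first.
  move=> x xab; have x0 : 0 < x by case/andP: xab => ax _; exact: lt_le_trans ax.
  rewrite /density mulr_sumr rmorph_sum /= mulr_suml; apply: eq_bigr => k _.
  rewrite /G; set w := u - (ln x)%:C%C.
  have wI : Im w = Im u by rewrite /w ImD ImN Im_real subr0.
  have w0 : w != 0 by apply: contra hu0 => /eqP h; rewrite -wI h.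
  have e1 : expm1q (r%:C%C * w) != 0.
    by apply: expm1q_neq0; rewrite ImM Re_real Im_real mul0r addr0 wI;
       move: hrp; rewrite ImM Re_real Im_real mul0r addr0.
  have e2 : expm1q w != 0 by apply: expm1q_neq0; rewrite wI.
  have := exp_kernelE (expo k) (lt0r_neq0 r0) w0 e1 e2 => kE.
  have xc : x%:C%C != 0 :> C by rewrite -cmod_gt0 cmod_real gtr0_norm.
  have Eu : cexp u = x%:C%C * cexp w.
    have xE : x%:C%C = cexp ((ln x)%:C%C) :> C by rewrite cexp_real lnK ?posrE.
    by rewrite {1}xE -cexpD /w [_ + (u - _)]addrC subrK.
  have Xr : (x `^ r)%:C%C = cexp (r%:C%C * (ln x)%:C%C) by exact: cexp_ln.
  have Xl : (x `^ l k)%:C%C = cexp ((l k)%:C%C * (ln x)%:C%C) by exact: cexp_ln.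
  have Er : cexp (r%:C%C * u) = cexp (r%:C%C * (ln x)%:C%C) * cexp (r%:C%C * w).
    by rewrite -cexpD /w; congr cexp; ring.
  have Em : cexp (- (expo k)%:C%C * u) * cexp ((expo k)%:C%C * w) =
      (cexp (r%:C%C * (ln x)%:C%C))^-1 * (cexp ((l k)%:C%C * (ln x)%:C%C))^-1.
    rewrite -!cexpN -!cexpD /w /expo; congr cexp; rewrite rmorphD; ring.
  have n1 : cexp w - 1 != 0 by rewrite -mul_expm1q mulf_neq0.
  have n2 : cexp (r%:C%C * w) - 1 != 0.
    by rewrite -mul_expm1q !mulf_neq0 // -cmod_gt0 cmod_real gtr0_norm.
  have n3 := cexp_neq0 (r%:C%C * (ln x)%:C%C).
  have n4 := cexp_neq0 ((l k)%:C%C * (ln x)%:C%C).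
  have rc : r%:C%C != 0 :> C by rewrite -cmod_gt0 cmod_real gtr0_norm.
  transitivity ((alpha k)%:C%C * (semicircle a b x / x)%:C%C *
     ((cexp (- (expo k)%:C%C * u) * cexp ((expo k)%:C%C * w)) /
      (cexp (r%:C%C * w) - 1))).
    rewrite Em Er Xr !rmorphM !fmorphV /= Xl.
    move: (cexp (r%:C%C * (ln x)%:C%C)) n3 => X n3.
    move: (cexp ((l k)%:C%C * (ln x)%:C%C)) n4 => Y n4.
    move: (cexp (r%:C%C * w)) n2 => Z n2.
    move: (x%:C%C : C) xc => xx xc.
    field; rewrite n2 n3 n4 xc /=.
    by rewrite -{2}[X]mulr1 -mulrBr mulf_neq0.
  rewrite -[_ * _ / (cexp (r%:C%C * w) - 1)]mulrA kE Eu !rmorphM !fmorphV /=.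
  move: (cexp w) n1 => W n1; move: (exp_kernel _ _ _) => Q.
  move: (cexp (- _ * u)) => P; move: (x%:C%C : C) xc => xx xc.
  move: (r%:C%C : C) rc => rr rc.
  field; rewrite n1 rc xc /=.
  by rewrite -{2}[xx]mulr1 -mulrBr mulf_neq0.
have [-> _] := sumC (index_enum 'I_n) G Gc.
apply: eq_bigr => k _; rewrite /G.
have c1 := ccontinuous_onM (@ccontinuous_on_cst R a b r^-1%:C%C) sp.
have m1 := ccontinuous_on_measurable (kp k); have b1 := ccontinuous_on_bounded (kp k).
have m2 := ccontinuous_on_measurable c1; have b2 := ccontinuous_on_bounded c1.
rewrite (CintZ _ (cmeasurableD m1 m2) (cboundedD b1 b2)) (CintD m1 b1 m2 b2).
by rewrite (CintZ _ (ccontinuous_on_measurable sp) (ccontinuous_on_bounded sp)).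
Qed.


Let r0 : 0 < r := r_gt0.
Let b0 : 0 < b := b_gt0.
Let op0 : 0 < opening := opening_gt0.
Let opr : opening <= pi / r := opening_le.
Let prp : pi / r <= pi := pir_le.
Let K0 : 0 < K := semi_const_gt0 ab.


(** * The two sides of the cut *)

Lemma sum_split (F : C) (P : 'I_n -> C) (X : C) :
  \sum_(k < n) (alpha k)%:C%C * cexp (- (expo k)%:C%C * X) * (P k + r^-1%:C%C * F) =
  \sum_(k < n) (alpha k)%:C%C * cexp (- (expo k)%:C%C * X) * P k +
  r^-1%:C%C * F * exp_sum X.
Proof.
rewrite /exp_sum mulr_sumr -big_split /=; apply: eq_bigr => k _; ring.
Qed.

Lemma continued_upper u : 0 < Im u < pi / r ->
  continued u = transform (cexp (r%:C%C * u)).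
Proof.
move=> /andP[h1 h2].
have hu : `|Im u| < pi / r by rewrite gtr0_norm.
rewrite transform_cut ?gt_eqF // semi_transform_upper //; last first.
  rewrite /cexp ImC mulr_gt0 ?expR_gt0 // sin_gt0_pi // h1 /=.
  exact: lt_le_trans prp.
rewrite /continued /real_part !sum_split -addrA; congr (_ + _).
by rewrite /root_log [(K / r)%:C%C]rmorphM /=; ring.
Qed.

Lemma continued_lower u : - opening < Im u < 0 ->
  continued u = transform (cexp (r%:C%C * u)) + excess u.
Proof.
move=> /andP[h1 h2].
have hu : `|Im u| < pi / r by rewrite ltr0_norm //; move: opr; lra.
rewrite transform_cut ?lt_eqF // semi_transform_lower //; last first.
  rewrite /cexp ImC pmulr_rlt0 ?expR_gt0 // -oppr_gt0 -sinN sin_gt0_pi //.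
  by move: opr prp; lra.
rewrite /continued /real_part /excess !sum_split -!addrA; congr (_ + _).
have -> : (2 * K / r)%:C%C = 2 * K%:C%C * r^-1%:C%C :> C by rewrite !rmorphM /= rmorph_nat.
by rewrite /root_log; ring.
Qed.

Lemma log_domain_open u : log_domain u -> exists2 d : R, 0 < d &
  forall v, cmod (v - u) < d -> log_domain v.
Proof.
move=> [/andP[h1 h2] h3].
have im v : `|Im v - Im u| <= cmod (v - u).
  by have := cmod_Im (v - u); rewrite ImD ImN.
have re v : `|Re v - Re u| <= cmod (v - u).
  by have := cmod_Re (v - u); rewrite ReD ReN.
pose d1 := Num.min (Im u + opening) (pi / r - Im u).
have d10 : 0 < d1 by rewrite lt_min !subr_gt0 h2 -ltrBlDr sub0r h1.
have S v : cmod (v - u) < d1 -> - opening < Im v < pi / r.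
  rewrite lt_min => /andP[g1 g2]; have := im v; rewrite ler_norml => /andP[g3 g4].
  by apply/andP; split; lra.
move: d1 d10 S => d1 d10 S.
have [i0|i0] := eqVneq (Im u) 0.
  have /andP[e1 e2] := h3 i0.
  exists (Num.min d1 (Num.min (Re u - ln a) (ln b - Re u))).
    by rewrite !lt_min d10 !subr_gt0 e1.
  move=> v; rewrite !lt_min => /andP[/S g1 /andP[g2 g3]]; split => // _.
  by have := re v; rewrite ler_norml => /andP[g4 g5]; apply/andP; split; lra.
exists (Num.min d1 `|Im u|); first by rewrite lt_min d10 normr_gt0.
move=> v; rewrite lt_min => /andP[/S g1 g2]; split => // v0.
by have := im v; rewrite v0 sub0r normrN; lra.
Qed.

Lemma log_domain_slit u : log_domain u ->
  Im (semi_quad a b (cexp u)) != 0 \/ 0 < Re (semi_quad a b (cexp u)).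
Proof.
move=> hu; have hb := log_domain_bounds hu.
have [i0|i0] := eqVneq (Im u) 0; last first.
  apply: semi_quad_slit.
  rewrite /cexp ImC; apply: mulf_neq0; first by rewrite gt_eqF ?expR_gt0.
  have hp : `|Im u| < pi by apply: lt_le_trans hb prp.
  have s0 (y : R) : 0 < y -> y < pi -> sin y != 0.
    by move=> y0 y1; rewrite gt_eqF // sin_gt0_pi // y0 y1.
  move: hp; rewrite ltr_norml => /andP[h1 h2].
  have := i0; rewrite neq_lt => /orP[h|h].
    by rewrite -oppr_eq0 -sinN; apply: s0; lra.
  exact: (s0 _ h h2).
right; case: hu => _ /(_ i0) /andP[h1 h2].
have -> : u = (Re u)%:C%C by apply: complex_eqP; rewrite ?i0.
rewrite cexp_real /semi_quad -!rmorphB -rmorphM Re_real mulr_gt0 // subr_gt0.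
  by rewrite -[ltRHS](lnK (_ : b \is Num.pos)) ?posrE // ltr_expR.
by rewrite -[ltLHS](lnK (_ : a \is Num.pos)) ?posrE // ltr_expR.
Qed.

Lemma root_log_gt0 u : log_domain u -> 0 < Re (root_log u).
Proof. by move=> hu; apply: Re_psqrt_gt0; exact: log_domain_slit. Qed.

Lemma sqr_root_log u : root_log u ^+ 2 = semi_quad a b (cexp u).
Proof. exact: sqr_psqrt. Qed.

Lemma analytic_quad_log u : analytic_at (fun v => semi_quad a b (cexp v)) u.
Proof.
apply: analyticM; apply: analyticB; try exact: analytic_cst; exact: analytic_cexp.
Qed.

Lemma root_log_analytic u : log_domain u -> analytic_at root_log u.
Proof.
move=> /log_domain_open[d d0 H].
apply: (analytic_root d0) (analytic_quad_log u) => v /H hv.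
  exact: sqr_root_log.
exact: root_log_gt0.
Qed.

Lemma analytic_cexp_scale (k : C) u : analytic_at (fun v => cexp (k * v)) u.
Proof.
have h1 (i : unit) : [set: unit] i -> cmod k <= Num.max (cmod k) (cmod (k * u + 0)).
  by move=> _; rewrite le_max lexx.
have h2 (i : unit) : [set: unit] i ->
    cmod (k * u + 0) <= Num.max (cmod k) (cmod (k * u + 0)).
  by move=> _; rewrite le_max lexx orbT.
have := unif_analytic_at (I : [set: unit] tt) (unif_analytic_cexp h1 h2).
by under eq_fun do rewrite addr0.
Qed.

Lemma exp_sum_analytic u : analytic_at exp_sum u.
Proof.
apply: analytic_sum => k.
by apply: analyticM; [exact: analytic_cst|exact: analytic_cexp_scale].
Qed.

Lemma regular_part_analytic k u : `|Im u| < pi / r -> analytic_at (regular_part k) u.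
Proof.
move=> hu.
have [M HM] := ccontinuous_on_bounded (ln_path).
have [W HW] := ccontinuous_on_bounded (weight_path).
apply: (@unif_analytic_at _ unit [set: unit]
  (fun _ v => regular_part k v) u tt) => //.
apply: (@unif_analytic_int _ unit [set: unit] a b (fun _ x v =>
  (semicircle a b x / x)%:C%C * exp_kernel (expo k) r (v - (ln x)%:C%C))).
- exact: ltW.
- apply: unif_analyticM.
    apply: (@unif_analytic_cst _ _ _ _ W) => ix [_ hx]; exact: HW.
  apply: (@unif_analytic_exp_kernel _ _ _ _ _ (fun ix => ln ix.2) _ M) => //.
  by move=> ix [_ hx]; have := HM _ hx; rewrite cmod_real.
exists (pi / r - `|Im u|); first by rewrite subr_gt0.
move=> _ _ h hh.
have huh : `|Im (u + h)| < pi / r.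
  rewrite ImD; apply: le_lt_trans (ler_normD _ _) _.
  by have := cmod_Im h; lra.
apply: ccontinuous_on_measurable; apply: ccontinuous_onM; first exact: weight_path.
apply: (@ccontinuous_on_comp _ a b (fun x => (ln x)%:C%C)
  (fun v => exp_kernel (expo k) r (u + h - v))); first exact: ln_path.
move=> x xab e e0.
have vM (i : unit) : [set: unit] i -> `|ln x| <= `|ln x| by [].
have A := unif_analytic_at (I : [set: unit] tt)
  (unif_analytic_exp_kernel (expo k) (M := `|ln x|) r1 vM huh).
have [d d0 H] := analytic_ccontinuous A e0.
exists d => // v hv.
have := H (u + h + (ln x)%:C%C - v).
rewrite (_ : u + h + (ln x)%:C%C - v - (u + h) = - (v - (ln x)%:C%C)); last by ring.
rewrite cmodN => /(_ hv).
by rewrite (_ : u + h + (ln x)%:C%C - v - (ln x)%:C%C = u + h - v) //; ring.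
Qed.

Lemma real_part_analytic u : `|Im u| < pi / r -> analytic_at real_part u.
Proof.
move=> hu; apply: analytic_sum => k; apply: analyticM.
  by apply: analyticM; [exact: analytic_cst|exact: analytic_cexp_scale].
apply: analyticD; first exact: regular_part_analytic.
apply: analyticM; first exact: analytic_cst.
apply: analyticM; first exact: analytic_cst.
by apply: analyticB; [exact: analytic_cexp|exact: analytic_cst].
Qed.

Lemma continued_analytic u : log_domain u -> analytic_at continued u.
Proof.
move=> hu; apply: analyticB.
  by apply: real_part_analytic; exact: log_domain_bounds hu.
apply: analyticM; last exact: exp_sum_analytic.
by apply: analyticM; [exact: analytic_cst|exact: root_log_analytic].
Qed.

(** * Imaginary parts at the boundary of the domain *)

Lemma Im0M (z w : C) : Im z = 0 -> Im w = 0 -> Im (z * w) = 0.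
Proof. by move=> hz hw; rewrite ImM hz hw mulr0 mul0r addr0. Qed.

Lemma Im0D (z w : C) : Im z = 0 -> Im w = 0 -> Im (z + w) = 0.
Proof. by move=> hz hw; rewrite ImD hz hw addr0. Qed.

Lemma Im_exp_sum_real (x : R) : Im (exp_sum x%:C%C) = 0.
Proof.
rewrite /exp_sum Im_sum big1 // => k _; apply: Im0M => //.
by rewrite -rmorphN -rmorphM cexp_real.
Qed.

Lemma Im_real_part_real (x : R) : Im (real_part x%:C%C) = 0.
Proof.
rewrite /real_part Im_sum big1 // => k _; apply: Im0M.
  by apply: Im0M => //; rewrite -rmorphN -rmorphM cexp_real.
apply: Im0D.
  apply: Im_Cint_eq0 => y _; apply: Im0M => //.
  by rewrite -rmorphB Im_exp_kernel_real.
by rewrite cexp_real -rmorphB -!rmorphM.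
Qed.

(** On the slits the radicand is nonpositive, so that the real part of the root
tends to zero from either side, although the root itself jumps. *)
Lemma boundary_slit (x e : R) : ~ (ln a < x < ln b) -> 0 < e ->
  exists2 d : R, 0 < d & forall u, log_domain u -> cmod (u - x%:C%C) < d ->
    - e < Im (continued u).
Proof.
move=> hx e0.
have qx : Im (semi_quad a b (cexp x%:C%C)) = 0 /\ Re (semi_quad a b (cexp x%:C%C)) <= 0.
  rewrite cexp_real /semi_quad -!rmorphB -rmorphM; split; first exact: Im_real.
  rewrite Re_real; have [h|h] := ltP (ln a) x.
    have h2 : ln b <= x by rewrite leNgt; apply/negP => h2; apply: hx; rewrite h.
    have : b <= expR x by rewrite -[leLHS](lnK (_ : b \is Num.pos)) ?posrE // ler_expR.
    move=> h3; rewrite mulr_le0_ge0 ?subr_le0 // subr_ge0.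
    by move: ab; lra.
  have : expR x <= a by rewrite -[leRHS](lnK (_ : a \is Num.pos)) ?posrE // ler_expR.
  move=> h3; rewrite mulr_ge0_le0 ?subr_le0 // subr_ge0.
  by move: ab; lra.
have ix : `|Im (x%:C%C : C)| < pi / r by rewrite Im_real normr0 divr_gt0 // pi_gt0.
have xe := analytic_ccontinuous (exp_sum_analytic x%:C%C).
have xq := analytic_ccontinuous (analytic_quad_log x%:C%C).
have xp := analytic_ccontinuous (real_part_analytic ix).
set Q := semi_quad a b (cexp x%:C%C) in qx.
set N0 := cmod (exp_sum x%:C%C).
have N00 : 0 <= N0 by exact: cmod_ge0.
have Kr : 0 < K / r by rewrite divr_gt0.
(* [B] bounds the root near the point, and [eta] bounds both the real part of
   the root and the imaginary part of the sum of exponentials *)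
pose B := cmod Q + 2.
have B0 : 2 <= B by rewrite /B; have := cmod_ge0 Q; lra.
pose eta := Num.min 1 (e / (4 * (K / r) * (N0 + 1 + B))).
have D0 : 0 < 4 * (K / r) * (N0 + 1 + B) by apply: mulr_gt0; [apply: mulr_gt0|lra].
have eta0 : 0 < eta by rewrite lt_min ltr01 divr_gt0.
have eta1 : eta <= 1 by rewrite ge_min lexx.
have etaE : eta * (4 * (K / r) * (N0 + 1 + B)) <= e.
  by rewrite -ler_pdivlMr // ge_min lexx orbT.
have e20 : 0 < e / 2 by rewrite divr_gt0.
have eta2 : 0 < eta ^+ 2 by rewrite exprn_gt0.
have [d1 d10 H1] := xp _ e20.
have [d2 d20 H2] := xe _ eta0.
have [d3 d30 H3] := xq _ eta2.
exists (Num.min d1 (Num.min d2 d3)); first by rewrite !lt_min d10 d20.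
move=> u hu; rewrite !lt_min => /andP[/H1 g1 /andP[/H2 g2 /H3 g3]].
set S := root_log u; set E := exp_sum u in g2.
have S2 : S ^+ 2 = semi_quad a b (cexp u) by exact: sqr_root_log.
rewrite -S2 -/Q in g3.
have Sr : Re S <= eta.
  rewrite leNgt; apply/negP => h.
  have hs : eta ^+ 2 < Re S ^+ 2 by rewrite ltrXn2r // ?nnegrE ?ltW // (lt_trans eta0).
  have := sqr_Re_root S.
  have c1 := cmod_lerB (S ^+ 2) Q.
  have c2 : Re (S ^+ 2) - Re Q <= cmod (S ^+ 2 - Q).
    rewrite -ReN -ReD; exact: le_trans (ler_norm _) (cmod_Re _).
  have c3 : cmod Q = - Re Q.
    by rewrite cmodE qx.1 expr0n addr0 sqrtr_sqr ler0_norm // qx.2.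
  lra.
have Sr0 : 0 < Re S by exact: root_log_gt0.
have SB : cmod S <= B.
  have h1 : cmod S ^+ 2 <= cmod Q + 1.
    have h2 : eta ^+ 2 <= 1 by rewrite exprn_ile1 // ltW.
    by rewrite -cmodX; have := cmod_lerB (S ^+ 2) Q; lra.
  rewrite leNgt; apply/negP => h.
  have B1 : 0 <= B by lra.
  have : B ^+ 2 < cmod S ^+ 2 by rewrite ltrXn2r // nnegrE cmod_ge0.
  have Q0 := cmod_ge0 Q; have Q2 : 0 <= cmod Q ^+ 2 by rewrite sqr_ge0.
  by move: h1; rewrite (_ : B ^+ 2 = cmod Q ^+ 2 + 4 * cmod Q + 4) /B; [lra|ring].
have EI : `|Im E| <= eta.
  have := cmod_Im (E - exp_sum x%:C%C); rewrite ImD ImN Im_exp_sum_real subr0.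
  by move=> h; apply: le_trans h (ltW _).
have ER : `|Re E| <= N0 + 1.
  apply: le_trans (cmod_Re E) _.
  by have := cmod_lerB E (exp_sum x%:C%C); rewrite -/N0; lra.
have IS : `|Im S| <= B by apply: le_trans (cmod_Im S) SB.
have -> : Im (continued u) = Im (real_part u) - K / r * (Re S * Re E - Im S * Im E).
  by rewrite /continued -/S -/E !ReImE; ring.
have g4 : `|Im (real_part u)| < e / 2.
  have := cmod_Im (real_part u - real_part x%:C%C).
  by rewrite ImD ImN Im_real_part_real subr0; move: g1; lra.
have p1 : `|Re S * Re E| <= eta * (N0 + 1).
  by rewrite normrM ler_pM // gtr0_norm.
have p2 : `|Im S * Im E| <= B * eta by rewrite normrM ler_pM.
have p3 : K / r * (Re S * Re E - Im S * Im E) <= K / r * (eta * (N0 + 1 + B)).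
  rewrite ler_pM2l //; have := ler_norm (Re S * Re E).
  have := ler_norm (- (Im S * Im E)); rewrite normrN; lra.
have := ler_norm (- Im (real_part u)); rewrite normrN.
have : K / r * (eta * (N0 + 1 + B)) <= e / 4 by lra.
lra.
Qed.


Lemma Im_excess u : Im (excess u) =
  - (2 * K / r * \sum_(k < n) alpha k * Re (root_log u * cexp (- (expo k)%:C%C * u))).
Proof.
rewrite /excess ImN (_ : Complex 0 1 * _ * _ * _ =
  Complex 0 1 * ((2 * K / r)%:C%C * (root_log u * exp_sum u))); last by ring.
rewrite ImM !ReImE !mul0r !mul1r subr0 add0r; congr (- (_ * _)).
rewrite -ReM /exp_sum mulr_sumr Re_sum; apply: eq_bigr => k _.
by rewrite mulrCA [LHS]ReM Re_real Im_real mul0r subr0.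
Qed.

Lemma Re_root_scale u k : Re (root_log u * cexp (- (expo k)%:C%C * u)) =
  expR (- expo k * Re u) * Re (root_log u * cexp (Complex 0 (- expo k * Im u))).
Proof.
have -> : - (expo k)%:C%C * u =
    (- expo k * Re u)%:C%C + Complex 0 (- expo k * Im u).
  by apply: complex_eqP; rewrite -rmorphN !ReImE; ring.
by rewrite cexpD cexp_real mulrCA [LHS]ReM Re_real Im_real mul0r subr0.
Qed.

(** Below the cut the square root of [(b - z)(z - a)] does not leave the right
half-plane when it is turned by the argument of [z]. *)
Lemma root_turn u : log_domain u -> Im u < 0 ->
  0 < Re (root_log u * cexp (Complex 0 (- Im u))).
Proof.
move=> hu iu; have S0 := root_log_gt0 hu.
have th1 : - Im u < pi by case: hu => /andP[h _] _; move: opr prp; lra.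
have s0 : 0 < sin (- Im u) by rewrite sin_gt0_pi // th1 oppr_gt0 iu.
set th := - Im u in s0 *.
have cs : cos th ^+ 2 + sin th ^+ 2 = 1 by exact: cos2Dsin2.
have [z1 z2] : Re (cexp u) = expR (Re u) * cos th /\ Im (cexp u) = - (expR (Re u) * sin th).
  by rewrite /cexp ReC ImC /th cosN sinN mulrN opprK.
have rho0 : 0 < expR (Re u) by exact: expR_gt0.
have cE : cexp (Complex 0 th) = Complex (cos th) (sin th).
  by rewrite /cexp !ReImE expR0 !mul1r.
rewrite cE; set S := root_log u in S0 *.
have S2 : S ^+ 2 = (b%:C%C - cexp u) * (cexp u - a%:C%C) by exact: sqr_root_log.
clearbody S; move: (cexp u) z1 z2 S2 => zeta z1 z2 S2.
have X2 := sqr_Re_root S.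
have XY : 2 * Re S * Im S = Im (S ^+ 2) by rewrite expr2 ImM; ring.
move: (expR (Re u)) rho0 z1 z2 => rho rho0 z1 z2.
move: (cos th) (sin th) s0 cs z1 z2 => c s s0 cs z1 z2.
have qR : Re (S ^+ 2) = (b - rho * c) * (rho * c - a) + rho ^+ 2 * s ^+ 2.
  by rewrite S2 !ReImE z1 z2; ring.
have qI : Im (S ^+ 2) = rho * s * (2 * rho * c - a - b).
  by rewrite S2 !ReImE z1 z2; ring.
pose D := a * b + rho ^+ 2 - (a + b) * rho * c.
have QD : D <= cmod (S ^+ 2).
  apply: le_trans (ler_norm _) _.
  rewrite -(@ler_pXn2r _ 2) ?nnegrE ?cmod_ge0 // -normrX ger0_norm ?sqr_ge0 //.
  rewrite cmod_sqr qR qI.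
  suff -> : ((b - rho * c) * (rho * c - a) + rho ^+ 2 * s ^+ 2) ^+ 2 +
     (rho * s * (2 * rho * c - a - b)) ^+ 2 = D ^+ 2 + (rho * s * (b - a)) ^+ 2.
    by rewrite lerDl sqr_ge0.
  have -> : s ^+ 2 = 1 - c ^+ 2 by rewrite -cs; ring.
  by rewrite /D !exprMn (_ : s ^+ 2 = 1 - c ^+ 2); [ring|rewrite -cs; ring].
have QU : cmod (S ^+ 2) <= (b + rho) * (rho + a).
  have zc : cmod zeta = rho.
    apply/eqP; rewrite -(@eqrXn2 _ 2) ?cmod_ge0 ?ltW // cmod_sqr z1 z2.
    by rewrite sqrrN !exprMn -mulrDr cs mulr1.
  rewrite S2 cmodM; apply: ler_pM; rewrite ?cmod_ge0 //.
    by apply: le_trans (cmodD _ _) _; rewrite cmodN zc cmod_real gtr0_norm.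
  by apply: le_trans (cmodD _ _) _; rewrite cmodN zc cmod_real gtr0_norm.
rewrite ReM ReC ImC.
have XE : 2 * Re S * (Re S * c - Im S * s) =
    c * cmod (S ^+ 2) + rho * (a + b) - c * (a * b + rho ^+ 2).
  transitivity (2 * Re S ^+ 2 * c - 2 * Re S * Im S * s); first by ring.
  rewrite X2 XY qR qI; move: (cmod _) => Q.
  transitivity (c * Q + c * ((b - rho * c) * (rho * c - a) + rho ^+ 2 * s ^+ 2)
     - rho * s ^+ 2 * (2 * rho * c - a - b)); first by field.
  by rewrite (_ : s ^+ 2 = 1 - c ^+ 2); [ring|rewrite -cs; ring].
have X0 : 0 < 2 * Re S by rewrite mulr_gt0.
suff : 0 < 2 * Re S * (Re S * c - Im S * s) by rewrite pmulr_rgt0.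
rewrite XE.
have s20 : 0 < s ^+ 2 by rewrite exprn_gt0.
have [c0|c0] := leP 0 c.
  have : c * D <= c * cmod (S ^+ 2) by rewrite ler_wpM2l.
  have : 0 < rho * (a + b) * s ^+ 2 by rewrite !mulr_gt0 // addr_gt0.
  have -> : rho * (a + b) * s ^+ 2 = rho * (a + b) + c * D - c * (a * b + rho ^+ 2).
    by rewrite /D (_ : s ^+ 2 = 1 - c ^+ 2); [ring|rewrite -cs; ring].
  lra.
have c1 : 0 < 1 + c.
  rewrite ltNge; apply/negP => h.
  by have : 1 <= c ^+ 2; [nra|lra].
have : c * ((b + rho) * (rho + a)) <= c * cmod (S ^+ 2) by rewrite ler_wnM2l // ltW.
have : 0 < rho * (a + b) * (1 + c) by rewrite !mulr_gt0 // addr_gt0.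
have -> : rho * (a + b) * (1 + c) =
   rho * (a + b) + c * ((b + rho) * (rho + a)) - c * (a * b + rho ^+ 2) by ring.
lra.
Qed.

(** The turned root has argument at most [pi/2], which leaves for the power of
order [m] an argument at least [pi/2] up to a multiple of the distance to the
lower edge: [pi <= m * opening] and [(m - 1) * opening <= pi]. *)
Lemma root_scale_edge u k : log_domain u -> Im u < 0 ->
  Re (root_log u * cexp (- (expo k)%:C%C * u)) <=
  expR (- expo k * Re u) * (cmod (root_log u) * (expo k * (opening + Im u))).
Proof.
move=> hu iu; rewrite Re_root_scale ler_wpM2l ?expR_ge0 //.
have [hi _] := hu; case/andP: hi => hi _.
have S0 := root_log_gt0 hu; have := root_turn hu iu.
have [w [/andP[w1 w2] wR wI]] := polar_right S0.
have cE y : cexp (Complex 0 y) = Complex (cos y) (sin y) :> C.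
  by rewrite /cexp !ReImE expR0 !mul1r.
have tE y : Re (root_log u * cexp (Complex 0 y)) = cmod (root_log u) * cos (w + y).
  by rewrite cE ReM ReC ImC wR wI cosD; ring.
rewrite !tE => h.
have N0 : 0 < cmod (root_log u).
  by apply: lt_le_trans (cmod_Re _); rewrite normr_gt0 gt_eqF.
rewrite ler_pM2l //; apply: cos_le_gap.
  have := expo_ge1 k => m1; rewrite mulr_ge0 //; first lra.
  lra.
have m1 := expo_ge1 k.
have w3 : w - Im u < pi / 2.
  rewrite ltNge; apply/negP => h2; move: h; rewrite pmulr_rgt0 // ltNge => /negP; apply.
  by apply: cos_le0; rewrite h2 /=; have := pi_ge0 R; move: opr prp; lra.
have e1 := expo_opening k; have e2 := expo_opening1 k.
have e3 : - ((expo k - 1) * Im u) <= (expo k - 1) * opening.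
  by rewrite -mulrN ler_wpM2l; lra.
by apply/andP; split; lra.
Qed.

Lemma cmod_root_log_sqr u : cmod (root_log u) ^+ 2 =
  cmod (b%:C%C - cexp u) * cmod (cexp u - a%:C%C).
Proof. by rewrite -cmodX sqr_root_log /semi_quad cmodM. Qed.

Lemma root_log_bound u : cmod (root_log u) <= b + expR (Re u).
Proof.
have b1 : 0 <= b + expR (Re u) by rewrite addr_ge0 ?expR_ge0 // ltW.
rewrite -(@ler_pXn2r _ 2) ?nnegrE ?cmod_ge0 // cmod_root_log_sqr expr2.
apply: ler_pM; rewrite ?cmod_ge0 //; apply: le_trans (cmodD _ _) _;
  rewrite cmodN cmod_cexp cmod_real gtr0_norm //.
by rewrite addrC lerD2r ltW.
Qed.

Lemma power_coordinate u : cexp (r%:C%C * u) =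
  Complex (expR (r * Re u) * cos (r * Im u)) (expR (r * Re u) * sin (r * Im u)).
Proof. by rewrite /cexp !ReImE !mul0r subr0 addr0. Qed.

Lemma Im_power_lt0 u : - opening < Im u < 0 -> Im (cexp (r%:C%C * u)) < 0.
Proof.
move=> /andP[h1 h2]; rewrite power_coordinate ImC pmulr_rlt0 ?expR_gt0 //.
rewrite -oppr_gt0 -sinN sin_gt0_pi // -mulrN mulr_gt0 ?oppr_gt0 //=.
by rewrite mulrC -ltr_pdivlMr //; move: opr; lra.
Qed.

Lemma Im_continued_lower u : - opening < Im u < 0 -> Im (excess u) <= Im (continued u).
Proof.
move=> hu; rewrite (continued_lower) // ImD lerDr.
by apply: Im_transform_lower; exact: Im_power_lt0.
Qed.

(** Below the cut the transform itself has nonnegative imaginary part, so that only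
the excess matters, and its imaginary part is not less than a negative multiple
of the distance to the edge. *)
Lemma boundary_lower (x e : R) : 0 < e -> exists2 d : R, 0 < d & forall u,
  log_domain u -> cmod (u - Complex x (- opening)) < d -> - e < Im (continued u).
Proof.
move=> e0; pose X := `|x| + 1.
pose B := 2 * K / r * \sum_(k < n) alpha k * (expR (expo k * X) * (b + expR X) * expo k).
have k0 : 0 < 2 * K / r by apply: divr_gt0 => //; apply: mulr_gt0.
have m0 k : 0 < expo k by apply: lt_le_trans (expo_ge1 k).
have B0 : 0 <= B.
  rewrite mulr_ge0 ?(ltW k0) //; apply: sumr_ge0 => k _.
  apply: mulr_ge0; first exact: ltW.
  apply: mulr_ge0; last exact: ltW.
  by apply: mulr_ge0; [exact: expR_ge0|apply: addr_ge0; [exact: ltW|exact: expR_ge0]].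
have B1 : 0 < B + 1 by lra.
exists (Num.min 1 (Num.min opening (e / (B + 1)))).
  by rewrite !lt_min ltr01 op0 /=; exact: divr_gt0.
move=> u hu; rewrite !lt_min => /andP[h1 /andP[h2 h3]].
have uR := cmod_Re (u - Complex x (- opening)).
have uI := cmod_Im (u - Complex x (- opening)).
rewrite ReD ReN ReC in uR; rewrite ImD ImN ImC opprK in uI.
have uX : `|Re u| <= X.
  by rewrite /X -[Re u](subrK x); apply: le_trans (ler_normD _ _) _; lra.
have [/andP[hi _] _] := hu.
have i0 : Im u < 0 by have := ler_norm (Im u + opening); lra.
have gap : Im u + opening < e / (B + 1) by have := ler_norm (Im u + opening); lra.
have gap0 : 0 < Im u + opening by lra.
apply: lt_le_trans (Im_continued_lower _); last by rewrite hi.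
rewrite Im_excess ltrN2; apply: (@le_lt_trans _ _ (B * (Im u + opening))).
  rewrite /B -[leRHS]mulrA; apply: ler_wpM2l; first exact: ltW.
  rewrite mulr_suml; apply: ler_sum => k _.
  rewrite -[leRHS]mulrA; apply: ler_wpM2l; first exact: ltW.
  apply: le_trans (root_scale_edge _ hu i0) _.
  rewrite [opening + _]addrC !mulrA ler_pM2r // ler_pM2r //.
  apply: ler_pM; rewrite ?expR_ge0 ?cmod_ge0 // ?ler_expR.
    rewrite mulNr -mulrN ler_pM2l //; apply: le_trans uX.
    by rewrite -normrN ler_norm.
  apply: le_trans (root_log_bound u) _; rewrite lerD2l ler_expR.
  by apply: le_trans uX; exact: ler_norm.
have : (B + 1) * (Im u + opening) < e by rewrite mulrC -ltr_pdivlMr.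
by lra.
Qed.

Lemma transform_negative_axis (x : R) : x <= 0 -> analytic_at transform x%:C%C.
Proof.
move=> x0; apply: (transform_analytic (d := a `^ r)).
  by rewrite powR_gt0.
move=> y /andP[ay _]; rewrite cmodB -rmorphB cmod_real.
apply: le_trans (ler_norm _); have : a `^ r <= y `^ r.
  by apply: ge0_ler_powR => //; rewrite ?nnegrE ltW // (lt_le_trans a0).
lra.
Qed.

(** The upper edge corresponds to the negative axis, where the transform is real
and continuous. *)
Lemma boundary_upper (x e : R) : 0 < e -> exists2 d : R, 0 < d & forall u,
  log_domain u -> cmod (u - Complex x (pi / r)) < d -> - e < Im (continued u).
Proof.
move=> e0; set u0 := Complex x (pi / r).
have zE : cexp (r%:C%C * u0) = (- expR (r * x))%:C%C.
  rewrite power_coordinate ReC ImC [r * (pi / r)]mulrC divfK ?gt_eqF // cospi sinpi.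
  by apply: complex_eqP; rewrite !ReImE; ring.
have z0 : - expR (r * x) <= 0 by rewrite oppr_le0 expR_ge0.
have [d1 d10 H1] := analytic_ccontinuous (transform_negative_axis z0) e0.
have [d2 d20 H2] := analytic_ccontinuous (analytic_cexp_scale r%:C%C u0) d10.
have p0 : 0 < pi / r by rewrite divr_gt0 // pi_gt0.
exists (Num.min d2 (pi / r)); first by rewrite lt_min d20.
move=> u [/andP[_ hu] _]; rewrite lt_min => /andP[/H2 h1 h2].
have i0 : 0 < Im u.
  have := cmod_Im (u - u0); rewrite ImD ImN ImC.
  by have := ler_norm (- (Im u - pi / r)); rewrite normrN; lra.
rewrite (continued_upper) ?i0 //.
rewrite zE in h1; have := H1 _ h1; set w := transform _ => h3.
have := cmod_Im (w - transform (- expR (r * x))%:C%C).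
rewrite ImD ImN (Im_transform_real) subr0.
by have := ler_norm (- Im w); rewrite normrN; lra.
Qed.


(** * Behaviour at infinity *)

Lemma expR_neg_le (y : R) : y < 0 -> expR y <= (- y)^-1.
Proof.
move=> y0; have h : - y <= expR (- y) by apply: le_trans (expR_ge1Dx _); rewrite lerDr.
by rewrite -[y]opprK expRN opprK lef_pV2 ?posrE ?expR_gt0 // oppr_gt0.
Qed.

Lemma expR_pos_le (y : R) : y <= expR y.
Proof. by apply: le_trans (expR_ge1Dx _); rewrite lerDr. Qed.

Lemma decay_right (e : R) : 0 < e -> exists X : R, forall u,
  X < Re u -> cmod (transform (cexp (r%:C%C * u))) < e.
Proof.
move=> e0; have [M M0 HM] := transform_bound.
exists (Num.max 0 (b `^ r + M / e)) => u; rewrite gt_max => /andP[x0 h].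
have d0 : 0 < Re u - b `^ r by have : 0 < M / e; [exact: divr_gt0|lra].
apply: (@le_lt_trans _ _ (M / (Re u - b `^ r))); last first.
  by rewrite ltr_pdivrMr // mulrC -ltr_pdivrMr //; lra.
apply: HM => // y /andP[ay yb].
apply: le_trans (cmod_lerB _ _).
rewrite cmod_cexp ReM Re_real Im_real mul0r subr0 cmod_real ger0_norm ?powR_ge0 //.
apply: lerB; last first.
  by apply: ge0_ler_powR => //; rewrite ?nnegrE ltW // (lt_le_trans a0).
by apply: le_trans (expR_pos_le _); rewrite ler_peMl // ltW.
Qed.

Lemma power_left u : Re u < 0 -> cmod (cexp (r%:C%C * u)) <= (- Re u)^-1.
Proof.
move=> x0; rewrite cmod_cexp ReM Re_real Im_real mul0r subr0.
apply: le_trans (expR_neg_le _); last by [].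
by rewrite ler_expR -[leRHS]mul1r ler_wnM2r // ltW.
Qed.

(** The point [z = 0] is off the support, and the transform is real there. *)
Lemma decay_left (e : R) : 0 < e -> exists X : R, forall u,
  Re u < X -> - e < Im (transform (cexp (r%:C%C * u))).
Proof.
move=> e0.
have [d d0 H] := analytic_ccontinuous (transform_negative_axis (lexx 0)) e0.
exists (Num.min 0 (- d^-1)) => u; rewrite lt_min => /andP[x0 h].
have : cmod (cexp (r%:C%C * u) - 0%:C%C) < d.
  rewrite subr0; apply: le_lt_trans (power_left x0) _.
  by rewrite -[ltRHS]invrK ltf_pV2 ?posrE ?invr_gt0 ?oppr_gt0 //; lra.
move=> /H; set w := transform (cexp _) => h3.
have := cmod_Im (w - transform 0%:C%C).
rewrite ImD ImN (Im_transform_real) subr0.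
by have := ler_norm (- Im w); rewrite normrN; lra.
Qed.

Lemma bounded_left : exists X B : R, forall u,
  Re u < X -> cmod (transform (cexp (r%:C%C * u))) <= B.
Proof.
have [M M0 HM] := transform_bound.
have ar : 0 < a `^ r by exact: powR_gt0.
exists (- (a `^ r / 2)^-1), (M / (a `^ r / 2)) => u h.
have i0 : 0 < (a `^ r / 2)^-1 by rewrite invr_gt0 divr_gt0.
have x0 : Re u < 0 by lra.
apply: HM => [|y /andP[ay yb]]; first by rewrite divr_gt0.
rewrite cmodB; apply: le_trans (cmod_lerB _ _).
rewrite cmod_real ger0_norm ?powR_ge0 //.
have h1 : a `^ r <= y `^ r.
  by apply: ge0_ler_powR => //; rewrite ?nnegrE ltW // (lt_le_trans a0).
have h2 := power_left x0.
have : (- Re u)^-1 <= a `^ r / 2.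
  by rewrite -[leRHS]invrK lef_pV2 ?posrE ?oppr_gt0 //; lra.
lra.
Qed.

(** Divided by [z], the root tends to [i] at infinity from the first quadrant,
so its rotations by angles between [0] and [pi] have a small positive real part
at most. *)
Lemma root_scale_right u k : log_domain u -> Im u < 0 -> 0 <= Re u -> b <= expR (Re u) ->
  Re (root_log u * cexp (- (expo k)%:C%C * u)) <= Num.sqrt (3 * b / expR (Re u)).
Proof.
move=> hu iu x0 hb; have T0 := root_turn hu iu.
have m1 := expo_ge1 k.
have th1 : - Im u < pi by case: hu => /andP[h _] _; move: opr prp; lra.
have mth : 0 <= (expo k - 1) * - Im u <= pi.
  have [/andP[h _] _] := hu; apply/andP; split; first by rewrite mulr_ge0 //; lra.
  apply: le_trans (expo_opening1 k); rewrite ler_wpM2l //; lra.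
have s0 : 0 < sin (- Im u) by rewrite sin_gt0_pi // th1 oppr_gt0 iu.
have sm : 0 <= sin ((expo k - 1) * - Im u) by rewrite sin_ge0_pi.
have cm : cos ((expo k - 1) * - Im u) <= 1 by exact: cos_le1.
rewrite Re_root_scale.
have -> : Complex 0 (- expo k * Im u) = Complex 0 (- Im u) +
    Complex 0 ((expo k - 1) * - Im u) :> C.
  by apply: complex_eqP; rewrite !ReImE; ring.
rewrite cexpD mulrA; set T := root_log u * _ in T0 *.
have cE (y : R) : cexp (Complex 0 y) = Complex (cos y) (sin y) :> C.
  by rewrite /cexp !ReImE expR0 !mul1r.
have [rho0 cs] := (expR_gt0 (Re u), cos2Dsin2 (- Im u)).
have T2 : T ^+ 2 = (b%:C%C * cexp (Complex 0 (- Im u)) - (expR (Re u))%:C%C) *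
    ((expR (Re u))%:C%C - a%:C%C * cexp (Complex 0 (- Im u))).
  rewrite exprMn sqr_root_log /semi_quad.
  have -> : (expR (Re u))%:C%C = cexp u * cexp (Complex 0 (- Im u)).
    rewrite -cexpD -cexp_real; congr cexp.
    by apply: complex_eqP; rewrite !ReImE ?addr0 ?subrr.
  by ring.
have TQ : cmod (T ^+ 2) <= (b + expR (Re u)) ^+ 2.
  have e1 : cmod (cexp (Complex 0 (- Im u) : C)) = 1 by rewrite cmod_cexp expR0.
  rewrite T2 cmodM expr2; apply: ler_pM; rewrite ?cmod_ge0 //;
    apply: le_trans (cmodD _ _) _; rewrite cmodN !cmodM e1 mulr1 !cmod_real
      !gtr0_norm //.
  by rewrite addrC lerD2r ltW.
rewrite cE in T2; rewrite cE ReM ReC ImC.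
have XY : 2 * Re T * Im T = Im (T ^+ 2) by rewrite expr2 ImM; ring.
have X2 := sqr_Re_root T.
clearbody T.
have -> : - expo k * Re u = - (expo k * Re u) by rewrite mulNr.
have rm : expR (- (expo k * Re u)) <= (expR (Re u))^-1.
  by rewrite -expRN ler_expR lerN2 ler_peMl.
have rm0 := expR_ge0 (- (expo k * Re u)).
move: (expR (- (expo k * _))) rm rm0 => pm rm rm0.
move: (cos (- Im u)) (sin (- Im u)) s0 cs T2 => c s s0 cs T2.
move: (cos _) (sin _) sm cm => cc ss sm cm.
move: (expR (Re u)) hb rho0 TQ T2 rm => rho hb rho0 TQ T2 rm.
have ba : 0 < b * (b - a) by apply: mulr_gt0; rewrite ?subr_gt0.
have c1 : c <= 1 by rewrite leNgt; apply/negP => h; nra.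
have cN1 : -1 <= c by rewrite leNgt; apply/negP => h; nra.
have IT : 0 < Im T.
  rewrite -(pmulr_rgt0 _ (_ : 0 < 2 * Re T)); last by rewrite mulr_gt0.
  rewrite XY T2 !ReImE.
  suff : 0 < s * ((a + b) * rho - 2 * (a * b) * c) by lra.
  have h1 : a * b * c <= a * b by apply: ler_piMr => //; rewrite mulr_ge0 // ltW.
  have h2 : (a + b) * b <= (a + b) * rho by apply: ler_wpM2l => //; rewrite addr_ge0 // ltW.
  by apply: mulr_gt0 => //; lra.
have RT : Re T ^+ 2 <= 3 * b * rho.
  have h : Re (T ^+ 2) <= - rho ^+ 2 + 2 * b * rho + b ^+ 2.
    rewrite T2 !ReImE.
    have h1 : rho * (a + b) * c <= rho * (2 * b).
      apply: (@le_trans _ _ (rho * (a + b))).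
        by apply: ler_piMr => //; rewrite mulr_ge0 ?addr_ge0 // ltW.
      by rewrite ler_pM2l //; move: ab; lra.
    have h2 : a * b * (s ^+ 2 - c ^+ 2) <= b ^+ 2.
      apply: (@le_trans _ _ (a * b)).
        apply: ler_piMr; first by rewrite mulr_ge0 // ltW.
        by have := sqr_ge0 c; lra.
      by rewrite expr2 ler_pM2r // ltW.
    lra.
  have h1 : b ^+ 2 <= b * rho by rewrite expr2 ler_pM2l.
  by rewrite X2; lra.
have P1 : Re T * cc - Im T * ss <= Re T.
  have : 0 <= Im T * ss by rewrite mulr_ge0 // ltW.
  have : Re T * cc <= Re T by apply: ler_piMr => //; exact: ltW.
  lra.
apply: (@le_trans _ _ (rho^-1 * Re T)).
  apply: (@le_trans _ _ (pm * Re T)); first by rewrite ler_wpM2l.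
  by rewrite ler_pM2r.
rewrite -[leLHS](gtr0_norm (_ : 0 < rho^-1 * Re T)) ?mulr_gt0 ?invr_gt0 //.
rewrite -sqrtr_sqr ler_wsqrtr // exprMn.
apply: (@le_trans _ _ (rho^-1 ^+ 2 * (3 * b * rho))).
  by rewrite ler_wpM2l // sqr_ge0.
have -> : rho^-1 ^+ 2 * (3 * b * rho) = 3 * b / rho by field; rewrite gt_eqF.
by [].
Qed.

Lemma excess_right (e : R) : 0 < e -> exists X : R, forall u, log_domain u ->
  Im u < 0 -> X < Re u -> - e < Im (excess u).
Proof.
move=> e0; pose A := 2 * K / r * \sum_(k < n) alpha k.
have k0 : 0 < 2 * K / r by apply: divr_gt0 => //; apply: mulr_gt0.
have A0 : 0 <= A.
  by apply: mulr_ge0; [exact: ltW|apply: sumr_ge0 => k _; exact: ltW].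
have A1 : 0 < A + 1 by lra.
pose f := e / (A + 1); have f0 : 0 < f by exact: divr_gt0.
have f2 : 0 < f ^+ 2 by exact: exprn_gt0.
exists (Num.max b (3 * b / f ^+ 2)) => u hu iu; rewrite gt_max => /andP[h1 h2].
have x0 : 0 <= Re u by move: b0; lra.
have hb : b <= expR (Re u) by apply: le_trans (ltW h1) (expR_pos_le _).
set s := Num.sqrt (3 * b / expR (Re u)).
have sf : s < f.
  rewrite -[ltRHS](gtr0_norm f0) -sqrtr_sqr ltr_sqrt // ltr_pdivrMr ?expR_gt0 //.
  have : 3 * b / f ^+ 2 < expR (Re u) by apply: lt_le_trans h2 (expR_pos_le _).
  by rewrite ltr_pdivrMr // [expR _ * _]mulrC.
have s0 : 0 <= s by exact: sqrtr_ge0.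
rewrite Im_excess ltrN2; apply: (@le_lt_trans _ _ (A * s)).
  rewrite /A -[leRHS]mulrA; apply: ler_wpM2l; first exact: ltW.
  rewrite mulr_suml; apply: ler_sum => k _; apply: ler_wpM2l; first exact: ltW.
  exact: root_scale_right.
apply: (@le_lt_trans _ _ (A * f)); first by rewrite ler_wpM2l // ltW.
rewrite /f mulrA ltr_pdivrMr // mulrC; lra.
Qed.

Context (top : 'I_n) (topP : forall k, k != top -> l k < l top).

(** The largest exponent dominates far to the left. *)
Lemma dominant_term : exists2 D : R, 0 <= D & forall u, Re u < 0 ->
  cmod (exp_sum u * cexp ((expo top)%:C%C * u) - (alpha top)%:C%C) <= D / (- Re u).
Proof.
exists (\sum_(k < n | k != top) alpha k / (l top - l k)).
  by apply: sumr_ge0 => k /topP h; apply: divr_ge0; rewrite ?subr_ge0; exact: ltW.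
move=> u x0; rewrite /exp_sum mulr_suml (bigD1 top) //=.
have -> : (alpha top)%:C%C * cexp (- (expo top)%:C%C * u) * cexp ((expo top)%:C%C * u) =
    (alpha top)%:C%C.
  by rewrite -mulrA -cexpD -mulrDl addNr mul0r cexp0 mulr1.
rewrite addrAC subrr add0r big_mkcond /= [X in X / _]big_mkcond /= mulr_suml.
apply: le_trans (cmod_sum _ _) _; apply: ler_sum => k _.
case: ifPn => [/topP h|_]; last by rewrite cmod0 mul0r.
rewrite -mulrA -cexpD !cmodM cmod_real gtr0_norm // -[leRHS]mulrA.
apply: ler_wpM2l; first exact: ltW.
have -> : - (expo k)%:C%C * u + (expo top)%:C%C * u = (l top - l k)%:C%C * u.
  by rewrite -mulrDl -rmorphN -rmorphD /expo; congr (_%:C%C * _); ring.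
rewrite cmod_cexp ReM Re_real Im_real mul0r subr0 -invfM mulrN.
by apply: expR_neg_le; rewrite pmulr_rlt0 ?subr_gt0.
Qed.

Lemma excess_left (B : R) : exists X : R, forall u, Re u < X ->
  B < cmod (excess u).
Proof.
have [D D0 HD] := dominant_term; have al := alpha0 top.
have k0 : 0 < 2 * K / r by apply: divr_gt0 => //; apply: mulr_gt0.
pose s := 2 * K / r * (a / 2) * (alpha top / 2).
have s0 : 0 < s by rewrite /s; apply: mulr_gt0; [apply: mulr_gt0 => //|]; exact: divr_gt0.
exists (Num.min (- (2 * D / alpha top + 2 / a)) (- `|B| / s)) => u.
rewrite lt_min => /andP[h1 h2].
have p1 : 0 <= 2 * D / alpha top by rewrite divr_ge0 ?mulr_ge0 // ltW.
have p2 : 0 < 2 / a by rewrite divr_gt0.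
have x0 : Re u < 0 by lra.
have E1 : alpha top / 2 <= cmod (exp_sum u * cexp ((expo top)%:C%C * u)).
  have := cmod_lerB (alpha top)%:C%C (exp_sum u * cexp ((expo top)%:C%C * u)).
  rewrite cmodB cmod_real gtr0_norm //; have := HD u x0.
  have : D / (- Re u) <= alpha top / 2.
    rewrite ler_pdivrMr ?oppr_gt0 //.
    have : 2 * D <= (- Re u) * alpha top by rewrite -ler_pdivrMr //; lra.
    lra.
  lra.
have E2 : - Re u * (alpha top / 2) <= cmod (exp_sum u).
  rewrite cmodM cmod_cexp ReM Re_real Im_real mul0r subr0 in E1.
  have m1 := expo_ge1 top.
  have m0 : expo top * Re u <= Re u by rewrite -[leRHS]mul1r ler_wnM2r // ltW.
  have : expR (expo top * Re u) <= (- Re u)^-1.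
    by apply: le_trans (expR_neg_le x0); rewrite ler_expR.
  have c0 := cmod_ge0 (exp_sum u) => h3.
  have : alpha top / 2 <= cmod (exp_sum u) * (- Re u)^-1.
    by apply: le_trans E1 _; rewrite ler_wpM2l.
  by rewrite ler_pdivlMr ?oppr_gt0 // mulrC.
have zx : cmod (cexp u) <= a / 2.
  rewrite cmod_cexp; apply: le_trans (expR_neg_le x0) _.
  rewrite -[leRHS]invrK lef_pV2 ?posrE ?oppr_gt0 ?invr_gt0 ?divr_gt0 //.
  by rewrite invf_div; lra.
have S1 : a / 2 <= cmod (root_log u).
  have a2 : 0 < a / 2 by rewrite divr_gt0.
  rewrite -(@ler_pXn2r _ 2) ?nnegrE ?cmod_ge0 ?(ltW a2) // cmod_root_log_sqr expr2.
  apply: ler_pM; rewrite ?(ltW a2) //.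
    have := cmod_lerB b%:C%C (cexp u); rewrite cmod_real gtr0_norm //.
    by move: ab; lra.
  rewrite cmodB.
  have := cmod_lerB a%:C%C (cexp u); rewrite cmod_real gtr0_norm //.
  by lra.
apply: (@lt_le_trans _ _ (s * - Re u)).
  rewrite mulrC; apply: le_lt_trans (ler_norm B) _.
  by rewrite -ltr_pdivrMr // ltrNr -mulNr.
rewrite /excess cmodN !cmodM cmod_real gtr0_norm //.
have -> : cmod (Complex 0 1 : C) = 1 by rewrite cmodE ReC ImC expr0n add0r expr1n sqrtr1.
rewrite mul1r.
have -> : s * - Re u = 2 * K / r * ((a / 2) * (- Re u * (alpha top / 2))).
  by rewrite /s; ring.
rewrite -[leRHS]mulrA; apply: ler_wpM2l; first exact: ltW.
apply: ler_pM => //; first by rewrite divr_ge0 // ltW.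
by apply: mulr_ge0; [rewrite oppr_ge0 ltW|apply: divr_ge0 => //; exact: ltW].
Qed.

(** Only in the far left of the lower half of the domain may the imaginary part
of the continued transform be very negative. *)
Lemma continued_tail (e L : R) : 0 < e -> exists X : R, forall u, log_domain u ->
  X < cmod u -> L <= Re u \/ 0 <= Im u -> - e < Im (continued u).
Proof.
move=> e0.
have [X1 H1] := decay_right e0; have [X2 H2] := decay_left e0.
have [X3 H3] := excess_right e0.
have [X [hX1 hX2 hX3 [hL ha hb]]] : exists X : R,
    [/\ X1 <= X, - X <= X2, X3 <= X & [/\ - X <= L, - X <= ln a & ln b <= X]].
  exists (`|X1| + `|X2| + `|X3| + `|L| + `|ln a| + `|ln b|).
  have := (ler_norm X1, ler_norm (- X2), ler_norm X3).
  have := (ler_norm (- L), ler_norm (- ln a), ler_norm (ln b)).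
  rewrite !normrN => -[[n4 n5] n6] [[n1 n2] n3].
  have := (normr_ge0 X1, normr_ge0 X2, normr_ge0 X3).
  have := (normr_ge0 L, normr_ge0 (ln a), normr_ge0 (ln b)).
  by move=> -[[m4 m5] m6] [[m1 m2] m3]; split; [lra..|split; lra].
exists (X + pi) => u hu hL' hR.
have [/andP[i1 i2] i3] := hu.
have iu := log_domain_bounds hu.
have XR : X < `|Re u| by have := cmod_le u; move: prp; lra.
have [iu0|iu0|iu0] := ltgtP (Im u) 0.
- have RL : L <= Re u by case: hR => // h; move: (le_lt_trans h iu0); rewrite ltxx.
  have [x0|x0] := leP 0 (Re u); last by rewrite (ltr0_norm x0) in XR; lra.
  rewrite (ger0_norm x0) in XR.
  have ii : - opening < Im u < 0 by rewrite i1.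
  have h6 : X3 < Re u by exact: le_lt_trans XR.
  exact: lt_le_trans (H3 _ hu iu0 h6) (Im_continued_lower ii).
- rewrite (continued_upper) ?iu0 //.
  have [x0|x0] := leP 0 (Re u).
    rewrite (ger0_norm x0) in XR.
    have : cmod (transform (cexp (r%:C%C * u))) < e by apply: H1; exact: le_lt_trans XR.
    set p := transform _ => h.
    have := cmod_Im p; have := ler_norm (- Im p); rewrite normrN.
    by lra.
  by rewrite (ltr0_norm x0) in XR; apply: H2; lra.
have /andP[j1 j2] := i3 iu0.
have [x0|x0] := leP 0 (Re u); [rewrite (ger0_norm x0) in XR|rewrite (ltr0_norm x0) in XR].
  by have := lt_trans j2 (le_lt_trans hb XR); rewrite ltxx.
by have : Re u < ln a; [lra|move=> /(lt_trans j1); rewrite ltxx].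
Qed.

(** In the only part of the domain where the imaginary part of the values is not
asymptotically nonnegative, the values escape to infinity. *)
Lemma continued_lower_proper : lower_proper opening log_domain continued.
Proof.
split.
- exact: log_domain_open.
- by move=> u; exact: continued_analytic.
- by move=> u [/andP[]].
- move=> u0 hu0 e e0.
  have far (d : R) : 0 < d -> (forall u, log_domain u -> d <= cmod (u - u0)) ->
      exists2 d : R, 0 < d & forall u, log_domain u -> cmod (u - u0) < d ->
        - e < Im (continued u).
    by move=> d0 h; exists d => // u /h; rewrite leNgt => /negP.
  have im u : `|Im u - Im u0| <= cmod (u - u0).
    by have := cmod_Im (u - u0); rewrite ImD ImN.
  have uE : u0 = Complex (Re u0) (Im u0) by case: u0 {hu0 far im}.
  have [h1|h1|h1] := ltgtP (Im u0) (- opening).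
  + apply: (far (- opening - Im u0)) => [|u [/andP[h _] _]]; first by rewrite subr_gt0.
    by have := im u; have := ler_norm (Im u - Im u0); lra.
  + have [h2|h2|h2] := ltgtP (Im u0) (pi / r).
    * have i0 : Im u0 = 0.
        apply/eqP/negPn/negP => /eqP i0; apply: hu0; split; first by rewrite h1.
        by move=> /i0.
      have u0E : u0 = (Re u0)%:C%C by rewrite uE i0.
      rewrite u0E; apply: (boundary_slit) => // h.
      by apply: hu0; split; rewrite ?h1 ?h2.
    * apply: (far (Im u0 - pi / r)) => [|u [/andP[_ h] _]]; first by rewrite subr_gt0.
      by have := im u; have := ler_norm (- (Im u - Im u0)); rewrite normrN; lra.
    * by rewrite uE h2; exact: boundary_upper.
  + by rewrite uE h1; exact: (boundary_lower).
move=> e e0.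
have [X4 [B H4]] := bounded_left.
have [X5 H5] := excess_left (e^-1 + B).
have [X HX] := continued_tail (Num.min X4 X5) e0.
exists X => u hu hX; have [h|h] := leP (Num.min X4 X5) (Re u).
  by left; apply: HX => //; left.
have [iu|iu] := leP 0 (Im u); first by left; apply: HX => //; right.
right; move: h; rewrite lt_min => /andP[x4 x5].
have [/andP[i1 _] _] := hu.
rewrite (continued_lower) ?i1 //.
have h4 := H4 u x4; have h5 := H5 u x5; move: h4 h5.
set p := transform _; set q := excess u => h4 h5.
by have := cmod_lerB q (- p); rewrite opprK cmodN [q + p]addrC; lra.
Qed.


(** * A value attained exactly once *)

Local Notation m := (expo top).

Let k0 : 0 < 2 * K / r. Proof. by apply: divr_gt0 => //; exact: mulr_gt0. Qed.
Let top_ge1 : 1 <= m := expo_ge1 top.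

Definition leading : R := 2 * K / r * Num.sqrt (a * b) * alpha top.

(** In the far left of the lower half of the domain the continued transform is
[- leading * e^(- m u)] up to a relative error. *)
Definition relative_error (u : C) : C :=
  - (leading^-1%:C%C * continued u * cexp (m%:C%C * u)) - 1.

Lemma sqrt_ab_gt0 : 0 < Num.sqrt (a * b).
Proof. by rewrite sqrtr_gt0 mulr_gt0. Qed.

Lemma leading_gt0 : 0 < leading.
Proof. by rewrite /leading; apply: mulr_gt0 => //; apply: mulr_gt0 => //; exact: sqrt_ab_gt0. Qed.

Lemma continued_leading u :
  continued u = - (leading%:C%C * cexp (- m%:C%C * u) * (1 + relative_error u)).
Proof.
rewrite /relative_error [1 + _]addrC subrK mulrN opprK.
have Lc : leading%:C%C != 0 :> C by rewrite -cmod_gt0 cmod_real gtr0_norm leading_gt0.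
have -> : cexp (- m%:C%C * u) = (cexp (m%:C%C * u))^-1 by rewrite -cexpN mulNr.
rewrite fmorphV /=; have := cexp_neq0 (m%:C%C * u).
by move: (cexp _) (leading%:C%C : C) Lc => X Y Y0 X0; field; rewrite X0 Y0.
Qed.

Lemma relative_error_analytic u : log_domain u -> analytic_at relative_error u.
Proof.
move=> hu; apply: analyticB; last exact: analytic_cst.
apply: analyticN; apply: analyticM; last exact: analytic_cexp_scale.
by apply: analyticM; [exact: analytic_cst|exact: (continued_analytic hu)].
Qed.

(** Near the origin the square of [i] times the root of [(b - z)(z - a)] is close
to [ab], and below the cut its real part is positive. *)
Lemma root_left u : log_domain u -> Im u < 0 -> 2 * expR (Re u) < a + b ->
  cmod (Complex 0 1 * root_log u - (Num.sqrt (a * b))%:C%C) * Num.sqrt (a * b) <=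
  expR (Re u) * (expR (Re u) + (a + b)).
Proof.
move=> hu iu hx; set s := Num.sqrt (a * b).
have s0 : 0 < s by exact: sqrt_ab_gt0.
have S0 := root_log_gt0 hu.
have th1 : - Im u < pi by case: hu => /andP[h _] _; move: opr prp; lra.
have sn : 0 < sin (- Im u) by rewrite sin_gt0_pi // th1 oppr_gt0 iu.
have cn : cos (Im u) <= 1 by exact: cos_le1.
have e0 := expR_gt0 (Re u).
have zE : Re (cexp u) = expR (Re u) * cos (Im u) /\
    Im (cexp u) = - (expR (Re u) * sin (- Im u)).
  by rewrite /cexp ReC ImC sinN mulrN opprK.
have S2 : root_log u ^+ 2 = (b%:C%C - cexp u) * (cexp u - a%:C%C).
  exact: sqr_root_log.
have cz : cmod (cexp u) = expR (Re u) by exact: cmod_cexp.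
move: (root_log u) S0 S2 => S S0 S2.
move: (cexp u) zE cz S2 => z [zR zI] cz S2.
have XY : 2 * Re S * Im S = Im (S ^+ 2) by rewrite expr2 ImM; ring.
have IS : Im S < 0.
  rewrite -(pmulr_rlt0 _ (_ : 0 < 2 * Re S)); last by rewrite mulr_gt0.
  rewrite XY S2 !ReImE zR zI.
  have h1 : 0 < expR (Re u) * sin (- Im u) * ((a + b) - 2 * (expR (Re u) * cos (Im u))).
    apply: mulr_gt0; first exact: mulr_gt0.
    have : expR (Re u) * cos (Im u) <= expR (Re u) by rewrite ler_piMr // ltW.
    by lra.
  by lra.
have prod : (Complex 0 1 * S - s%:C%C) * (Complex 0 1 * S + s%:C%C) =
    z * (z - (a + b)%:C%C).
  transitivity ((Complex 0 1) ^+ 2 * S ^+ 2 - (s ^+ 2)%:C%C).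
    by rewrite rmorphXn /=; ring.
  have -> : (Complex 0 1 : C) ^+ 2 = - 1.
    by apply: complex_eqP; rewrite expr2 !ReImE /=; ring.
  by rewrite sqr_sqrtr ?S2 ?rmorphM ?rmorphD /=; [ring|rewrite mulr_ge0 // ltW].
have ge : s <= cmod (Complex 0 1 * S + s%:C%C).
  apply: le_trans (cmod_Re _); apply: le_trans (ler_norm _).
  by rewrite !ReImE; lra.
apply: (@le_trans _ _ (cmod (z * (z - (a + b)%:C%C)))).
  by rewrite -prod [leRHS]cmodM ler_wpM2l ?cmod_ge0.
rewrite cmodM cz ler_wpM2l ?(ltW e0) //; apply: le_trans (cmodD _ _) _.
by rewrite cmodN cz cmod_real gtr0_norm // addr_gt0.
Qed.

Lemma relative_error_small (eta : R) : 0 < eta -> eta <= 1 ->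
  exists X : R, forall u, log_domain u -> Im u < 0 -> Re u < X ->
    cmod (relative_error u) <= eta.
Proof.
move=> eta0 eta1; have s0 := sqrt_ab_gt0; have L0 := leading_gt0.
have [D D0 HD] := dominant_term.
have [X [B HB]] := bounded_left.
pose Y := D / alpha top + (1 + (a + b)) / (a * b) + `|B| / leading.
have al := alpha0 top.
have y1 : 0 <= D / alpha top by rewrite divr_ge0 // ltW.
have y2 : 0 <= (1 + (a + b)) / (a * b).
  by rewrite divr_ge0 ?mulr_ge0 ?addr_ge0 // ltW.
have y3 : 0 <= `|B| / leading by rewrite divr_ge0 // ltW.
pose c := Num.min 1 (Num.min ((a + b) / 3) (eta / (4 * (Y + 1)))).
have c0 : 0 < c.
  rewrite !lt_min ltr01 /=; apply/andP; split; first by rewrite divr_gt0 // addr_gt0.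
  by rewrite divr_gt0 // mulr_gt0 // /Y; lra.
exists (Num.min X (- c^-1)) => u hu iu; rewrite lt_min => /andP[xX xc].
have ci : 0 < c^-1 by rewrite invr_gt0.
have x0 : Re u < 0 by lra.
pose y := (- Re u)^-1.
have yc : y < c by rewrite -[ltRHS]invrK ltf_pV2 ?posrE ?oppr_gt0 //; lra.
have y0 : 0 < y by rewrite invr_gt0 oppr_gt0.
move: (yc); rewrite !lt_min => /andP[c1 /andP[c2 c3]].
have Y1 : 0 < 4 * (Y + 1) by rewrite mulr_gt0 // /Y; lra.
rewrite ltr_pdivlMr // in c3.
have rho : expR (Re u) <= y by exact: expR_neg_le.
have rho0 := expR_gt0 (Re u).
have q1 : cmod (Complex 0 1 * root_log u / (Num.sqrt (a * b))%:C%C - 1) <= eta / 4.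
  have sc : (Num.sqrt (a * b))%:C%C != 0 :> C.
    by rewrite -cmod_gt0 cmod_real gtr0_norm.
  have -> : Complex 0 1 * root_log u / (Num.sqrt (a * b))%:C%C - 1 =
     (Complex 0 1 * root_log u - (Num.sqrt (a * b))%:C%C) / (Num.sqrt (a * b))%:C%C.
    by rewrite mulrBl divff.
  rewrite cmodM cmodV cmod_real gtr0_norm // ler_pdivrMr //.
  have := @root_left u hu iu; move=> /(_ _); set E := cmod _ => hE.
  have h1 : E * Num.sqrt (a * b) <= y * (1 + (a + b)).
    apply: le_trans (hE _) _; first by lra.
    apply: ler_pM; rewrite ?(ltW rho0) //; last by lra.
    by rewrite !addr_ge0 // ltW.
  have h2 : y * (1 + (a + b)) <= eta / 4 * (a * b).
    rewrite -ler_pdivrMr ?mulr_gt0 // -mulrA.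
    have : y * ((1 + (a + b)) / (a * b)) <= y * Y by rewrite ler_wpM2l ?(ltW y0) // /Y; lra.
    by lra.
  rewrite -(ler_pM2r s0); apply: (le_trans h1); apply: (le_trans h2).
  by rewrite -[leRHS]mulrA -expr2 sqr_sqrtr // mulr_ge0 // ltW.
have q2 : cmod (exp_sum u * cexp (m%:C%C * u) / (alpha top)%:C%C - 1) <= eta / 4.
  have ac : (alpha top)%:C%C != 0 :> C by rewrite -cmod_gt0 cmod_real gtr0_norm.
  have -> : exp_sum u * cexp (m%:C%C * u) / (alpha top)%:C%C - 1 =
     (exp_sum u * cexp (m%:C%C * u) - (alpha top)%:C%C) / (alpha top)%:C%C.
    by rewrite mulrBl divff.
  rewrite cmodM cmodV cmod_real gtr0_norm // ler_pdivrMr //.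
  apply: le_trans (HD _ x0) _; rewrite -/y -ler_pdivrMr // mulrAC.
  have : D / alpha top * y <= Y * y by rewrite ler_wpM2r ?(ltW y0) // /Y; lra.
  by lra.
have q3 : cmod (leading^-1%:C%C * transform (cexp (r%:C%C * u)) * cexp (m%:C%C * u))
    <= eta / 4.
  rewrite !cmodM cmod_cexp ReM Re_real Im_real mul0r subr0 cmod_real gtr0_norm ?invr_gt0 //.
  have h1 : expR (m * Re u) <= y.
    by apply: le_trans rho; rewrite ler_expR -[leRHS]mul1r ler_wnM2r // ltW.
  have h2 : cmod (transform (cexp (r%:C%C * u))) <= `|B|.
    by apply: le_trans (HB _ xX) (ler_norm _).
  have h3 : leading^-1 * cmod (transform (cexp (r%:C%C * u))) * expR (m * Re u) <=
      leading^-1 * `|B| * y.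
    apply: ler_pM; rewrite ?mulr_ge0 ?cmod_ge0 ?expR_ge0 ?invr_ge0 ?(ltW L0) //.
    by rewrite ler_wpM2l // invr_ge0 ltW.
  apply: (le_trans h3); rewrite [leading^-1 * _]mulrC.
  have : `|B| / leading * y <= Y * y by rewrite ler_wpM2r ?(ltW y0) // /Y; lra.
  by lra.
set A1 := Complex 0 1 * root_log u / _ in q1.
set A2 := exp_sum u * _ / _ in q2.
set A3 := leading^-1%:C%C * _ * _ in q3.
have -> : relative_error u = (A1 - 1) * (A2 - 1) + (A1 - 1) + (A2 - 1) - A3.
  have [/andP[i1 _] _] := hu.
  rewrite /relative_error (continued_lower) ?i1 // /excess.
  rewrite /A1 /A2 /A3 [(2 * K / r)%:C%C]lock.
  have -> : leading^-1%:C%C = ((locked (2 * K / r)%:C%C) * (Num.sqrt (a * b))%:C%C *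
      (alpha top)%:C%C)^-1 :> C.
    by rewrite -lock fmorphV /leading [X in X^-1]rmorphM /= [X in X * _]rmorphM.
  have Kc : locked (2 * K / r)%:C%C != 0 :> C.
    by rewrite -lock -cmod_gt0 cmod_real gtr0_norm.
  have sc : (Num.sqrt (a * b))%:C%C != 0 :> C by rewrite -cmod_gt0 cmod_real gtr0_norm.
  have ac : (alpha top)%:C%C != 0 :> C by rewrite -cmod_gt0 cmod_real gtr0_norm.
  by field; rewrite Kc sc ac.
have [p1 p2] : cmod ((A1 - 1) * (A2 - 1)) <= eta / 4 /\ True.
  split=> //; rewrite cmodM; apply: (@le_trans _ _ (eta / 4 * 1)); last by rewrite mulr1.
  by apply: ler_pM; rewrite ?cmod_ge0 //; lra.
apply: le_trans (cmodD _ _) _; rewrite cmodN.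
have := cmodD ((A1 - 1) * (A2 - 1) + (A1 - 1)) (A2 - 1).
have := cmodD ((A1 - 1) * (A2 - 1)) (A1 - 1).
by lra.
Qed.

Lemma continued_bounded_below (L : R) : exists B : R, forall u, log_domain u ->
  L <= Re u \/ 0 <= Im u -> - B < Im (continued u).
Proof.
have LP := continued_lower_proper.
have [X HX] := continued_tail L (ltr01 : 0 < 1 :> R).
have [B HB] := lower_proper_bounded_disc X LP.
exists (Num.max 1 B) => u hu hL; have [h|h] := leP (cmod u) X.
  by apply: le_lt_trans (HB u hu h); rewrite lerN2 le_max lexx orbT.
by apply: le_lt_trans (HX u hu h hL); rewrite lerN2 le_max lexx.
Qed.

Let mop : pi <= m * opening <= 2 * pi.
Proof.
rewrite expo_opening //=; have := expo_opening1 top.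
by move: opr prp; lra.
Qed.

(** Far to the left, on the line where the leading term is a negative multiple
of [i], the value of the continued transform is attained only once, and is not
critical: values so low come from the region where the leading term dominates,
and there the relative error varies too little to compensate for the variation
of the exponential. *)
Lemma start_point : exists u0, [/\ log_domain u0, Im (continued u0) < 0,
  forall v, log_domain v -> continued v = continued u0 -> v = u0 &
  exists k d : R, [/\ 0 < k, 0 < d & forall v, cmod (v - u0) < d ->
     k * cmod (v - u0) <= cmod (continued v - continued u0)]].
Proof.
have L0 := leading_gt0; have m0 : 0 < m by exact: lt_le_trans top_ge1.
have eta0 : 0 < 128^-1 :> R by rewrite invr_gt0.
have eta1 : 128^-1 <= 1 :> R by lra.
have [X HX] := relative_error_small eta0 eta1.
have [B HB] := continued_bounded_below (X - 1).
pose N := Num.max (2 - X) (2 * `|B| / leading + 1).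
pose u0 : C := Complex (- N) (- (pi / 2 / m)).
have N1 : 2 - X <= N by rewrite le_max lexx.
have N2 : 2 * `|B| / leading + 1 <= N by rewrite le_max lexx orbT.
have B0 : 0 <= 2 * `|B| / leading.
  by apply: divr_ge0; [rewrite mulr_ge0|exact: ltW].
have N0 : 0 <= N by apply: le_trans N2; exact: addr_ge0.
move: N N0 N1 N2 @u0 => N N0 N1 N2 u0.
have mi : 0 < m^-1 by rewrite invr_gt0.
have mi1 : m^-1 <= 1 by rewrite invf_le1.
(* as [1 / m <= pi / (2 m)] and [pi / m <= opening], the disc avoids the axis
   and the lower edge *)
have disc v : cmod (v - u0) <= m^-1 / 2 -> [/\ log_domain v, Im v < 0 & Re v < X].
  move=> h.
  have := le_trans (cmod_Re _) h; rewrite ReD ReN ler_norml => /andP[_ h2].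
  have := le_trans (cmod_Im _) h; rewrite ImD ImN ler_norml => /andP[h3 h4].
  rewrite /u0 ReC in h2; rewrite /u0 ImC in h3 h4.
  have h5 : m^-1 <= pi / 2 / m by rewrite ler_peMl ?pihalf_ge1 // ltW.
  have h6 : Im v < 0 by lra.
  split=> //; last by lra.
  split; last by move=> h7; rewrite h7 ltxx in h6.
  apply/andP; split; last exact: lt_trans h6 (lt_le_trans op0 opr).
  have h7 : pi / m <= opening by rewrite ler_pdivrMr // mulrC; case/andP: mop.
  by have : pi / 2 / m * 2 = pi / m by [field; rewrite gt_eqF]; move: h3 h5 mi; lra.
have small v : cmod (v - u0) <= m^-1 / 2 ->
    analytic_at relative_error v /\ cmod (relative_error v) <= 128^-1.
  by move=> /disc[h1 h2 h3]; split; [exact: relative_error_analytic|exact: HX].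
have c0 : cmod (u0 - u0) <= m^-1 / 2 by rewrite subrr cmod0 divr_ge0 // ltW.
have [T0 i0 x0] := disc u0 c0; have [_ e0] := small u0 c0.
have Lc : leading%:C%C != 0 :> C by rewrite -cmod_gt0 cmod_real gtr0_norm.
have [uniq simple] :=
  perturbed_exponential_simple top_ge1 Lc continued_leading small.
(* the leading term at [u0] is [- i] times a large positive number *)
have deep : Im (continued u0) <= - (leading * expR (m * N) / 2).
  have e0E : cexp (- m%:C%C * u0) = Complex 0 (expR (m * N)).
    rewrite /cexp !ReImE oppr0 !mul0r subr0 addr0.
    have -> : - m * - (pi / 2 / m) = pi / 2 by field; rewrite gt_eqF.
    by rewrite cos_pihalf sin_pihalf mulr0 mulr1 mulrNN.
  rewrite continued_leading e0E; move: (relative_error u0) e0 => e he; rewrite !ReImE.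
  have := le_trans (cmod_Re e) he; rewrite ler_norml => /andP[h _].
  have L1 : 0 <= leading * expR (m * N).
    by apply: mulr_ge0; [exact: ltW|exact: expR_ge0].
  have : leading * expR (m * N) * 2^-1 <= leading * expR (m * N) * (1 + Re e).
    by apply: ler_wpM2l => //; lra.
  by lra.
have deepB : Im (continued u0) < - `|B|.
  have NN : N <= expR (m * N) by apply: le_trans (expR_pos_le _); rewrite ler_peMl.
  have : 2 * `|B| < leading * expR (m * N).
    by rewrite [ltRHS]mulrC -ltr_pdivrMr //; move: N2 NN; lra.
  by move: deep; lra.
exists u0; split=> //; first by apply: lt_le_trans deepB _; rewrite oppr_le0.
move=> v hv vE; have [h1 h2] : Re v < X - 1 /\ Im v < 0.
  have : ~ (X - 1 <= Re v \/ 0 <= Im v).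
    move=> /(HB v hv); rewrite vE; have := ler_norm B; move: deepB; lra.
  by move=> h; split; rewrite ltNge; apply/negP => h'; apply: h; [left|right].
apply: uniq => //; first by apply: HX => //; lra.
have -> : Im (- m%:C%C * (v - u0)) = - (m * Im v) - pi / 2.
  by rewrite !ReImE; field; rewrite gt_eqF.
have [/andP[h3 _] _] := hv.
have g3 : m * Im v <= 0 by rewrite mulr_ge0_le0 // ltW.
have g4 : - (m * opening) <= m * Im v by rewrite -mulrN ler_pM2l // ltW.
by case/andP: mop => g1 g2; apply/andP; split; move: g2 g3 g4; lra.
Qed.

(** * The inverse of the continued transform *)

(** The domain lies in a horizontal strip of width at most [2 pi / r]. *)
Lemma power_inj u v : log_domain u -> log_domain v ->
  cexp (r%:C%C * u) = cexp (r%:C%C * v) -> u = v.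
Proof.
move=> [/andP[u1 u2] _] [/andP[v1 v2] _] E.
have rc : r%:C%C != 0 :> C by rewrite -cmod_gt0 cmod_real gtr0_norm.
have : r%:C%C * (u - v) = 0.
  apply: cexp_eq1; first by rewrite mulrBr cexpD E -cexpD subrr cexp0.
  rewrite ImM Re_real Im_real mul0r addr0 ImD ImN normrM gtr0_norm //.
  rewrite mulrC -ltr_pdivlMr // ltr_norml; apply/andP.
  by have : 2 * pi / r = 2 * (pi / r) by [rewrite mulrA]; move: opr; split; lra.
by move/eqP; rewrite mulf_eq0 (negPf rc) subr_eq0 => /eqP.
Qed.

(** Every value of the lower half-plane has a sole preimage. The inequality that
defines sole preimages makes their dependence on the value Lipschitz, hence
complex differentiable. *)
Lemma inverse_univalent : exists h : C -> C,
  (forall w, Im w < 0 -> log_domain (h w) /\ continued (h w) = w /\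
     forall v, log_domain v -> continued v = w -> v = h w) /\
  univalent_on lower_half_plane (fun w => cexp (r%:C%C * h w)).
Proof.
have LP := continued_lower_proper.
have [u0 [T0 i0 U0 S0]] := start_point.
have : forall w : C, exists u, Im w < 0 -> sole_preimage opening log_domain continued w u.
  move=> w; have [w0|w0] := ltP (Im w) 0; last by exists 0.
  by have [u hu] := degree_one LP T0 i0 U0 S0 w0; exists u.
move=> /choice[h hE]; exists h; split.
  move=> w w0; have hw := hE w w0; have [g1 g2 _] := hw; do ! split=> //.
  by move=> v; exact: (sole_preimage_inj LP w0 hw).
split; last first.
  move=> w w'; rewrite !inE => w0 w'0 E; have [g1 <- _] := hE w w0.
  by have [g1' <- _] := hE w' w'0; rewrite (power_inj g1 g1' E).
move=> w w0.
have hw := hE w w0; have [Tw gw _] := hw.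
set B := cmod (h w + Complex 0 (opening + 1)) ^+ 2.
have B0 : 0 < B.
  rewrite exprn_gt0 // cmod_gt0; apply/eqP => /(congr1 (@complex.Im R)).
  rewrite ImD ImC /= => e; have [/andP[g _] _] := Tw; lra.
have w1 : 0 < - Im w by rewrite oppr_gt0.
have B16 : 0 < 16 * B by rewrite mulr_gt0.
pose d := Num.min (- Im w) (- Im w / (16 * B)).
have d0 : 0 < d by rewrite lt_min w1 divr_gt0.
have im w' : cmod (w' - w) < d -> Im w' < 0.
  rewrite lt_min => /andP[h1 _]; have := cmod_Im (w' - w); rewrite ImD ImN.
  by have := ler_norm (Im w' - Im w); lra.
have [c hc] := analytic_cderivative (continued_analytic Tw).
have K0' : 0 < 16 * B / - Im w by rewrite divr_gt0.
have [||_ hh] := cderivative_inverse (h := h) (w := w) K0' d0 _ _ hc.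
- by move=> w' /im w'0; case: (hE w' w'0).
- move=> w' hd; have w'0 := im w' hd; have [T' g' _] := hE w' w'0.
  have [->|ne] := eqVneq w' w; first by rewrite !subrr cmod0 mulr0.
  have p0 : 0 < cmod (w' - w) by rewrite cmod_gt0 subr_eq0.
  apply: (sole_preimage_close LP w0 hw T').
  + by rewrite mulr_gt0.
  + move: hd; rewrite lt_min => /andP[_]; rewrite ltr_pdivlMr // => hd.
    by rewrite mulrAC ler_pdivrMr // mul1r mulrC ltW.
  + rewrite g' -/B [leRHS](_ : _ = 16 * cmod (w' - w) * B) //.
    by field; rewrite lt_eqF.
have [e he] := analytic_cderivative (analytic_cexp_scale r%:C%C (h w)).
exact: cderivative_derivable (cderivative_comp hh he).
Qed.


(** * The inverse of the transform near the origin *)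

Context (mass : Cint a b (fun x => (density x)%:C%C) = 1).

Let br0 : 0 < b `^ r := powR_gt0 r b0.

Lemma transform_at_infinity : exists2 A : R, 0 < A & forall z, 2 * b `^ r <= cmod z ->
  cmod (transform z - z^-1) <= A / cmod z ^+ 2.
Proof.
have [M [M0 HM]] := density_bound.
exists (2 * (b - a) * (M * (2 * b `^ r))); first by rewrite !mulr_gt0 ?subr_gt0.
move=> z hz; have z0 : 0 < cmod z by apply: lt_le_trans hz; rewrite mulr_gt0.
have zn : z != 0 by rewrite -cmod_gt0.
have xr x : a <= x <= b -> 0 <= x `^ r <= b `^ r.
  move=> /andP[ax xb]; rewrite powR_ge0 /=.
  by apply: ge0_ler_powR => //; rewrite ?nnegrE ltW // (lt_le_trans a0).
have dist x : a <= x <= b -> cmod z / 2 <= cmod (z - (x `^ r)%:C%C).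
  move=> /xr/andP[h1 h2]; apply: le_trans (cmod_lerB _ _).
  by rewrite cmod_real ger0_norm //; lra.
have nz x : a <= x <= b -> z - (x `^ r)%:C%C != 0.
  by move=> /dist h; rewrite -cmod_gt0; apply: lt_le_trans h; rewrite divr_gt0.
have c1 := transform_path nz.
have c2 := ccontinuous_onM (@ccontinuous_on_cst R a b (- z^-1)) (density_path).
have -> : transform z - z^-1 = Cint a b (fun x => (density x)%:C%C *
    (z - (x `^ r)%:C%C)^-1 + - z^-1 * (density x)%:C%C).
  have cd := density_path.
  have m1 := ccontinuous_on_measurable c1; have bd1 := ccontinuous_on_bounded c1.
  have m2 := ccontinuous_on_measurable c2; have bd2 := ccontinuous_on_bounded c2.
  have m3 := ccontinuous_on_measurable cd; have bd3 := ccontinuous_on_bounded cd.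
  by rewrite CintD // CintZ // mass mulr1.
rewrite -[leRHS]mulrA -[M * _ / _]mulrA; apply: Cint_norm; first exact: ltW.
  exact: ccontinuous_on_measurable (ccontinuous_onD c1 c2).
move=> x xab; have := nz x xab; have := dist x xab; have := xr x xab.
move: (x `^ r) => y /andP[y0 yb] hd hn.
have -> : (density x)%:C%C * (z - y%:C%C)^-1 +
    - z^-1 * (density x)%:C%C =
    (density x)%:C%C * (y%:C%C * ((z - y%:C%C)^-1 * z^-1)).
  by field; rewrite hn zn.
rewrite cmodM cmod_real ger0_norm ?density_ge0 //; apply: ler_pM.
- exact: density_ge0.
- exact: cmod_ge0.
- exact: HM.
rewrite !cmodM cmod_real ger0_norm // !cmodV.
have -> : 2 * b `^ r / cmod z ^+ 2 = b `^ r * ((cmod z / 2)^-1 * (cmod z)^-1).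
  by field; rewrite gt_eqF.
have i0 : 0 <= (cmod z)^-1 by rewrite invr_ge0 ltW.
apply: ler_pM => //; first by rewrite mulr_ge0 // invr_ge0 cmod_ge0.
by apply: ler_wpM2r => //; rewrite lef_pV2 ?posrE ?divr_gt0 // cmod_gt0.
Qed.

Lemma transform_upper_analytic z : Im z != 0 -> analytic_at transform z.
Proof.
move=> z0; apply: (transform_analytic (d := `|Im z|)).
  by rewrite normr_gt0.
move=> x _; apply: le_trans (cmod_Im _).
by rewrite ImD ImN Im_real subr0.
Qed.

(** Near infinity the transform is close to [1/z], so a value [w] near [0] is
taken close to [1/w], by the maximum principle for the reciprocal of the
difference. *)
Lemma transform_small_value (A : R) w : 0 < A ->
  (forall z, 2 * b `^ r <= cmod z -> cmod (transform z - z^-1) <= A / cmod z ^+ 2) ->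
  w != 0 -> 24 * A + 4 * b `^ r <= cmod w^-1 -> 12 * A <  `|Im w^-1| ->
  exists2 z, cmod (z - w^-1) <= 12 * A & transform z = w.
Proof.
move=> A0 HA w0 h1 h2; apply: contrapT => N.
have cw0 : 0 < cmod w by rewrite cmod_gt0.
have br : 0 < b `^ r := br0.
have wi : 0 < cmod w^-1 by rewrite cmodV invr_gt0.
have N' z : cmod (z - w^-1) <= 12 * A -> transform z - w != 0.
  move=> hz; apply/eqP => /eqP; rewrite subr_eq0 => /eqP e; apply: N; by exists z.
have lowz z : cmod (z - w^-1) <= 12 * A -> cmod w^-1 / 2 <= cmod z <= 2 * cmod w^-1.
  move=> hz; have := cmod_lerB w^-1 z; have := cmod_lerB z w^-1.
  by rewrite [cmod (w^-1 - _)]cmodB => g1 g2; apply/andP; split; lra.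
have imz z : cmod (z - w^-1) <= 12 * A -> Im z != 0.
  move=> hz; apply/eqP => e; have := le_trans (cmod_Im (z - w^-1)) hz.
  by rewrite ImD ImN e add0r normrN; lra.
have an z : cmod (z - w^-1) <= 12 * A -> analytic_at (fun z => (transform z - w)^-1) z.
  move=> hz; apply: analyticV; first exact: N'.
  by apply: analyticB; [apply: transform_upper_analytic; exact: imz|exact: analytic_cst].
have c0 : cmod (w^-1 - w^-1) <= 12 * A by rewrite subrr cmod0 mulr_ge0 // ltW.
(* on the circle, [1/z] differs from [w] by [6 A |w|^2] at least, which exceeds
   the error [4 A |w|^2] by more than the error [A |w|^2] at the centre *)
have near z : cmod (z - w^-1) <= 12 * A -> cmod (transform z - z^-1) <= 4 * A * cmod w ^+ 2.
  move=> hz; have /andP[g1 g2] := lowz z hz.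
  apply: le_trans (HA z _) _; first by lra.
  have z0 : 0 < cmod z by lra.
  rewrite ler_pdivrMr ?exprn_gt0 //.
  have : 1 <= 2 * cmod w * cmod z.
    have := ler_wpM2l (ltW cw0) g1; rewrite cmodV mulrA divff ?gt_eqF //; lra.
  move=> h3; have h4 : 1 <= (2 * cmod w * cmod z) ^+ 2 by rewrite exprn_ege1.
  have -> : 4 * A * cmod w ^+ 2 * cmod z ^+ 2 = A * (2 * cmod w * cmod z) ^+ 2 by ring.
  by rewrite ler_peMr // ltW.
have w2 : 0 < cmod w ^+ 2 by rewrite exprn_gt0.
have M0 : 0 < 2 * A * cmod w ^+ 2 by rewrite !mulr_gt0.
have := max_principle (f := fun z => (transform z - w)^-1)
  (M := (2 * A * cmod w ^+ 2)^-1) (@closed_disc_compact R w^-1 (12 * A)).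
move=> /(_ (fun z hz => analytic_ccontinuous (an z hz))) /(_ _ w^-1 c0) H.
have : cmod (transform w^-1 - w)^-1 <= (2 * A * cmod w ^+ 2)^-1.
  apply: H => z hz; have [hlt|hge] := ltP (cmod (z - w^-1)) (12 * A).
    right; split; first exact: an.
    exists (12 * A - cmod (z - w^-1)); first by rewrite subr_gt0.
    move=> v hv /=; have := cmodD (v - z) (z - w^-1).
    by rewrite addrA subrK; lra.
  have hE : cmod (z - w^-1) = 12 * A by apply/le_anti; rewrite hge hz.
  left; rewrite cmodV lef_pV2 ?posrE //; last by rewrite cmod_gt0 N'.
  have := cmod_lerB (w - z^-1) (transform z - z^-1).
  have -> : w - z^-1 - (transform z - z^-1) = - (transform z - w) by ring.
  rewrite cmodN; have := near z hz => g1 g2.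
  have /andP[g3 g4] := lowz z hz.
  have z0 : z != 0 by rewrite -cmod_gt0; lra.
  have : 6 * A * cmod w ^+ 2 <= cmod (w - z^-1).
    have -> : w - z^-1 = w * ((z - w^-1) * z^-1) by field; rewrite w0 z0.
    rewrite !cmodM hE cmodV.
    have -> : 6 * A * cmod w ^+ 2 = cmod w * (12 * A * (2 * cmod w^-1)^-1).
      by rewrite cmodV; field; rewrite gt_eqF.
    rewrite ler_pM2l // ler_pM2l ?mulr_gt0 // lef_pV2 ?posrE ?mulr_gt0 //.
    by rewrite cmod_gt0.
  by lra.
rewrite cmodV lef_pV2 ?posrE //; last by rewrite cmod_gt0 N'.
have := HA w^-1 _; rewrite invrK; move=> /(_ _); rewrite [cmod w^-1]cmodV exprVn invrK => h.
have : cmod (transform w^-1 - w) <= A * cmod w ^+ 2.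
  by apply: h; move: h1; rewrite cmodV; lra.
have : 0 < A * cmod w ^+ 2 by rewrite mulr_gt0.
by lra.
Qed.

(** A value taken by the transform in the upper half-plane is taken by its
continuation at the logarithm of the point, and nowhere else; so the inverse of
the continuation extends the inverse of the transform. *)
Theorem transform_univalent_inverse : exists (M delta : R) (F : C -> C),
  [/\ 0 < M, 0 < delta, univalent_on (Gamma_domain 2^-1 M) transform,
      univalent_on lower_half_plane F &
      forall w, Lambda_domain 1 delta w ->
        Gamma_domain 2^-1 M (F w) /\ transform (F w) = w].
Proof.
have [h [hE hF]] := inverse_univalent.
have [A A0 HA] := transform_at_infinity; have br : 0 < b `^ r := br0.
pose M := A + 2 * b `^ r; have M0 : 0 < M by rewrite /M; lra.
pose W := 100 * A + 4 * b `^ r + 2 * M; have W0 : 0 < W by rewrite /W; lra.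
(* values taken in the upper half-plane have no other preimage *)
have hz z : 0 < Im z -> Im (transform z) < 0 -> cexp (r%:C%C * h (transform z)) = z.
  move=> z0 iz; have [u hu uz] := upper_log r0 z0.
  have [_ [_ uniq]] := hE _ iz; rewrite -(uniq u) //.
    have /andP[u1 u2] := hu; split; last by move=> e; rewrite e ltxx in u1.
    by rewrite u2 andbT; apply: lt_trans u1; rewrite oppr_lt0.
  by rewrite (continued_upper hu) uz.
have low z : Gamma_domain 2^-1 M z -> Im (transform z) < 0.
  move=> [z0 _ zM]; have zc : M < cmod z.
    by apply: lt_le_trans zM _; apply: le_trans (ler_norm _) (cmod_Im z).
  have c0 : 0 < cmod z by exact: lt_trans zc.
  have := HA z; set p := transform z; move=> /(_ _) H.
  have := cmod_Im (p - z^-1); rewrite ImD ImN Im_inv.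
  have := H _; set E := cmod (p - z^-1) => HE h1.
  have h2 : E <= A / cmod z ^+ 2 by apply: HE; move: zc; rewrite /M; lra.
  have : A / cmod z ^+ 2 < Im z / cmod z ^+ 2.
    by rewrite ltr_pM2r ?invr_gt0 ?exprn_gt0 //; move: zM; rewrite /M; lra.
  have := ler_norm (Im p - - Im z / cmod z ^+ 2); rewrite mulNr opprK.
  by move: h1; rewrite mulNr opprK; lra.
exists M, (2 * W)^-1, (fun w => cexp (r%:C%C * h w)); split=> //.
- by rewrite invr_gt0 mulr_gt0.
- split.
    move=> z [z0 _ _].
    have [c hc] := analytic_cderivative (transform_upper_analytic (lt0r_neq0 z0)).
    exact: cderivative_derivable hc.
  move=> z z'; rewrite !inE => gz gz' E.
  have [z0 _ _] := gz; have [z0' _ _] := gz'.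
  by rewrite -(hz z z0 (low z gz)) -(hz z' z0' (low z' gz')) E.
move=> w [w0]; rewrite mul1r => hw hd.
have wn : w != 0 by apply/eqP => e; rewrite e /= ltxx in w0.
have cw0 : 0 < cmod w by rewrite cmod_gt0.
have c1 : cmod w < (W)^-1.
  have -> : W^-1 = 2 * (2 * W)^-1 by field; rewrite gt_eqF.
  by have := cmod_le w; rewrite (ltr0_norm w0); lra.
have c2 : W < (cmod w)^-1 by rewrite -[ltLHS]invrK ltf_pV2 ?posrE ?invr_gt0.
have iI : (cmod w)^-1 / 2 <= Im w^-1.
  rewrite Im_inv ler_pdivlMr ?exprn_gt0 //.
  have -> : (cmod w)^-1 / 2 * cmod w ^+ 2 = cmod w / 2 by field; rewrite gt_eqF.
  by have := cmod_le w; rewrite (ltr0_norm w0); lra.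
have iR : `|Re w^-1| < Im w^-1.
  have -> : Re w^-1 = Re w / cmod w ^+ 2 by rewrite cmod_sqr; case: (w).
  rewrite Im_inv normrM [`|(_ ^+ 2)^-1|]gtr0_norm ?invr_gt0 ?exprn_gt0 //.
  by rewrite ltr_pM2r ?invr_gt0 ?exprn_gt0.
rewrite /W in c2.
have [||z zw zE] := transform_small_value A0 HA wn.
- by rewrite cmodV; lra.
- by apply: lt_le_trans (ler_norm _); lra.
have := le_trans (cmod_Re _) zw; rewrite ReD ReN => g1.
have := le_trans (cmod_Im _) zw; rewrite ImD ImN ler_norml => /andP[g2 g3].
have g4 : `|Re z| <= `|Re w^-1| + 12 * A.
  by rewrite -[Re z](subrK (Re w^-1)) addrC; apply: le_trans (ler_normD _ _) _; lra.
have Gz : Gamma_domain 2^-1 M z by split; lra.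
have [z0 _ _] := Gz.
by have := hz z z0 (low z Gz); rewrite zE => ->.
Qed.


End Continuation.

(** * The law of the power *)

Section DensityMeasure.
Context {R : realType} (nu : {measure set R -> \bar R}) (p : R -> R).
Context (mp : measurable_fun setT p) (p0 : forall x, 0 <= p x)
  (nuE : forall A, measurable A ->
     nu A = (\int[lebesgue_measure]_(x in A) (p x)%:E)%E).
Local Notation leb := (@lebesgue_measure R).

Lemma integral_density_indic (E : set R) : measurable E ->
  (\int[nu]_x (\1_E x)%:E = \int[leb]_x ((\1_E x)%:E * (p x)%:E))%E.
Proof.
move=> mE; rewrite integral_indic // setIT nuE // integral_mkcond.
apply: eq_integral => x _; rewrite patchE indicE.
by case: ifPn => _; rewrite ?mul1e ?mul0e.
Qed.

Import HBNNSimple.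

Lemma integral_density_nnsfun (f : {nnsfun R >-> R}) :
  (\int[nu]_x (f x)%:E = \int[leb]_x ((f x)%:E * (p x)%:E))%E.
Proof.
have mE r : measurable (f @^-1` [set r]).
  by rewrite -[X in measurable X]setTI; apply: (measurable_funP f).
under [LHS]eq_integral do rewrite fimfunE -fsumEFin//.
rewrite [LHS]ge0_integral_fsum//; last 2 first.
  - by move=> r; exact/measurable_EFinP/measurableT_comp.
  - by move=> n x _; rewrite EFinM nnfun_muleindic_ge0.
under [RHS]eq_integral.
  move=> x xD; rewrite fimfunE -fsumEFin// muleC ge0_mule_fsumr; last first.
    by move=> r; rewrite EFinM nnfun_muleindic_ge0.
  over.
rewrite [RHS]ge0_integral_fsum//; last 2 first.
  - move=> r; apply: emeasurable_funM; first exact/measurable_EFinP.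
    apply/measurable_EFinP; apply: measurable_funM => //; apply: measurable_indic.
    exact: mE.
  - move=> r x _; apply: mule_ge0; first by rewrite lee_fin.
    by rewrite EFinM nnfun_muleindic_ge0.
apply: eq_fsbigr => r /[!inE] -[x _ <-].
have fx : (0 <= f x) by [].
under eq_integral do rewrite EFinM.
rewrite ge0_integralZl // ?lee_fin //.
- rewrite integral_density_indic // -ge0_integralZl // ?lee_fin //.
  + by apply: eq_integral => y _; rewrite EFinM [RHS]muleC muleA.
  + apply: emeasurable_funM; last exact/measurable_EFinP.
    by apply/measurable_EFinP; apply: measurable_indic; exact: mE.
  + by move=> y _; rewrite mule_ge0 ?lee_fin.
- by apply/measurable_EFinP; apply: measurable_indic; exact: mE.
Qed.

Lemma ge0_integral_density (f : R -> \bar R) : measurable_fun setT f ->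
  (forall x, 0 <= f x)%E -> (\int[nu]_x f x = \int[leb]_x (f x * (p x)%:E))%E.
Proof.
move=> mf f0; pose f_ := nnsfun_approx measurableT mf.
transitivity (lim (\int[nu]_x (f_ n x)%:E @[n --> \oo])%E).
  rewrite -monotone_convergence//=.
  - apply: eq_integral => ? /[!inE] xD; apply/esym/cvg_lim => //=.
    exact: cvg_nnsfun_approx.
  - by move=> n; exact/measurable_EFinP/measurable_funTS.
  - by move=> n ? _; rewrite lee_fin.
  - by move=> ? _ ? ? mn; rewrite lee_fin; exact/lefP/nd_nnsfun_approx.
rewrite (_ : (fun n => _) = (fun n => \int[leb]_x ((f_ n x)%:E * (p x)%:E)))%E; last first.
  by apply/funext => n; exact: integral_density_nnsfun.
rewrite -monotone_convergence//=.
- apply: eq_integral => x _; apply/cvg_lim => //=.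
  apply: cvgeZr => //; exact: cvg_nnsfun_approx.
- move=> n; apply: emeasurable_funM; last exact/measurable_EFinP.
  by apply/measurable_EFinP; apply: (measurable_funP (f_ n)).
- by move=> n x _; rewrite mule_ge0 ?lee_fin.
- move=> x _ i j ij; apply: lee_wpmul2r; rewrite lee_fin //.
  by have /lefP := nd_nnsfun_approx measurableT mf ij; exact.
Qed.

Lemma integral_density (f : R -> \bar R) : measurable_fun setT f ->
  (\int[nu]_x f x = \int[leb]_x (f x * (p x)%:E))%E.
Proof.
move=> mf; rewrite integralE [RHS]integralE; congr (_ - _)%E.
  rewrite ge0_integral_density //; last exact: measurable_funepos.
  apply: eq_integral => x _; rewrite !funeposE [LHS]muleC maxe_pMr ?lee_fin //.
  by rewrite mule0 [in RHS]muleC.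
rewrite ge0_integral_density //; last exact: measurable_funeneg.
apply: eq_integral => x _; rewrite !funenegE [LHS]muleC maxe_pMr ?lee_fin //.
by rewrite mule0 muleN [in RHS]muleC.
Qed.

End DensityMeasure.

Section Law.
Context {R : realType} (a b : R) (N : nat) (l alpha : 'I_N -> R).
Context (a0 : 0 < a) (ab : a < b) (alpha0 : forall k, 0 < alpha k).
Local Notation C := R[i].
Local Notation leb := (@lebesgue_measure R).
Local Notation density := (density a b l alpha).

Lemma pdf_density x : GPFP_pdf a b alpha l x = (density \_ `[a, b]) x.
Proof.
rewrite /GPFP_pdf patchE indicE.
case: ifPn => [|/negP hx]; last first.
  rewrite memNset ?mulr0 // => /= hx'; apply: hx.
  by rewrite inE /=; move: hx'; rewrite !in_itv /= => /andP[h1 h2]; rewrite !ltW.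
rewrite inE /= in_itv /= => /andP[ax xb].
rewrite /density /semicircle.
have [/eqP xa|xa] := boolP (x == a).
  by rewrite xa subrr mulr0 sqrtr0 !mul0r.
have [/eqP xb'|xb'] := boolP (x == b).
  by rewrite xb' subrr mul0r sqrtr0 !mul0r.
rewrite mem_set ?mulr1 //= in_itv /= lt_neqAle eq_sym xa ax /=.
by rewrite lt_neqAle xb' xb.
Qed.

Lemma measurable_pdf : measurable_fun setT (GPFP_pdf a b alpha l).
Proof.
rewrite (_ : GPFP_pdf a b alpha l = density \_ `[a, b]); last first.
  by apply/funext => x; exact: pdf_density.
have [h _] := ccontinuous_on_measurable (@density_path R a b N l alpha a0).
exact: (iffLR (measurable_restrictT density (measurable_itv _)) h).
Qed.

Lemma pdf_ge0 x : 0 <= GPFP_pdf a b alpha l x.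
Proof.
rewrite pdf_density patchE; case: ifPn => //.
by rewrite inE /= in_itv /=; exact: density_ge0.
Qed.

Lemma unit_mass :
  (\int[leb]_(x in `[a, b]) (GPFP_pdf a b alpha l x)%:E = 1)%E ->
  Cint a b (fun x => (density x)%:C%C) = 1.
Proof.
move=> h; apply: complex_eqP; last exact: (Im_Cint_eq0 (fun x _ => Im_real (density x))).
rewrite /Cint ReC /Rintegral; have -> : Re (1 : C) = fine (1%E : \bar R) by [].
rewrite -h; congr fine; apply: eq_integral => x xab.
by rewrite pdf_density patchE xab.
Qed.

Context (d : measure_display) (T : measurableType d) (P : probability T R)
  (X : {RV P >-> R}).
Context (X_GPFP : forall A : set R, measurable A -> distribution P X A = GPFP a b alpha l A).

(** Two changes of variables along [X] and along the power, then the density of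
[X]. *)
Lemma integral_power (r M : R) (g : R -> R) : continuous g -> (forall x, `|g x| <= M) ->
  \int[distribution P (RV_powR X r)]_x g x =
  \int[leb]_(x in `[a, b]) (density x * g (x `^ r)).
Proof.
move=> gc gM; rewrite /Rintegral; congr fine.
have mg : measurable_fun setT g by exact: continuous_measurable_fun.
have mp : measurable_fun setT (fun x => g (x `^ r)).
  exact: (@measurableT_comp _ _ _ _ _ _ g _ (@powR R ^~ r)).
have bnd d' (T' : measurableType d') (Q : probability T' R) (f : T' -> R) :
    measurable_fun setT f -> (forall x, `|f x| <= M) -> Q.-integrable setT (EFin \o f).
  move=> mf fM; apply: measurable_bounded_integrable => //.
    by rewrite -ge0_fin_numE // fin_num_measure.
  exists M; split; first exact: num_real.
  by move=> x Mx y _; apply: le_trans (fM y) (ltW Mx).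
rewrite integral_distribution; [|exact/measurable_EFinP|]; last first.
  by apply: bnd => //; apply: measurableT_comp.
transitivity (\int[P]_x ((fun y => (g (y `^ r))%:E) \o X) x)%E; first by [].
rewrite -integral_distribution; [|exact/measurable_EFinP|]; last first.
  by apply: (bnd _ _ P (fun w => g (X w `^ r))) => //; exact: (measurableT_comp mp).
rewrite (integral_density measurable_pdf pdf_ge0 X_GPFP); last exact/measurable_EFinP.
rewrite [RHS]integral_mkcond; apply: eq_integral => x _.
rewrite pdf_density !patchE; case: ifPn => _; last by rewrite mule0.
by rewrite -EFinM mulrC.
Qed.

Lemma Re_inv (z : C) : Re z^-1 = Re z / cmod z ^+ 2.
Proof. by rewrite cmod_sqr; case: z. Qed.

Lemma cauchy_transform_power (r : R) z : Im z != 0 ->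
  cauchy_transform (distribution P (RV_powR X r)) z = transform a b r l alpha z.
Proof.
move=> z0; rewrite /cauchy_transform /transform /Cint.
have dist x : 0 < `|Im z| <= cmod (z - x%:C%C).
  rewrite normr_gt0 z0 /=; apply: le_trans (cmod_Im _).
  by rewrite ImD ImN Im_real subr0.
have n0 x : cmod (z - x%:C%C) ^+ 2 != 0.
  have /andP[h1 h2] := dist x.
  by rewrite expf_neq0 // gt_eqF // (lt_le_trans h1).
have bound x : cmod (z - x%:C%C)^-1 <= `|Im z|^-1.
  have /andP[h1 h2] := dist x; rewrite cmodV lef_pV2 ?posrE //.
  exact: lt_le_trans h2.
have den : continuous (fun x : R => cmod (z - x%:C%C) ^+ 2).
  have -> : (fun x : R => cmod (z - x%:C%C) ^+ 2) =
      (fun x => (Re z - x) ^+ 2 + Im z ^+ 2).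
    by apply/funext => x; rewrite cmod_sqr !ReImE oppr0 addr0.
  move=> x; apply: cvgD; last exact: cvg_cst.
  by apply: (@cvg_comp _ _ _ (fun x => Re z - x) (fun y => y ^+ 2));
    [apply: cvgB; [exact: cvg_cst|exact: cvg_id]|exact: exprn_continuous].
have inv : continuous (fun x : R => (cmod (z - x%:C%C) ^+ 2)^-1).
  by move=> x; apply: cvgV; [exact: n0|exact: den].
have cR : continuous (fun x : R => Re (z - x%:C%C)^-1).
  have -> : (fun x : R => Re (z - x%:C%C)^-1) =
      (fun x => (Re z - x) * (cmod (z - x%:C%C) ^+ 2)^-1).
    by apply/funext => x; rewrite Re_inv ReD ReN.
  move=> x; apply: cvgM; last exact: inv.
  by apply: cvgB; [exact: cvg_cst|exact: cvg_id].
have cI : continuous (fun x : R => Im (z - x%:C%C)^-1).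
  have -> : (fun x : R => Im (z - x%:C%C)^-1) =
      (fun x => - Im z * (cmod (z - x%:C%C) ^+ 2)^-1).
    by apply/funext => x; rewrite Im_inv ImD ImN subr0.
  by move=> x; apply: cvgM; [exact: cvg_cst|exact: inv].
rewrite (integral_power r cR (M := `|Im z|^-1)); last first.
  by move=> x; apply: le_trans (cmod_Re _) (bound x).
rewrite (integral_power r cI (M := `|Im z|^-1)); last first.
  by move=> x; apply: le_trans (cmod_Im _) (bound x).
congr Complex; apply: eq_Rintegral => x _.
  by rewrite [in RHS]ReM Re_real Im_real mul0r subr0.
by rewrite [in RHS]ImM Re_real Im_real mul0r addr0.
Qed.

End Law.

Theorem theorem4p1 (R : realType) (a b : R) (N : nat) (l alpha : 'I_N -> R)
    (d : measure_display) (T : measurableType d) (P : probability T R)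
    (X : {RV P >-> R})
    (a_gt0 : 0 < a) (a_lt_b : a < b)
    (l_incr : forall i j : 'I_N, (i < j)%N -> l i < l j)
    (alpha_gt0 : forall k, 0 < alpha k)
    (pdf_int1 : (\int[lebesgue_measure]_(x in `[a, b])
                   (GPFP_pdf a b alpha l x)%:E = 1)%E)
    (X_GPFP : forall A : set R, measurable A ->
                distribution P X A = GPFP a b alpha l A)
    (l_range : exists2 t : R, 0 <= t & forall k, t <= l k <= t + 1) :
  forall r : R, 1 <= r -> class_UI (distribution P (RV_powR X r)).
Proof.
move=> r r1; have [t t0 lt] := l_range.
have [top topP] : exists top : 'I_N, forall k, k != top -> l k < l top.
  case: N l alpha l_incr pdf_int1 {lt alpha_gt0 X_GPFP l_range} => [|N] l alpha l_incr h.
    (* an empty sum has no mass *)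
    suff : (0 = 1 :> \bar R)%E by move=> /eqP; rewrite eq_sym onee_eq0.
    rewrite -[RHS]h integral0_eq // => x _.
    by rewrite /GPFP_pdf big_ord0 mulr0 mul0r.
  exists ord_max => k km; apply: l_incr; rewrite ltn_neqAle -val_eqE /= in km *.
  by rewrite km -ltnS ltn_ord.
have mass := unit_mass pdf_int1.
have [M [delta [F [M0 d0 [_ injG] uF HF]]]] :=
  transform_univalent_inverse a_gt0 a_lt_b r1 t0 lt alpha_gt0 topP mass.
pose mu := distribution P (RV_powR X r).
have muE z : Im z != 0 -> cauchy_transform mu z = transform a b r l alpha z.
  exact: cauchy_transform_power.
have imG z : Gamma_domain 2^-1 M z -> Im z != 0 by case=> /lt0r_neq0.
exists 1, delta, F, F; split=> //; exists 2^-1, M; split=> //.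
- split.
  + move=> z Gz.
    have i0 : 0 < `|Im z| by rewrite normr_gt0 imG.
    have near v : cmod (v - z) < `|Im z| ->
        transform a b r l alpha v = cauchy_transform mu v.
      move=> h; rewrite muE //; apply/eqP => v0; have := cmod_Im (v - z).
      by rewrite ImD ImN v0 add0r normrN leNgt h.
    have an := transform_upper_analytic r l alpha a_gt0 a_lt_b (imG z Gz).
    have [c hc] := analytic_cderivative (analytic_near i0 near an).
    exact: cderivative_derivable hc.
  + move=> z z' Gz Gz'; rewrite -!/mu !muE; last 2 first.
      exact: imG (set_mem Gz'). exact: imG (set_mem Gz).
    exact: injG.
- move=> w /HF[g e]; exists (F w) => //.
  by rewrite -/mu muE //; exact: imG.
- by move=> w /HF[g e]; rewrite -/mu muE //; exact: imG.
Qed.
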